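(* Let $k\ge 1$ be an integer and let $g=3k-1$. Then the relation $p_{3,1}^{2k}=0$ on the universal Jacobian $\mathcal{J}_g$ gives the top Faber--Zagier relation of genus $3k-1$, in the following sense. Apply the Polishchuk differential operator $\mathcal{D}$ to the monomial $p_{3,1}^{2k}$ exactly $3k$ times. The result $\mathcal{D}^{3k}(p_{3,1}^{2k})$ is a polynomial in $\psi$ and the $p_{0,2n}$ ($n\ge 0$). After substituting $$p_{0,2n}\;\mapsto\;\frac{1}{2^{n+1}}\sum_{r=0}^n \binom{n+1}{r+1}\psi^{n-r}\kappa_r+\psi^n ,\qquad \kappa_0\mapsto 2g-2,$$ (as a $\mathbb{Q}[\psi]$-algebra homomorphism) one obtains an element of the polynomial ring $\mathbb{Q}[\psi,\kappa_1,\kappa_2,\dots]$ that equals a nonzero rational multiple of $$\left[\exp\left(-\{\log A(z)\}_{\vec\kappa}\right)\right]_{z^k}\in\mathbb{Q}[\kappa_1,\kappa_2,\dots],\qquad A(z)=\sum_{n=0}^\infty\frac{(6n)!}{(3n)!(2n)!}\left(\frac{z}{72}\right)^n .$$ In other words, the relation in $R^*(\mathcal{C}_g)$ obtained from $p_{3,1}^{2k}=0$ is, up to a nonzero scalar, the pullback under $\mathcal{C}_g\to\mathcal{M}_g$ of the top Faber--Zagier relation $[\exp(-\{\log A\}_{\vec\kappa})]_{z^k}=0$; in particular, multiplying it by $K$ and pushing forward to $\mathcal{M}_g$ again gives the top Faber--Zagier relation (up to a nonzero scalar).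
   Context: Chow rings have $\mathbb{Q}$-coefficients. $\mathcal{M}_g$ is the moduli space of smooth curves of genus $g\ge 2$, $\mathcal{C}_g=\mathcal{M}_{g,1}\to\mathcal{M}_g$ is the universal curve, $K$ is the first Chern class of its relative dualizing sheaf, and $\kappa_i$ is the pushforward of $K^{i+1}$ to $\mathcal{M}_g$, so $\kappa_0=2g-2$. $R^*(\mathcal{M}_g)$ is the $\mathbb{Q}$-subalgebra of $\mathrm{CH}^*(\mathcal{M}_g)$ generated by the kappa classes; $R^*(\mathcal{C}_g)$ is the subalgebra of $\mathrm{CH}^*(\mathcal{C}_g)$ generated by the kappa classes and $K$. Let $S=\mathcal{C}_g$, let $\mathcal{C}\to S$ be the universal family of genus $g$ curves over $S$, with its section $s:S\to\mathcal{C}$, and let $\mathcal{J}_g=\mathrm{Pic}^0(\mathcal{C}/S)$ be the universal Jacobian, an abelian scheme of relative dimension $g$ over $S$. Let $\iota:\mathcal{C}\to\mathcal{J}_g$ send a point $x$ of a curve $C$ to $\mathcal{O}_C(x-s)$. Let $\mathrm{CH}^i_{(j)}(\mathcal{J}_g)\subset\mathrm{CH}^i(\mathcal{J}_g)$ be the classes on which $m^*$ (pullback by multiplication by $m$) acts by $m^{2i-j}$ for all integers $m$, and set $\mathrm{CH}_{(i,j)}(\mathcal{J}_g)=\mathrm{CH}^{(i+j)/2}_{(j)}(\mathcal{J}_g)$ for $i\equiv j \pmod 2$; one has $\mathrm{CH}^*(\mathcal{J}_g)=\bigoplus_{i,j}\mathrm{CH}_{(i,j)}(\mathcal{J}_g)$.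 Let $\theta$ be the universal theta divisor class (first Chern class of the symmetric, relatively ample line bundle, trivialized along the zero section, associated with the principal polarization), and let $\mathcal{F}(x)=\pi_{2,*}(\pi_1^*x\cdot\exp(\ell))$ be the Fourier--Mukai transform, $\ell$ the first Chern class of the Poincaré bundle. Define $p_{i,j}=\mathcal{F}(\theta^{(j-i+2)/2}\cdot\iota_*[\mathcal{C}]_{(j)})\in\mathrm{CH}_{(i,j)}(\mathcal{J}_g)$, where $[\,\cdot\,]_{(j)}$ is the component in the Beauville decomposition; $p_{i,j}=0$ if $i<0$ or $j<0$ or $j>2g-2$, and $p_{0,0}=g$. Let $\psi=s^*(c_1(\omega_{\mathcal{C}/S}))$, also pulled back to $\mathcal{J}_g$. The tautological ring $R^*(\mathcal{J}_g)$ is the smallest $\mathbb{Q}$-subalgebra of $\mathrm{CH}^*(\mathcal{J}_g)$ containing $\iota_*[\mathcal{C}]$ and stable under $\mathcal{F}$ and all $m^*$; it is generated by $\psi$ and the $p_{i,j}$. The Polishchuk operator acts on polynomials in $\psi$ and the $p_{i,j}$ (with $i,j\ge 0$, $i\equiv j\pmod 2$, and $p_{i,j}=0$ when $i<0$ or $j<0$) by $$\mathcal{D}=\frac12\sum_{i,j,k,l}\left(\psi\,p_{i-1,j-1}p_{k-1,l-1}-\binom{i+k-2}{i-1}p_{i+k-2,j+l}\right)\partial_{p_{i,j}}\partial_{p_{k,l}}+\sum_{i,j}p_{i-2,j}\,\partial_{p_{i,j}} ,$$ with the convention that $\binom{i+k-2}{i-1}=0$ if $i=0$ or $k=0$. It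 represents the action of the element $\mathfrak{f}\in\mathfrak{sl}_2$ on $R^*(\mathcal{J}_g)$ and hence sends relations to relations. Pullback along $\mathcal{J}_g\to S$ identifies $R^*(\mathcal{C}_g)$ with $\bigoplus_{i}R^*_{(0,2i)}(\mathcal{J}_g)$, and under this identification $p_{0,2n}$ corresponds to $\frac{1}{2^{n+1}}\sum_{r=0}^n\binom{n+1}{r+1}\psi^{n-r}\kappa_r+\psi^n$, where $\psi$ is the class $K$ on $\mathcal{C}_g$. For indeterminates $\vec\jmath=(j_0,j_1,\dots)$, the bracket $\{\cdot\}_{\vec\jmath}$ is the $\mathbb{Q}$-linear operation on power series in $z$ with $\{z^n\}_{\vec\jmath}=z^nj_n$; $[\cdot]_{z^k}$ denotes the coefficient of $z^k$; $\vec\kappa=(\kappa_0,\kappa_1,\dots)$ (since $\log A$ has no constant term, $\kappa_0$ does not occur). *)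

(* Defs.v *)
From HB Require Import structures.
From mathcomp Require Import all_boot all_order all_algebra finmap.
From mathcomp.multinomials Require Import monalg.

Set Implicit Arguments.
Unset Strict Implicit.
Unset Printing Implicit Defensive.

Import GRing.Theory Num.Theory.
Local Open Scope ring_scope.

Notation polyring R I := {malg R[{cmonom I}]}.

Section Polynomials.
Variables (R : comNzRingType) (I : choiceType).

Definition pX (i : I) : polyring R I := << ucm i >>.

Definition mev (S : comNzRingType) (h : I -> S) (m : {cmonom I}) : S :=
  \prod_(i <- finsupp m) h i ^+ m i.

(** Evaluation at [h], the coefficients being mapped by [f]. *)
Definition pev (S : comNzRingType) (f : R -> S) (h : I -> S)
    (P : polyring R I) : S :=
  mmap f (mev h) P.

Definition pderiv (i : I) (P : polyring R I) : polyring R I :=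
  \sum_(m <- msupp P) << P@_m *+ m i *g divcm m (ucm i) >>.

Definition pvars (P : polyring R I) : seq I :=
  undup (flatten
    [seq (finsupp m : seq I) | m : {cmonom I} <- (msupp P : seq {cmonom I})]).

End Polynomials.

(** Indices of the variables p_{i,j} : i, j >= 0 and i = j mod 2. *)
Definition pidx : choiceType := {ij : nat * nat | odd ij.1 == odd ij.2}.

Definition fstp (v : pidx) : nat := (val v).1.
Definition sndp (v : pidx) : nat := (val v).2.

(** Q[psi], the variable ['X] being psi. *)
Notation Qpsi := {poly rat}.

Notation Qpsi_p := (polyring Qpsi pidx).

(** p_{i,j}, which is 0 if i < 0 or j < 0.  The pairs violating i = j mod 2
    are also sent to 0; the operator below never produces them. *)
Definition pvar (i j : int) : Qpsi_p :=
  match i, j with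
  | Posz a, Posz b =>
      if insub (a, b) is Some v then pX Qpsi (v : pidx) else 0
  | _, _ => 0
  end.

Definition polbin (i k : nat) : nat :=
  if (i == 0)%N || (k == 0)%N then 0%N else 'C(i + k - 2, i - 1).

Definition polcoef (v w : pidx) : Qpsi_p :=
  let i := fstp v in let j := sndp v in
  let k := fstp w in let l := sndp w in
  'X *: (pvar (i%:Z - 1) (j%:Z - 1) * pvar (k%:Z - 1) (l%:Z - 1))
  - pvar (i%:Z + k%:Z - 2) (j%:Z + l%:Z) *+ polbin i k.

(** The sums over all variables reduce to the variables occurring in [P], since
    the other partial derivatives of [P] vanish. *)
Definition polishchuk (P : Qpsi_p) : Qpsi_p :=
  (2^-1)%:P *: (\sum_(v <- pvars P) \sum_(w <- pvars P)
                  polcoef v w * pderiv v (pderiv w P))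
  + \sum_(v <- pvars P) pvar ((fstp v)%:Z - 2) (sndp v)%:Z * pderiv v P.

(** Q[psi][p_{0,0}, p_{0,2}, p_{0,4}, ...]; the variable of index [n] stands
    for p_{0,2n}. *)
Notation Qpsi_p0 := (polyring Qpsi nat).

Definition incl_p0 (P : Qpsi_p0) : Qpsi_p :=
  pev (in_alg Qpsi_p) (fun n => pvar 0 (2 * n)%N) P.

(** Q[kappa_1, kappa_2, ...]; the variable of index [n] stands for
    kappa_{n+1}. *)
Notation Qkappa := (polyring rat nat).

(** Q[psi, kappa_1, kappa_2, ...] as Q[kappa_1, kappa_2, ...][psi].  Pullback
    along C_g -> M_g is the inclusion of the constant polynomials. *)
Notation Qkappa_psi := {poly Qkappa}.

Definition kappa (g r : nat) : Qkappa :=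
  if r is r'.+1 then pX rat r' else (2 * g - 2)%N%:R.

(** The class corresponding to p_{0,2n}, in a ring [R] with embedding [e] of Q,
    psi being [ps] and kappa_r being [kap r]. *)
Definition p0_formula (R : comNzRingType) (e : rat -> R) (ps : R)
    (kap : nat -> R) (n : nat) : R :=
  e ((2 ^+ n.+1)^-1)
    * (\sum_(r < n.+1) (ps ^+ (n - r) * kap r) *+ 'C(n.+1, r.+1))
  + ps ^+ n.

Definition subst_p0 (g : nat) (P : Qpsi_p0) : Qkappa_psi :=
  pev (map_poly (in_alg Qkappa))
      (p0_formula (fun q => (in_alg Qkappa q)%:P) 'X
                  (fun r => (kappa g r)%:P))
      P.

(** Formal pushforward along C_g -> M_g : it is Q[kappa]-linear and sends
    psi^0 to 0 and psi^(r+1) to kappa_r. *)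
Definition pushforward (g : nat) (P : Qkappa_psi) : Qkappa :=
  \sum_(i < (size P).-1) P`_i.+1 * kappa g i.

(** A power series is given by its sequence of coefficients.  The coefficient
    of z^n in [log f] (for [f 0 = 1]) and in [exp f] (for [f 0 = 0]) only
    depends on the truncation of [f] and on the powers of exponent at most n. *)
Definition series_trunc (R : nzRingType) (f : nat -> R) (n : nat) : {poly R} :=
  \poly_(i < n.+1) f i.

Definition log_series (f : nat -> rat) (n : nat) : rat :=
  (\sum_(1 <= m < n.+1)
     ((-1) ^+ m.-1 / m%:R) *: (series_trunc f n - 1) ^+ m)`_n.

Definition exp_series (R : comAlgType rat) (f : nat -> R) (n : nat) : R :=
  \sum_(m < n.+1) (m`!%:R^-1 : rat) *: (series_trunc f n ^+ m)`_n.

(** The operation {f}_j : z^n is replaced by z^n j_n. *)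
Definition bracket (R : comAlgType rat) (f : nat -> rat) (j : nat -> R)
    (n : nat) : R :=
  f n *: j n.

Definition seriesA (n : nat) : rat :=
  (6 * n)`!%:R / ((3 * n)`!%:R * (2 * n)`!%:R) / 72 ^+ n.

(** [exp(-{log A}_kappa)]_{z^k}; the constant term of [log_series] is 0, hence
    this does not depend on [g]. *)
Definition faber_zagier (g k : nat) : Qkappa :=
  exp_series (fun n => - bracket (log_series seriesA) (kappa g) n) k.

(** The data and properties of the Chow rings of M_g, C_g and J_g through which
    a relation on J_g yields relations on C_g and M_g. *)
Record chow_model (g : nat) := ChowModel {
  CHM : comAlgType rat;
  CHC : comAlgType rat;
  CHJ : comAlgType rat;
  (* pullback and pushforward along C_g -> M_g *)
  pull : {lrmorphism CHM -> CHC};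
  push : {linear CHC -> CHM};
  projection_formula : forall x y, push (pull x * y) = x * push y;
  clK : CHC;
  push_clK : push clK = (2 * g - 2)%N%:R;
  (* pullback along J_g -> C_g, injective because of the zero section *)
  pullJ : {lrmorphism CHC -> CHJ};
  pullJ_inj : injective pullJ;
  clp : pidx -> CHJ;
  clp0 : forall (v : pidx) (n : nat), fstp v = 0%N -> sndp v = (2 * n)%N ->
    clp v = pullJ (p0_formula (in_alg CHC) clK
                     (fun r => pull (push (clK ^+ r.+1))) n);
  polishchuk_relation : forall P : Qpsi_p,
    pev (horner_alg (pullJ clK)) clp P = 0 ->
    pev (horner_alg (pullJ clK)) clp (polishchuk P) = 0
}.

Definition evJ (g : nat) (M : chow_model g) (P : Qpsi_p) : CHJ M :=
  pev (horner_alg (pullJ M (clK M))) (@clp g M) P.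

Definition evM (g : nat) (M : chow_model g) (P : Qkappa) : CHM M :=
  pev (in_alg (CHM M)) (fun n => push M (clK M ^+ n.+2)) P.

Definition evC (g : nat) (M : chow_model g) (P : Qkappa_psi) : CHC M :=
  (map_poly (fun a => pull M (evM M a)) P).[clK M].

(* Main.v *)
(** Set psi to a nonzero rational l and send p_(i,j) to
    <(X - x)^i ((K + l)/2)^((j + 2 - i)/2)> / i!, where x and the symbols
    <X^i K^e> are free variables, < > is linear, and p_(i,j) goes to 0 if
    i > j + 2.  (Formally < > is the integration over the curve and x is the
    coordinate of the marked point.)  This turns the Polishchuk operator into
    the second-order operator L with L(<X^i K^e>) = C(i,2) <X^(i-2) K^(e+1)>,
    Gamma(<X^i K^e>, <X^k K^f>) = - i k <X^(i+k-2) K^(e+f)> and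
    Gamma(x, x) = l, up to an ideal of infinitesimal translations which the
    final evaluation (x = 0, <X^i K^e> = 0 for i > 0,
    <K^e> = kappa_(e-1) + l^(e-1)) kills after any power of L.

    The image of p_(3,1) is <(X - x)^3> / 6.  In genus 3k - 1 it may be replaced
    by (<X^3> - x^3/l) / 6 under L^(3k) and the evaluation: along the segment
    joining these cubics the value has a derivative of the form (t (1 - t) B)'.
    Next, <X^i K^e> - l^(e-1) x^i amounts to forgetting the marked point, so
    that only L^(3k) <X^3>^(2k) without x remains, evaluated at
    <K^e> = kappa_(e-1); in particular psi has disappeared.

    As a function of kappa, this last value and [exp(-{log A})]_(z^k) obey the
    same recursion when a point of weight l is added or removed, l^(e-1) being
    added to each kappa_(e-1): the generating series is multiplied by A(l z).
    A polynomial invariant under all these changes is constant, hence the two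
    agree up to the normalisation.  Finally D lowers the weight given by
    wt p_(i,j) = i by 2, so that D^(3k) p_(3,1)^(2k) only involves the
    p_(0,2n). *)

From HB Require Import structures.
Require Import Defs.
From mathcomp Require Import all_boot all_order all_algebra finmap ring zify.
From mathcomp.multinomials Require Import monalg.

Set Implicit Arguments.
Unset Strict Implicit.
Unset Printing Implicit Defensive.

Import Order.TTheory GRing.Theory Num.Theory.
Local Open Scope ring_scope.

(** * Polynomial rings *)

(** An additive operator whose defect from the Leibniz rule is a biderivation is determined by its
    values and by this defect on constants and variables. Every commutation or intertwining
    statement is therefore checked on generators only. The genus enters at a single point: <K> =
    kappa_0 + 1 = 2g - 1, while 3k = g + 1 operators are applied. With these two values the
    derivative along the segment of cubics becomes exact. The series A counts contractions. If 2a of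
    the 2k factors <X^3> are replaced by -x^3/l, then 3a of the 3k operators must remove the 6a
    copies of x in pairs. This happens in C(2k,2a) C(3k,3a) (6a)!/8^a ways, with weight l^(3a)
    l^(-2a) = l^a. Normalising the k-th value by (3k)! (2k)! 9^k turns the count into (6a)!/((3a)!
    (2a)! 72^a). A rational l, instead of psi itself, makes 1/l available; nothing is lost, since a
    polynomial in psi that vanishes at all nonzero rationals is 0. *)

Section Eval.
Variables (I : choiceType) (S : comNzRingType) (h : I -> S).

Lemma mevEw (m : {cmonom I}) (d : {fset I}) :
  (finsupp m `<=` d)%fset -> mev h m = \prod_(i <- d) h i ^+ m i.
Proof.
move=> sub; rewrite /mev [RHS](big_fsetID _ (mem (finsupp m))) /=.
rewrite [X in _ = _ * X]big_seq_cond [X in _ = _ * X]big1 ?mulr1; last first.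
  move=> i; rewrite andbT !inE /= => /andP[_].
  by rewrite -cmE_eq0 => /eqP->.
apply: eq_fbig_cond => // i; rewrite !inE /= andbT.
by case: (boolP (i \in finsupp m)); rewrite ?andbF // => /(fsubsetP sub) ->.
Qed.

Fact mev_mmorphism : mmorphism (mev h).
Proof.
split=> [m1 m2|]; last by rewrite /mev mdom1 big_seq_fset0.
have s1 := fsubsetUl (finsupp m1) (finsupp m2).
have s2 := fsubsetUr (finsupp m1) (finsupp m2).
rewrite (mevEw s1) (mevEw s2) (@mevEw (mmul m1 m2) (finsupp m1 `|` finsupp m2)%fset).
  by rewrite -big_split /=; apply: eq_bigr => i _; rewrite cmM exprD.
by rewrite mdomD.
Qed.

HB.instance Definition _ :=
  isMultiplicative.Build {cmonom I} S (mev h) mev_mmorphism.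

Lemma mevU i : mev h (ucm i) = h i.
Proof. by rewrite /mev mdomU big_seq_fset1 cmUU expr1. Qed.

Variables (R : comNzRingType) (f : {rmorphism R -> S}).

HB.instance Definition _ := GRing.RMorphism.copy (pev f h) (mmap f (mev h)).

Lemma pevC c : pev f h c%:MP = f c.
Proof. exact: mmapC. Qed.

Lemma pevX i : pev f h (pX R i) = h i.
Proof. by rewrite /pev /pX mmapU /= rmorph1 mul1r mevU. Qed.

Lemma pevZ c P : pev f h (c *: P) = f c * pev f h P.
Proof. exact: mmapZ. Qed.
End Eval.

Section Derivative.
Variables (R : comNzRingType) (I : choiceType).
Local Notation PR := (polyring R I).
Implicit Types (P Q : PR) (i j : I).

Lemma monalgM (c d : R) (m n : {cmonom I}) :
  << c *g m >> * << d *g n >> = << c * d *g mmul m n >> :> PR.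
Proof. by rewrite malgM_def fgmulUU. Qed.

Lemma monalg_ind (K : PR -> Prop) :
  K 0 -> (forall P Q, K P -> K Q -> K (P + Q)) ->
  (forall c (m : {cmonom I}), K << c *g m >>) -> forall P, K P.
Proof.
move=> K0 KD KU P.
by rewrite (monalgE P); apply: big_ind => [//|//|m _]; apply: KU.
Qed.

(** Splitting one variable off a monomial lowers its degree. This is the form in which the
    hypotheses [generated] of the abstract sections are met. *)
Lemma polyring_ind (K : PR -> Prop) :
  (forall c, K c%:MP) -> (forall i, K (pX R i)) ->
  (forall P Q, K P -> K Q -> K (P + Q)) ->
  (forall P Q, K P -> K Q -> K (P * Q)) -> forall P, K P.
Proof.
move=> KC KX KD KM P.
have K0 : K 0 by rewrite -malgC0E; apply: KC.
have K1 : K 1 by rewrite -mpolyC1E; apply: KC.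
move: P; apply: (monalg_ind K0 KD) => c m.
have -> : << c *g m >> = c%:MP * << m >> :> PR.
  by rewrite monalgM mulr1 mul1m.
apply: (KM _ _ (KC c)).
elim: {m}(mdeg m) {-2}m (erefl (mdeg m)) => [m /mdeg_eq0I ->|d IHd m dm].
  exact: K1.
have /fset0Pn[i im] : finsupp m != fset0.
  apply/eqP => m0; move: dm.
  by rewrite mdegE m0 big_seq_fset0.
have e : m = mmul (ucm i) (divcm m (ucm i)).
  apply/eqP/cmP => j; rewrite cmM cmU divcmE cmU subnKC //.
  case: eqP => [<-|//]; by rewrite lt0n cmE_neq0.
have -> : << m >> = pX R i * << divcm m (ucm i) >>.
  by rewrite /pX monalgM mulr1 -e.
apply: (KM _ _ (KX i)); apply: IHd; move: dm.
by rewrite [in mdeg m = _]e mdegM mdegU => -[].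
Qed.

(** Coefficientwise, the support of [P], over which the definition sums, disappears; additivity is
    then immediate. *)
Lemma pderivE i P m :
  (pderiv i P)@_m = P@_(mmul m (ucm i)) *+ (m i).+1.
Proof.
rewrite /pderiv raddf_sum /=.
have key (n : {cmonom I}) : n i != 0%N -> (divcm n (ucm i) == m) = (n == mmul m (ucm i)).
  move=> ni; apply/eqP/eqP => [<-|->].
    apply/eqP/cmP => j; rewrite cmM cmU divcmE cmU subnK //.
    by case: eqP => [<-|//]; rewrite lt0n.
  by apply/eqP/cmP => j; rewrite divcmE cmM cmU addnK.
rewrite (eq_bigr (fun n => (P@_n *+ n i) *+ (n == mmul m (ucm i)))); last first.
  move=> n _; rewrite mcoeffU; case: (eqVneq (n i) 0%N) => [->|ni].
    by rewrite mulr0n !mul0rn.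
  by rewrite key.
case: (boolP ((mmul m (ucm i)) \in msupp P)) => mP.
  rewrite (big_fsetD1 (mmul m (ucm i))) //= eqxx big_seq big1 ?addr0; last first.
    by move=> n; rewrite in_fsetD1 => /andP[/negbTE-> _]; rewrite mulr0n.
  by rewrite cmM cmUU addn1 mulr1n.
rewrite big_seq big1; first by rewrite (mcoeff_outdom mP) mul0rn.
move=> n nP; case: eqP => [e|]; last by rewrite mulr0n.
by rewrite -e nP in mP.
Qed.

Fact pderiv_additive i : additive (pderiv i : PR -> PR).
Proof.
move=> P Q; apply/malgP => m; rewrite mcoeffB [X in X = _]pderivE.
by rewrite [X in _ = X - _]pderivE [X in _ = _ - X]pderivE mcoeffB mulrnBl.
Qed.

HB.instance Definition _ i :=
  GRing.isAdditive.Build PR PR (pderiv i) (pderiv_additive i).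

Lemma pderiv0 i : pderiv i (0 : PR) = 0.
Proof. exact: (raddf0 (pderiv i)). Qed.

Lemma pderivD i P Q : pderiv i (P + Q) = pderiv i P + pderiv i Q.
Proof. exact: (raddfD (pderiv i)). Qed.

Lemma pderivU i c m :
  pderiv i (<< c *g m >> : PR) = << c *+ m i *g divcm m (ucm i) >>.
Proof.
apply/malgP => n; rewrite pderivE !mcoeffU.
case: eqP => [->|ne].
  have -> : divcm (mmul n (ucm i)) (ucm i) = n.
    by apply/eqP/cmP => j; rewrite divcmE cmM cmU addnK.
  by rewrite eqxx cmM cmUU addn1 !mulr1n.
rewrite mulr0n mul0rn; case: (eqVneq (m i) 0%N) => [->|mi].
  by rewrite mulr0n mul0rn.
case: eqP => [e|]; last by rewrite mulr0n.
case: ne; apply/eqP/cmP => j; rewrite -e cmM divcmE cmU subnK //.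
by case: eqP => [<-|//]; rewrite lt0n.
Qed.

Lemma pderivC i c : pderiv i (c%:MP : PR) = 0.
Proof. by rewrite pderivU cm1 mulr0n monalgU0. Qed.

Lemma pderivX i j : pderiv i (pX R j) = (i == j)%:R.
Proof.
rewrite pderivU cmU eq_sym; case: eqP => [->|_]; last by rewrite mulr0n monalgU0.
have -> : divcm (ucm j) (ucm j) = mone.
  by apply/eqP/cmP => k; rewrite divcmE cm1 subnn.
exact: mpolyC1E.
Qed.

Lemma pderivM i P Q :
  pderiv i (P * Q) = pderiv i P * Q + P * pderiv i Q.
Proof.
move: P; apply: monalg_ind => [|P1 P2 IH1 IH2|c m].
- by rewrite pderiv0 !mul0r pderiv0 addr0.
- by rewrite mulrDl !pderivD !mulrDl addrACA; exact: (congr2 +%R IH1 IH2).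
move: Q; apply: monalg_ind => [|Q1 Q2 IH1 IH2|d n].
- by rewrite pderiv0 !mulr0 pderiv0 addr0.
- by rewrite mulrDr !pderivD !mulrDr addrACA; exact: (congr2 +%R IH1 IH2).
rewrite [in LHS]monalgM [LHS]pderivU [X in _ = X * _ + _]pderivU.
rewrite [X in _ = _ + _ * X]pderivU.
rewrite [X in _ = X + _]monalgM [X in _ = _ + X]monalgM cmM mulrnDr [LHS]monalgUD.
rewrite mulrnAl mulrnAr; apply: congr2.
  case: (eqVneq (m i) 0%N) => [->|mi]; first by rewrite !mulr0n !monalgU0.
  suff -> : divcm (mmul m n) (ucm i) = mmul (divcm m (ucm i)) n by [].
  apply/eqP/cmP => j.
  rewrite !(divcmE, cmM, cmU); case: eqP => [<-|]; last by rewrite !subn0.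
  by rewrite addnBAC // lt0n.
case: (eqVneq (n i) 0%N) => [->|ni]; first by rewrite !mulr0n !monalgU0.
suff -> : divcm (mmul m n) (ucm i) = mmul m (divcm n (ucm i)) by [].
apply/eqP/cmP => j.
rewrite !(divcmE, cmM, cmU); case: eqP => [<-|]; last by rewrite !subn0.
by rewrite addnBA // lt0n.
Qed.

Lemma pderiv_notin i P : i \notin pvars P -> pderiv i P = 0.
Proof.
move=> iP; rewrite /pderiv big_seq big1 // => m mP.
have -> : m i = 0%N; last by rewrite mulr0n monalgU0.
apply/eqP; rewrite cmE_eq0; apply: contra iP => im.
rewrite /pvars mem_undup; apply/flattenP; exists (finsupp m : seq I) => //.
by apply/mapP; exists m.
Qed.

(** The list [pvars P] varies with [P]. Enlarging it without changing the sum lets several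
    polynomials share one list. *)
Lemma pvars_sum (V : zmodType) (F : I -> V) (s : seq I) P :
  uniq s -> {subset pvars P <= s} -> (forall i, pderiv i P = 0 -> F i = 0) ->
  \sum_(i <- pvars P) F i = \sum_(i <- s) F i.
Proof.
move=> us sub F0; rewrite [RHS](bigID (mem (pvars P))) /=.
rewrite [X in _ + X]big1 ?addr0; last by move=> i /pderiv_notin/F0.
rewrite -[RHS]big_filter; apply/perm_big/uniq_perm; rewrite ?filter_uniq ?undup_uniq //.
by move=> i; rewrite mem_filter; case: (boolP (i \in pvars P)) => // /sub ->.
Qed.

End Derivative.

(** * Second-order operators and derivations *)

(** The "carre du champ" of [L], a biderivation when [L] is a second-order operator. *)
Definition carre (A : comNzRingType) (L : A -> A) (a b : A) : A :=
  L (a * b) - a * L b - b * L a.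

Record diffop2 (A : comNzRingType) (L : A -> A) : Prop := Diffop2 {
  diffop2D : {morph L : a b / a + b};
  carreMl : forall a b c,
    carre L (a * b) c = a * carre L b c + b * carre L a c
}.

Record derivation (A : comNzRingType) (d : A -> A) : Prop := Derivation {
  derivationD : {morph d : a b / a + b};
  derivationM : forall a b, d (a * b) = a * d b + b * d a
}.

Lemma eq_carre (A : comNzRingType) (L L' : A -> A) a b :
  L =1 L' -> carre L a b = carre L' a b.
Proof. by move=> e; rewrite /carre !e. Qed.

Lemma eq_diffop2 (A : comNzRingType) (L L' : A -> A) :
  L =1 L' -> diffop2 L' -> diffop2 L.
Proof.
by move=> e [h1 h2]; split=> [a b|a b c]; rewrite ?e ?h1 // !(eq_carre _ _ e).
Qed.

Section Diffop2.
Variables (A : comNzRingType) (L : A -> A).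
Hypothesis HL : diffop2 L.
Implicit Types a b c : A.

Lemma diffop2M a b : L (a * b) = a * L b + b * L a + carre L a b.
Proof. by rewrite /carre; ring. Qed.

Lemma carreC a b : carre L a b = carre L b a.
Proof. by rewrite /carre (mulrC b a); ring. Qed.

Lemma carreDl a b c : carre L (a + b) c = carre L a c + carre L b c.
Proof. by rewrite /carre mulrDl !(diffop2D HL); ring. Qed.

Lemma carreMr a b c : carre L a (b * c) = b * carre L a c + c * carre L a b.
Proof. by rewrite carreC (carreMl HL) !(carreC a). Qed.

Lemma carreDr a b c : carre L a (b + c) = carre L a b + carre L a c.
Proof. by rewrite carreC carreDl !(carreC a). Qed.

Lemma diffop20 : L 0 = 0.
Proof. by apply: (addIr (L 0)); rewrite -(diffop2D HL) !add0r. Qed.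

Lemma diffop2N a : L (- a) = - L a.
Proof. by apply: (addIr (L a)); rewrite -(diffop2D HL) !addNr diffop20. Qed.

Lemma diffop2B a b : L (a - b) = L a - L b.
Proof. by rewrite (diffop2D HL) diffop2N. Qed.

Lemma diffop2_sum (J : Type) (s : seq J) (F : J -> A) :
  L (\sum_(j <- s) F j) = \sum_(j <- s) L (F j).
Proof. exact: (big_morph L (diffop2D HL) diffop20). Qed.

Lemma diffop2Mn a n : L (a *+ n) = L a *+ n.
Proof. by elim: n => [|n IH]; rewrite ?mulr0n ?diffop20 // !mulrS (diffop2D HL) IH. Qed.

Lemma carreNl a b : carre L (- a) b = - carre L a b.
Proof. by rewrite /carre mulNr !diffop2N; ring. Qed.

Lemma carreMn a b n : carre L (a *+ n) b = carre L a b *+ n.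
Proof.
elim: n => [|n IH]; last by rewrite !mulrS carreDl IH.
by rewrite !mulr0n /carre mul0r diffop20; ring.
Qed.

Lemma carre_suml (J : Type) (s : seq J) (F : J -> A) c :
  carre L (\sum_(j <- s) F j) c = \sum_(j <- s) carre L (F j) c.
Proof.
apply: (big_morph (fun a => carre L a c)) => [a b|]; first exact: carreDl.
by rewrite /carre mul0r diffop20; ring.
Qed.

Lemma diffop2_derivation a : derivation (carre L a).
Proof.
split=> [b c|b c]; first exact: carreDr.
by rewrite carreMr.
Qed.

End Diffop2.

Section Derivation.
Variables (A : comNzRingType) (d : A -> A).
Hypothesis Hd : derivation d.

Lemma derivation0 : d 0 = 0.
Proof. by apply: (addIr (d 0)); rewrite -(derivationD Hd) !add0r. Qed.

Lemma derivationN a : d (- a) = - d a.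
Proof. by apply: (addIr (d a)); rewrite -(derivationD Hd) !addNr derivation0. Qed.

Lemma derivation_sum (J : Type) (s : seq J) (F : J -> A) :
  d (\sum_(j <- s) F j) = \sum_(j <- s) d (F j).
Proof. exact: (big_morph d (derivationD Hd) derivation0). Qed.

Lemma derivationMn a n : d (a *+ n) = d a *+ n.
Proof. by elim: n => [|n IH]; rewrite ?mulr0n ?derivation0 // !mulrS (derivationD Hd) IH. Qed.

Lemma derivation1 : d 1 = 0.
Proof.
have := derivationM Hd 1 1; rewrite !mul1r => e.
by apply: (addIr (d 1)); rewrite add0r -e.
Qed.

Lemma derivationX a n : d (a ^+ n.+1) = a ^+ n * d a *+ n.+1.
Proof.
elim: n => [|n IH]; first by rewrite expr1 expr0 mul1r.
rewrite exprS (derivationM Hd) IH [in RHS]mulrS addrC; congr (_ + _).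
by rewrite mulrnAr mulrA -exprS.
Qed.

End Derivation.

(** * Extending second-order identities from generators *)

Section Generators.
Variables (A : comNzRingType) (C I : Type) (cst : C -> A) (X : I -> A).
Hypothesis generated : forall K : A -> Prop,
  (forall c, K (cst c)) -> (forall i, K (X i)) ->
  (forall P Q, K P -> K Q -> K (P + Q)) ->
  (forall P Q, K P -> K Q -> K (P * Q)) -> forall P, K P.

Section Ind.
Variables (B : comNzRingType) (phi : A -> B) (N : B -> Prop).
Hypothesis ND : forall a b, N a -> N b -> N (a + b).
Hypothesis NM : forall P a, N a -> N (phi P * a).
Variables (E : A -> B) (F : A -> A -> B).
Hypothesis ED : {morph E : P Q / P + Q}.
Hypothesis EM : forall P Q, E (P * Q) = phi P * E Q + phi Q * E P + F P Q.
Hypothesis FC : forall P Q, F P Q = F Q P.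
Hypothesis FD : forall P Q S, F (P + Q) S = F P S + F Q S.
Hypothesis FM : forall P Q S, F (P * Q) S = phi P * F Q S + phi Q * F P S.
Hypothesis Econst : forall c, N (E (cst c)).
Hypothesis Fconst : forall c Q, N (F (cst c) Q).
Hypothesis Egen : forall i, N (E (X i)).
Hypothesis Fgen : forall i j, N (F (X i) (X j)).

(** [F] is the carre du champ of [E]: its two Leibniz rules spread [N] from generators to all pairs,
    after which [EM] spreads it to [E]. Stability of [N] is asked only under the image of [phi],
    because [translation_ideal] is merely a module over the translation-invariant elements. *)
Lemma second_order_ind P : N (E P).
Proof.
have F1 i Q : N (F (X i) Q).
  move: Q; apply: generated => [c|j|P1 P2 H1 H2|P1 P2 H1 H2].
  - by rewrite FC; apply: Fconst.
  - exact: Fgen.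
  - by rewrite FC FD !(FC _ (X i)); apply: ND.
  - by rewrite FC FM !(FC _ (X i)); apply: ND; apply: NM.
have F2 S Q : N (F S Q).
  move: S; apply: generated => [c|j|P1 P2 H1 H2|P1 P2 H1 H2].
  - exact: Fconst.
  - exact: F1.
  - by rewrite FD; apply: ND.
  - by rewrite FM; apply: ND; apply: NM.
move: P; apply: generated => [c|j|P1 P2 H1 H2|P1 P2 H1 H2].
- exact: Econst.
- exact: Egen.
- by rewrite ED; apply: ND.
- by rewrite EM; apply: ND => //; apply: ND; apply: NM.
Qed.
End Ind.

Section Intertwine.
Variables (B : comNzRingType) (g : {rmorphism A -> A}) (h : {rmorphism A -> B}).
Variables (D : A -> A) (L : B -> B) (N : B -> Prop).
Hypothesis HD : diffop2 D.
Hypothesis HL : diffop2 L.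
Hypothesis N0 : N 0.
Hypothesis ND : forall a b, N a -> N b -> N (a + b).
Hypothesis NM : forall P a, N a -> N (h (g P) * a).
Hypothesis gC : forall c, g (cst c) = (cst c).
Hypothesis DC : forall c, D (cst c) = 0.
Hypothesis DCM : forall c P, carre D (cst c) P = 0.
Hypothesis LC : forall c, L (h (cst c)) = 0.
Hypothesis LCM : forall c b, carre L (h (cst c)) b = 0.
Hypothesis gen : forall i, N (L (h (g (X i))) - h (D (g (X i)))).
Hypothesis gen2 : forall i j,
  N (carre L (h (g (X i))) (h (g (X j)))
     - h (carre D (g (X i)) (g (X j)))).

(** The endomorphism [g] cuts out the subring on which the comparison can hold. It is the truncation
    in the case of the Polishchuk operator and the identity when a point is added. *)
Lemma intertwine_mod P : N (L (h (g P)) - h (D (g P))).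
Proof.
pose F P Q := carre L (h (g P)) (h (g Q)) - h (carre D (g P) (g Q)).
pose E P := L (h (g P)) - h (D (g P)).
rewrite -/(E P).
apply: (@second_order_ind _ (fun P => h (g P)) N ND NM E F); rewrite /E /F => *.
- by move=> a b; rewrite !rmorphD (diffop2D HL) (diffop2D HD) !rmorphD; ring.
- by rewrite !rmorphM (diffop2M L) (diffop2M D) !rmorphD !rmorphM; ring.
- by rewrite carreC [in X in _ - X]carreC.
- by rewrite (rmorphD g) (rmorphD h) (carreDl HL) (carreDl HD) (rmorphD h); ring.
- rewrite (rmorphM g) (rmorphM h) (carreMl HL) (carreMl HD) (rmorphD h).
  by rewrite 2!(rmorphM h); ring.
- by rewrite gC DC LC rmorph0 subr0.
- by rewrite gC DCM LCM rmorph0 subr0.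
- exact: gen.
- exact: gen2.
Qed.
End Intertwine.

Section Commutator.
Variables (d L : A -> A) (m : nat).
Hypothesis Hd : derivation d.
Hypothesis HL : diffop2 L.
Hypothesis dC : forall c, d (cst c) = 0.
Hypothesis LC : forall c, L (cst c) = 0.
Hypothesis LCM : forall c P, carre L (cst c) P = 0.
Hypothesis gen : forall i,
  d (L (X i)) = L (d (X i)) - L (X i) *+ m.
Hypothesis gen2 : forall i j,
  d (carre L (X i) (X j)) =
  carre L (d (X i)) (X j) + carre L (X i) (d (X j))
  - carre L (X i) (X j) *+ m.

(** The operator dL - Ld + mL is again of second order, with carre du champ [F]. The values of [m]
    that occur are 0 for translations, 4 for twice the degree of the Gaussian model, and 2 for the
    weight of the Polishchuk operator. *)
Lemma derivation_commutator P : d (L P) = L (d P) - L P *+ m.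
Proof.
pose E P := d (L P) - L (d P) + L P *+ m.
pose F P Q := d (carre L P Q) - carre L (d P) Q - carre L P (d Q)
  + carre L P Q *+ m.
suff: E P = 0 by rewrite /E => /eqP; rewrite addr_eq0 => /eqP e; rewrite -[d _](subrK (L (d P))) e addrC.
have zD (a b : A) : a = 0 -> b = 0 -> a + b = 0 by move=> -> ->; rewrite addr0.
have zM (a b : A) : b = 0 -> id a * b = 0 by move=> ->; rewrite mulr0.
apply: (@second_order_ind _ id (fun b => b = 0) zD zM E F); rewrite /E /F.
- move=> a b; rewrite !((diffop2D HL), (derivationD Hd)); ring.
- move=> S Q; rewrite !(derivationM Hd) (diffop2M L) !((diffop2D HL), (derivationD Hd), (derivationM Hd)).
  by rewrite !(diffop2M L) (carreC L _ (d S)); ring.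
- by move=> S Q; rewrite (carreC L S) (carreC L _ Q) (carreC L _ (d Q)); ring.
- by move=> S Q T; rewrite !(carreDl HL, derivationD Hd); ring.
- by move=> S Q T; rewrite !(carreMl HL, derivationD Hd, derivationM Hd, carreDl HL); ring.
- by move=> c; rewrite LC dC (diffop20 HL) (derivation0 Hd) mul0rn; ring.
- move=> c Q; rewrite !LCM dC (derivation0 Hd) mul0rn.
  by rewrite /carre mul0r (diffop20 HL); ring.
- by move=> i; rewrite gen; ring.
- by move=> i j; rewrite gen2; ring.
Qed.
End Commutator.
End Generators.

Lemma derivation_scale (A : comNzRingType) (d : A -> A) c a :
  derivation d -> d c = 0 -> d (c * a) = c * d a.
Proof. by move=> hd c0; rewrite (derivationM hd) c0 mulr0 addr0. Qed.

Lemma derivation_homogeneous (A : comNzRingType) (d : A -> A) (psi a b c : A) (i k m : nat) :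
  derivation d -> d psi = 0 -> d a = a *+ i -> d b = b *+ k -> d c = c *+ (i + k) ->
  d (psi * (a * b) - c *+ m) =
  (psi * (a * b) - c *+ m) *+ i.+1 + (psi * (a * b) - c *+ m) *+ k.+1
  - (psi * (a * b) - c *+ m) *+ 2.
Proof.
move=> hd d0 da db dc; rewrite (derivationD hd) (derivationN hd) (derivationMn hd).
rewrite (derivation_scale _ hd d0) (derivationM hd) da db dc; ring.
Qed.

Lemma derivation_commutator_iter (A : comNzRingType) (d D : A -> A) w n P :
  derivation d -> (forall Q, d (D Q) = D (d Q) - D Q *+ 2) ->
  (forall Q m, D (Q *+ m) = D Q *+ m) -> (2 * n <= w)%N ->
  d P = P *+ w -> d (iter n D P) = iter n D P *+ (w - 2 * n).
Proof.
move=> hd hc hm + dP; elim: n => [|n IH] nw; first by rewrite muln0 subn0.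
rewrite iterS hc IH; last by lia.
by rewrite hm -mulrnBr; [congr (_ *+ _); lia|lia].
Qed.

(** * Elements of weight 0 *)

Section EulerKernel.
Variables (A : comNzRingType) (C I : Type) (cst : C -> A) (X : I -> A).
Hypothesis generated : forall K : A -> Prop,
  (forall c, K (cst c)) -> (forall i, K (X i)) ->
  (forall P Q, K P -> K Q -> K (P + Q)) ->
  (forall P Q, K P -> K Q -> K (P * Q)) -> forall P, K P.
Hypothesis A_torsion_free : forall (a : A) j, a *+ j.+1 = 0 -> a = 0.
Variables (wt : I -> nat) (d : A -> A).
Hypothesis Hd : derivation d.
Hypothesis dC : forall c, d (cst c) = 0.
Hypothesis dX : forall i, d (X i) = X i *+ wt i.
Variables (grade : {rmorphism A -> {poly A}}) (part0 : {rmorphism A -> A}).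
Hypothesis gradeC : forall c, grade (cst c) = (cst c)%:P.
Hypothesis gradeX : forall i, grade (X i) = (X i)%:P * 'X^(wt i).
Hypothesis part0C : forall c, part0 (cst c) = cst c.
Hypothesis part0X : forall i, part0 (X i) = if wt i == 0%N then X i else 0.

Lemma grade_euler P : grade (d P) = 'X * (grade P)^`().
Proof.
move: P; apply: generated => [c|i|P Q IP IQ|P Q IP IQ].
- by rewrite dC rmorph0 gradeC derivC mulr0.
- rewrite dX rmorphMn /= gradeX derivM derivC mul0r add0r derivXn.
  case: (wt i) => [|w]; first by rewrite !mulr0n !mulr0.
  by rewrite /= !mulrnAr mulrCA -exprS.
- by rewrite (derivationD Hd) !rmorphD derivD mulrDr IP IQ.
- by rewrite (derivationM Hd) rmorphD !rmorphM derivM IP IQ; ring.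
Qed.

Lemma grade1 P : (grade P).[1] = P.
Proof.
move: P; apply: generated => [c|i|P Q IP IQ|P Q IP IQ].
- by rewrite gradeC hornerC.
- by rewrite gradeX hornerM hornerC hornerXn expr1n mulr1.
- by rewrite rmorphD hornerD IP IQ.
- by rewrite rmorphM hornerM IP IQ.
Qed.

Lemma grade0 P : (grade P).[0] = part0 P.
Proof.
move: P; apply: generated => [c|i|P Q IP IQ|P Q IP IQ].
- by rewrite gradeC hornerC part0C.
- rewrite gradeX hornerM hornerC hornerXn expr0n part0X.
  by case: eqP => _; rewrite ?mulr1 ?mulr0.
- by rewrite !rmorphD hornerD IP IQ.
- by rewrite !rmorphM hornerM IP IQ.
Qed.

(** Scaling each variable by t to its weight turns [d] into t d/dt. A polynomial killed by [d] is
    thus constant in t, and its values at t = 1 and t = 0 are [P] and [part0 P]. *)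
Lemma euler_kernel P : d P = 0 -> part0 P = P.
Proof.
move=> dP; have dg : (grade P)^`() = 0.
  apply/polyP => i; have := grade_euler P; rewrite dP rmorph0.
  by move=> /(congr1 (fun p : {poly A} => p`_i.+1)); rewrite coefXM /= !coef0 => <-.
rewrite -grade0 -[RHS]grade1.
have -> : grade P = ((grade P)`_0)%:P; last by rewrite !hornerC.
apply/polyP => -[|i]; rewrite coefC //=.
by apply: (A_torsion_free (j := i)); rewrite -coef_deriv dg coef0.
Qed.
End EulerKernel.

(** * Second-order operators given by coefficients *)

Section ConcreteOperators.
Variables (A : comNzRingType) (I : eqType) (X : I -> A).
Variables (dd : I -> A -> A) (vars : A -> seq I).
Hypothesis ddD : forall i, derivation (dd i).
Hypothesis ddX : forall i j, dd i (X j) = (i == j)%:R.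
Hypothesis ddC : forall i j P, dd i (dd j P) = dd j (dd i P).
Hypothesis vars_uniq : forall P, uniq (vars P).
Hypothesis varsE : forall (V : zmodType) (F : I -> V) (s : seq I) P,
  uniq s -> {subset vars P <= s} -> (forall i, dd i P = 0 -> F i = 0) ->
  \sum_(i <- vars P) F i = \sum_(i <- s) F i.
Variables (half : A) (gam : I -> I -> A) (lam : I -> A).

(** A common shape for the Polishchuk operator, the two Gaussian operators and, with [half = 0], the
    Euler field. *)
Definition dop (P : A) : A :=
  half * (\sum_(v <- vars P) \sum_(w <- vars P) gam v w * dd v (dd w P))
  + \sum_(v <- vars P) lam v * dd v P.

Lemma dopE s P : uniq s -> {subset vars P <= s} ->
  dop P = half * (\sum_(v <- s) \sum_(w <- s) gam v w * dd v (dd w P))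
    + \sum_(v <- s) lam v * dd v P.
Proof.
move=> us sub; rewrite /dop; congr (_ * _ + _); last first.
  by apply: varsE => // i ->; rewrite mulr0.
rewrite (varsE us sub) => [|i i0]; last first.
  by apply: big1 => j _; rewrite ddC i0 (derivation0 (ddD j)) mulr0.
apply: eq_bigr => v _; apply: varsE => // w ->.
by rewrite (derivation0 (ddD v)) mulr0.
Qed.

Lemma common_vars (s : seq A) :
  exists2 t, uniq t & forall P, P \in s -> {subset vars P <= t}.
Proof.
exists (undup (flatten [seq vars P | P <- s])); first exact: undup_uniq.
move=> P Ps i iP; rewrite mem_undup; apply/flattenP.
by exists (vars P) => //; apply: map_f.
Qed.

Lemma carre_dopE s P Q : uniq s ->
  {subset vars P <= s} -> {subset vars Q <= s} -> {subset vars (P * Q) <= s} ->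
  carre dop P Q = half * \sum_(v <- s) \sum_(w <- s)
    gam v w * (dd v P * dd w Q + dd w P * dd v Q).
Proof.
move=> us sP sQ sPQ; rewrite /carre (dopE us sP) (dopE us sQ) (dopE us sPQ).
have -> : \sum_(v <- s) lam v * dd v (P * Q) =
    P * (\sum_(v <- s) lam v * dd v Q) + Q * (\sum_(v <- s) lam v * dd v P).
  rewrite !mulr_sumr -big_split /=; apply: eq_bigr => v _.
  by rewrite (derivationM (ddD v)); ring.
have -> : \sum_(v <- s) \sum_(w <- s) gam v w * dd v (dd w (P * Q)) =
    P * (\sum_(v <- s) \sum_(w <- s) gam v w * dd v (dd w Q))
    + Q * (\sum_(v <- s) \sum_(w <- s) gam v w * dd v (dd w P))
    + \sum_(v <- s) \sum_(w <- s)
       gam v w * (dd v P * dd w Q + dd w P * dd v Q).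
  rewrite !mulr_sumr -!big_split /=; apply: eq_bigr => v _.
  rewrite !mulr_sumr -!big_split /=; apply: eq_bigr => w _.
  rewrite !(derivationM (ddD _), derivationD (ddD _)); ring.
by ring.
Qed.

Lemma dop_diffop2 : diffop2 dop.
Proof.
split=> [P Q|P Q S].
  have [s us sub] := common_vars [:: P; Q; P + Q].
  rewrite !(dopE us (sub _ _)) ?inE ?eqxx ?orbT // addrACA -mulrDr -!big_split /=.
  congr (_ * _ + _); apply: eq_bigr => v _; last by rewrite (derivationD (ddD _)) mulrDr.
  by rewrite -big_split /=; apply: eq_bigr => w _; rewrite !(derivationD (ddD _)) mulrDr.
have [s us sub] := common_vars [:: P; Q; S; P * Q; P * Q * S; Q * S; P * S].
rewrite !(carre_dopE us (sub _ _) (sub _ _) (sub _ _)) ?inE ?eqxx ?orbT //.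
rewrite !(mulrCA _ half) -mulrDr; congr (_ * _); rewrite !mulr_sumr -big_split /=.
apply: eq_bigr => v _; rewrite !mulr_sumr -!big_split /=; apply: eq_bigr => w _.
by rewrite !(derivationM (ddD _)); ring.
Qed.

Lemma dop_derivation : half = 0 -> derivation dop.
Proof.
move=> half0; split=> [P Q|P Q]; first exact: (diffop2D dop_diffop2).
have [s us sub] := common_vars [:: P; Q; P * Q].
rewrite (diffop2M dop) (carre_dopE us) ?half0 ?mul0r ?addr0 //;
  by apply: sub; rewrite !inE eqxx ?orbT.
Qed.

Lemma dop_vanish c : (forall i, dd i c = 0) -> dop c = 0.
Proof.
move=> c0; rewrite /dop [X in _ + X]big1 => [|v _]; last by rewrite c0 mulr0.
rewrite big1 ?mulr0 ?addr0 // => v _; apply: big1 => w _.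
by rewrite c0 (derivation0 (ddD v)) mulr0.
Qed.

Lemma carre_dop_vanish c P : (forall i, dd i c = 0) -> carre dop c P = 0.
Proof.
move=> c0; have [s us sub] := common_vars [:: c; P; c * P].
rewrite (carre_dopE us) ?(sub _ _) ?inE ?eqxx ?orbT //; try by apply: sub; rewrite !inE eqxx ?orbT.
rewrite big1 ?mulr0 // => v _; apply: big1 => w _.
by rewrite !c0 !mul0r addr0 mulr0.
Qed.

Lemma sum_dd_var (V : nmodType) (s : seq I) (F : I -> V) i :
  uniq s -> i \in s -> \sum_(v <- s) F v *+ (v == i) = F i.
Proof.
move=> us si; rewrite (bigD1_seq i) //= eqxx mulr1n big1 ?addr0 //.
by move=> j /negbTE->.
Qed.

Lemma dopX i : dop (X i) = lam i.
Proof.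
pose s := undup (i :: vars (X i)).
have us : uniq s := undup_uniq _.
have sub : {subset vars (X i) <= s} by move=> j jX; rewrite mem_undup inE jX orbT.
have si : i \in s by rewrite mem_undup inE eqxx.
rewrite (dopE us sub) big1 => [|v _]; last first.
  apply: big1 => w _; rewrite ddX.
  have -> : dd v (w == i)%:R = 0 by rewrite derivationMn // derivation1 // mul0rn.
  by rewrite mulr0.
rewrite mulr0 add0r -[RHS](sum_dd_var lam us si); apply: eq_bigr => v _.
by rewrite ddX mulr_natr.
Qed.

Lemma carre_dopX i j : carre dop (X i) (X j) = half * (gam i j + gam j i).
Proof.
have [t ut sub] := common_vars [:: X i; X j; X i * X j].
pose s := undup (i :: j :: t).
have us : uniq s := undup_uniq _.
have sub' P : P \in [:: X i; X j; X i * X j] -> {subset vars P <= s}.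
  by move=> /sub h k /h kt; rewrite mem_undup !inE kt !orbT.
have si : i \in s by rewrite mem_undup inE eqxx.
have sj : j \in s by rewrite mem_undup !inE eqxx orbT.
rewrite (carre_dopE us) ?(sub' _ _) //; try by apply: sub'; rewrite !inE eqxx ?orbT.
congr (_ * _); rewrite -(sum_dd_var (fun v => gam v j) us si) -(sum_dd_var (fun v => gam v i) us sj).
rewrite -big_split /=; apply: eq_bigr => v _.
transitivity (\sum_(w <- s) ((gam v w *+ (w == j)) *+ (v == i)
    + (gam v w *+ (w == i)) *+ (v == j))).
  apply: eq_bigr => w _; rewrite !ddX; do ?case: eqP => _;
  by rewrite ?(mulr0n, mulr1n, mulr1, mulr0, mul0r, mul1r, addr0, add0r, mulrDr).
by rewrite big_split /= !sumrMnl (sum_dd_var (gam v) us sj) (sum_dd_var (gam v) us si).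
Qed.

Lemma rmorph_dop_vanish (S : comNzRingType) (ev : {rmorphism A -> S}) P :
  (forall v w, ev (gam v w) = 0) -> (forall v, ev (lam v) = 0) -> ev (dop P) = 0.
Proof.
move=> g0 l0; rewrite rmorphD rmorphM !rmorph_sum /= [X in _ + X]big1 => [|v _].
  rewrite big1 ?mulr0 ?addr0 // => v _; rewrite rmorph_sum big1 // => w _.
  by rewrite rmorphM g0 mul0r.
by rewrite rmorphM l0 mul0r.
Qed.
End ConcreteOperators.

(** * The Gaussian model *)

(* [r i e] is <X^i K^e> and [x] is the marked point. *)
Section GaussianModel.
Variables (T : comNzRingType) (C : Type) (cst : C -> T).
Variable X : option (nat * nat) -> T.
Hypothesis generated : forall K : T -> Prop,
  (forall c, K (cst c)) -> (forall i, K (X i)) ->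
  (forall P Q, K P -> K Q -> K (P + Q)) ->
  (forall P Q, K P -> K Q -> K (P * Q)) -> forall P, K P.
Local Notation x := (X None).
Local Notation r i e := (X (Some (i, e))).
Variables (l li : T) (L : T -> T).
Hypothesis lli : l * li = 1.
Hypothesis HL : diffop2 L.
Hypothesis LC : forall c, L (cst c) = 0.
Hypothesis LCM : forall c P, carre L (cst c) P = 0.
Hypothesis Ll : L l = 0.
Hypothesis LlM : forall P, carre L l P = 0.
Hypothesis Lli : L li = 0.
Hypothesis LliM : forall P, carre L li P = 0.
Hypothesis Lx : L x = 0.
Hypothesis Lr : forall i e, L (r i e) = r (i - 2)%N e.+1 *+ 'C(i, 2).
Hypothesis cxx : carre L x x = l.
Hypothesis cxr : forall i e, carre L x (r i e) = 0.
Hypothesis crr : forall i e k f,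
  carre L (r i e) (r k f) = - (r (i + k - 2)%N (e + f)%N *+ (i * k)).

(* <X^i> without the contribution of the marked point. *)
Definition rhat i : T := r i 0%N - li * x ^+ i.
(* The infinitesimal translation r_(i,e) |-> i r_(i-1,e), x |-> 1. *)
Definition shift (P : T) : T := - carre L (rhat 1) P.
(* Twice the Euler field of the grading in which r_(i,e) has degree i and x degree 1. *)
Definition euler2 (P : T) : T := - carre L (rhat 2) P.

Lemma carre_derivation a : derivation (carre L a).
Proof. exact: diffop2_derivation. Qed.

Lemma shift_derivation : derivation shift.
Proof.
split=> a b; rewrite /shift; first by rewrite (carreDr HL) opprD.
by rewrite (carreMr HL); ring.
Qed.

Lemma euler2_derivation : derivation euler2.
Proof.
split=> a b; rewrite /euler2; first by rewrite (carreDr HL) opprD.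
by rewrite (carreMr HL); ring.
Qed.

Lemma carre_li a b : carre L (li * a) b = li * carre L a b.
Proof. by rewrite (carreMl HL) LliM mulr0 addr0. Qed.

Lemma carrex_li a b : carre L a (li * b) = li * carre L a b.
Proof. by rewrite carreC carre_li carreC. Qed.

Lemma carreB a b c : carre L (a - b) c = carre L a c - carre L b c.
Proof. by rewrite (carreDl HL) (carreNl HL). Qed.

Lemma shift_r i e : shift (r i e) = r i.-1 e *+ i.
Proof.
rewrite /shift /rhat carreB expr1 carre_li cxr mulr0 subr0 crr opprK.
by rewrite mul1n add0n add1n subSS subn1.
Qed.

Lemma shift_x : shift x = 1.
Proof.
rewrite /shift /rhat carreB expr1 carre_li cxx carreC cxr.
by rewrite sub0r opprK mulrC lli.
Qed.

Lemma carre_x2 b : carre L (x ^+ 2) b = x * carre L x b *+ 2.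
Proof. by rewrite expr2 (carreMl HL) mulr2n. Qed.

Lemma euler2_r i e : euler2 (r i e) = r i e *+ (2 * i).
Proof.
rewrite /euler2 /rhat carreB carre_li carre_x2 cxr mulr0 mul0rn mulr0 subr0 crr opprK.
by rewrite add0n addKn.
Qed.

Lemma euler2_x : euler2 x = x *+ 2.
Proof.
rewrite /euler2 /rhat carreB carre_li carre_x2 cxx carreC cxr sub0r opprK.
by rewrite mulrnAr mulrCA (mulrC li) lli mulr1.
Qed.

Lemma shift_cst c : shift (cst c) = 0.
Proof. by rewrite /shift carreC LCM oppr0. Qed.

Lemma euler2_cst c : euler2 (cst c) = 0.
Proof. by rewrite /euler2 carreC LCM oppr0. Qed.

Lemma shift_l : shift l = 0. Proof. by rewrite /shift carreC LlM oppr0. Qed.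
Lemma shift_li : shift li = 0. Proof. by rewrite /shift carreC LliM oppr0. Qed.
Lemma euler2_l : euler2 l = 0. Proof. by rewrite /euler2 carreC LlM oppr0. Qed.

Lemma carre0l b : carre L 0 b = 0.
Proof. by rewrite /carre mul0r (diffop20 HL); ring. Qed.

Lemma carre1l b : carre L 1 b = 0.
Proof. by rewrite -lli (carreMl HL) LlM LliM !mulr0 addr0. Qed.

Lemma diffop21 : L 1 = 0.
Proof. by have := carre1l 1; rewrite /carre !mul1r subrr sub0r => /eqP; rewrite oppr_eq0 => /eqP. Qed.

Lemma carreMnr a b n : carre L a (b *+ n) = carre L a b *+ n.
Proof. by rewrite carreC (carreMn HL) carreC. Qed.

(** Infinitesimal form of the invariance of [L] under a simultaneous translation of X and x. *)
Lemma shiftL P : shift (L P) = L (shift P).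
Proof.
rewrite -[RHS]subr0 -[X in _ - X](mulr0n (L P)).
apply: (derivation_commutator generated shift_derivation HL shift_cst LC LCM).
  move=> [[i e]|]; last by rewrite Lx shift_x (derivation0 shift_derivation) diffop21 mulr0n subr0.
  rewrite Lr (derivationMn shift_derivation) !shift_r (diffop2Mn HL) Lr mulr0n subr0.
  rewrite -!mulrnA; case: i => [|[|[|i]]]; [exact: erefl|exact: erefl|exact: erefl|].
  have -> : (i.+3 - 2).-1 = (i.+3.-1 - 2)%N by lia.
  congr (_ *+ _); have := mul_bin_diag i.+3 1; have := mul_bin_diag i.+2 1.
  by rewrite !bin1 /= subn2 /=; nia.
move=> [[i e]|] [[k f]|]; rewrite mulr0n subr0.
- rewrite crr (derivationN shift_derivation) (derivationMn shift_derivation) !shift_r.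
  rewrite (carreMn HL) carreMnr !crr -!mulNrn -!mulrnA.
  case: i => [|i]; first by rewrite !(mul0n, muln0, mulr0n, oppr0, addr0, subr0).
  case: k => [|k]; first by rewrite !(mul0n, muln0, mulr0n, oppr0, addr0, subr0).
  have -> : (i.+1 + k.+1 - 2 = i + k)%N by lia.
  have -> : (i.+1.-1 + k.+1 - 2 = (i + k).-1)%N by lia.
  have -> : (i.+1 + k.+1.-1 - 2 = (i + k).-1)%N by lia.
  by rewrite -mulrnDr; congr (_ *+ _) => /=; lia.
- by rewrite shift_r (carreMn HL) shift_x ![carre L (r _ _) _]carreC !cxr carre1l mul0rn addr0 (derivation0 shift_derivation).
- by rewrite cxr shift_r carreMnr cxr shift_x carre1l mul0rn addr0 (derivation0 shift_derivation).
- by rewrite cxx shift_l shift_x (carreC L x 1) !carre1l addr0.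
Qed.

(** [L] lowers the degree by 2, and [euler2] counts the degree twice. *)
Lemma euler2L P : euler2 (L P) = L (euler2 P) - L P *+ 4.
Proof.
apply: (derivation_commutator generated euler2_derivation HL euler2_cst LC LCM).
  move=> [[i e]|]; last by rewrite euler2_x (diffop2Mn HL) Lx (derivation0 euler2_derivation) !mul0rn subr0.
  rewrite euler2_r (diffop2Mn HL) Lr (derivationMn euler2_derivation) euler2_r -!mulrnA.
  case: i => [|[|i]]; [by rewrite subr0|by rewrite subr0|].
  by rewrite -mulrnBr; [congr (_ *+ _); lia|nia].
move=> [[i e]|] [[k f]|].
- rewrite crr (derivationN euler2_derivation) (derivationMn euler2_derivation) !euler2_r.
  rewrite (carreMn HL) carreMnr !crr.
  case: i => [|i]; first by rewrite !(mul0n, muln0, mulr0n, oppr0, addr0, subr0, mul0rn).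
  case: k => [|k]; first by rewrite !(mul0n, muln0, mulr0n, oppr0, addr0, subr0, mul0rn).
  have -> : (i.+1 + k.+1 - 2 = i + k)%N by lia.
  ring.
- by rewrite euler2_r (carreMn HL) euler2_x carreMnr ![carre L (r _ _) _]carreC cxr (derivation0 euler2_derivation) !mul0rn addr0 subr0.
- by rewrite cxr euler2_r carreMnr euler2_x (carreMn HL) cxr (derivation0 euler2_derivation) !mul0rn addr0 subr0.
- by rewrite cxx euler2_l euler2_x (carreMn HL) carreMnr cxx -mulrnDr subrr.
Qed.

Lemma carre_r0 e P : carre L (r 0%N e) P = 0.
Proof.
move: P; apply: generated => [c|[[i f]|]|P Q IP IQ|P Q IP IQ].
- by rewrite carreC LCM.
- by rewrite crr mul0n mulr0n oppr0.
- by rewrite carreC cxr.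
- by rewrite (carreDr HL) IP IQ addr0.
- by rewrite (carreMr HL) IP IQ !mulr0 addr0.
Qed.

Lemma L_r0M e P : L (r 0%N e * P) = r 0%N e * L P.
Proof. by rewrite (diffop2M L) carre_r0 Lr bin0n mulr0n; ring. Qed.

Lemma L_liM P : L (li * P) = li * L P.
Proof. by rewrite (diffop2M L) LliM Lli; ring. Qed.

Lemma L_rhat0M P : L (rhat 0 * P) = rhat 0 * L P.
Proof.
by rewrite /rhat expr0 mulr1 !mulrBl (diffop2B HL) L_r0M L_liM.
Qed.

Lemma L_rhat1M P : L (rhat 1 * P) = rhat 1 * L P - shift P.
Proof.
have -> : shift P = - carre L (rhat 1) P by [].
rewrite (diffop2M L).
have -> : L (rhat 1) = 0; last by ring.
by rewrite /rhat expr1 (diffop2B HL) L_liM Lx Lr bin_small // mulr0n mulr0 subr0.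
Qed.

Lemma L_rhat2M P :
  L (rhat 2 * P) = rhat 2 * L P + (r 0%N 1%N - 1) * P - euler2 P.
Proof.
have -> : euler2 P = - carre L (rhat 2) P by [].
rewrite (diffop2M L).
have -> : L (rhat 2) = r 0%N 1%N - 1; last by ring.
rewrite /rhat (diffop2B HL) L_liM Lr binn mulr1n expr2 (diffop2M L) Lx cxx.
by rewrite mulr0 !add0r (mulrC li) lli.
Qed.

Lemma iterL_D n P Q : iter n L (P + Q) = iter n L P + iter n L Q.
Proof. by elim: n => //= n ->; rewrite (diffop2D HL). Qed.

Lemma iterL_rhat0M n P : iter n L (rhat 0 * P) = rhat 0 * iter n L P.
Proof. by elim: n => //= n ->; rewrite L_rhat0M. Qed.

Lemma iterL_shift n P : shift (iter n L P) = iter n L (shift P).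
Proof. by elim: n => //= n <-; rewrite shiftL. Qed.

Lemma iterL_rhat1M n P :
  iter n.+1 L (rhat 1 * P) = rhat 1 * iter n.+1 L P - iter n L (shift P) *+ n.+1.
Proof.
elim: n => [|n IH]; first by rewrite /= L_rhat1M.
rewrite iterS IH (diffop2B HL) (diffop2Mn HL) L_rhat1M iterL_shift -!iterS.
by rewrite [in RHS]mulrS; ring.
Qed.

(** An sl_2-type computation: by [L_rhat2M], commuting [rhat 2] past one [L] costs <K> - 1 -
    [euler2]. Moving all Euler fields to the left of the remaining [L] then costs 4 (0 + 1 + ... +
    n) = 2n (n + 1). *)
Lemma iterL_rhat2M n P :
  iter n.+1 L (rhat 2 * P) = rhat 2 * iter n.+1 L P
   + (r 0%N 1%N - 1 - (2 * n)%:R) * iter n L P *+ n.+1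
   - euler2 (iter n L P) *+ n.+1.
Proof.
elim: n => [|n IH]; first by rewrite /= L_rhat2M; ring.
rewrite iterS IH (diffop2B HL) (diffop2D HL) !(diffop2Mn HL) L_rhat2M.
have -> : L ((r 0%N 1%N - 1 - (2 * n)%:R) * iter n L P)
    = (r 0%N 1%N - 1 - (2 * n)%:R) * iter n.+1 L P.
  by rewrite !mulrBl !(diffop2B HL) L_r0M !mul1r !mulr_natl (diffop2Mn HL).
have -> : L (euler2 (iter n L P)) = euler2 (iter n.+1 L P) + iter n.+1 L P *+ 4.
  by rewrite iterS euler2L subrK.
rewrite -!iterS; ring.
Qed.

(** * Deforming the cubic *)

Section Translation.
Variables (S : comNzRingType) (ev : {rmorphism T -> S}) (n : nat).
Hypothesis S_torsion_free : forall (a : S) j, a *+ j.+1 = 0 -> a = 0.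
Hypothesis ev_x : ev x = 0.
Hypothesis ev_r : forall i e, ev (r i.+1 e) = 0.
Hypothesis ev_r00 : ev (r 0%N 0%N) = ev li.
Hypothesis ev_r01 : ev (r 0%N 1%N) + 1 = (2 * n)%:R.

(** The evaluation sees only degree 0, where the Euler field vanishes. *)
Lemma ev_euler2 P : ev (euler2 P) = 0.
Proof.
move: P; apply: generated => [c|[[i e]|]|P Q IP IQ|P Q IP IQ].
- by rewrite euler2_cst rmorph0.
- rewrite euler2_r rmorphMn; case: i => [|i]; first by rewrite muln0 mulr0n.
  by rewrite /= ev_r mul0rn.
- by rewrite euler2_x rmorphMn /= ev_x mul0rn.
- by rewrite (derivationD euler2_derivation) rmorphD IP IQ addr0.
- by rewrite (derivationM euler2_derivation) rmorphD !rmorphM IP IQ !mulr0 addr0.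
Qed.

Definition expect j (P : T) : S := ev (iter j L P).

Lemma expectD j P Q : expect j (P + Q) = expect j P + expect j Q.
Proof. by rewrite /expect iterL_D rmorphD. Qed.

Lemma expect0 j : expect j 0 = 0.
Proof. by apply: (addIr (expect j 0)); rewrite -expectD !add0r. Qed.

Lemma expectN j P : expect j (- P) = - expect j P.
Proof. by apply: (addIr (expect j P)); rewrite -expectD !addNr expect0. Qed.

Lemma expectMn j P a : expect j (P *+ a) = expect j P *+ a.
Proof. by elim: a => [|a IH]; rewrite ?mulr0n ?expect0 // !mulrS expectD IH. Qed.

Lemma expect_rhat0 j P : expect j (rhat 0 * P) = 0.
Proof.
rewrite /expect iterL_rhat0M rmorphM.
by rewrite /rhat expr0 mulr1 rmorphB ev_r00 subrr mul0r.
Qed.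

Lemma expect_rhat1 j P : expect j.+1 (rhat 1 * P) = - (expect j (shift P) *+ j.+1).
Proof.
rewrite /expect iterL_rhat1M rmorphB rmorphM rmorphMn.
by rewrite /rhat expr1 rmorphB rmorphM /= ev_x ev_r mulr0 subrr mul0r sub0r.
Qed.

(** The only use of the value of <K>: [ev_r01] turns <K> - 1 - 2n into -2, whatever [P] is. *)
Lemma expect_rhat2 P : expect n.+1 (rhat 2 * P) = - (expect n P *+ (2 * n.+1)).
Proof.
have e2 : ev (rhat 2) = 0.
  by rewrite /rhat rmorphB rmorphM rmorphXn ev_x ev_r expr0n mulr0 subrr.
rewrite /expect iterL_rhat2M rmorphB rmorphD rmorphM !rmorphMn rmorphM /=.
by rewrite ev_euler2 e2 !rmorphB rmorph1 rmorph_nat -ev_r01; ring.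
Qed.

Definition coefwise (V W : nzRingType) (f : V -> W) (P : {poly V}) : {poly W} :=
  \poly_(i < size P) f P`_i.

Lemma coef_coefwise (V W : nzRingType) (f : V -> W) P i :
  f 0 = 0 -> (coefwise f P)`_i = f P`_i.
Proof. by move=> f0; rewrite coef_poly; case: ltnP => // /leq_sizeP ->. Qed.

(** Only the two ends of the segment are evaluated; the powers of 0 and 1 are 0 or 1, so additivity
    of [f] suffices. *)
Lemma coefwise_horner_nat (V W : nzRingType) (f : V -> W) P (a : bool) :
  {morph f : u v / u + v} -> f 0 = 0 -> (coefwise f P).[a%:R] = f P.[a%:R].
Proof.
move=> fD f0; have szf : (size (coefwise f P) <= size P)%N by apply: size_poly.
rewrite (horner_coef_wide _ szf) horner_coef (big_morph f fD f0).
apply: eq_bigr => i _; rewrite (coef_coefwise _ _ f0).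
case: a; first by rewrite !expr1n !mulr1.
by case: (nat_of_ord i) => [|j]; rewrite ?expr0 ?mulr1 // !exprS !mul0r !mulr0.
Qed.

Lemma shift0 : shift 0 = 0.
Proof. exact: derivation0 shift_derivation. Qed.

Lemma coef_expect j (F : {poly T}) i : (coefwise (expect j) F)`_i = expect j F`_i.
Proof. exact: coef_coefwise (expect0 j). Qed.

Lemma coef_shift (F : {poly T}) i : (coefwise shift F)`_i = shift F`_i.
Proof. exact: coef_coefwise shift0. Qed.

Lemma shiftp_derivation : derivation (coefwise shift).
Proof.
split=> F G; apply/polyP => i.
  by rewrite coefD !coef_shift coefD (derivationD shift_derivation).
rewrite coefD coef_shift !coefM.
rewrite (derivation_sum shift_derivation).
rewrite (eq_bigr _ (fun j _ => derivationM shift_derivation _ _)) big_split /=.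
congr (_ + _); first by apply: eq_bigr => j _; rewrite coef_shift.
rewrite [RHS](reindex_inj rev_ord_inj) /=; apply: eq_bigr => j _.
by rewrite coef_shift subSS subKn // -ltnS.
Qed.

Lemma shiftpC a : coefwise shift a%:P = (shift a)%:P.
Proof.
by apply/polyP => -[|i]; rewrite coef_shift !coefC //= shift0.
Qed.

Lemma shiftpX : coefwise shift 'X = 0.
Proof.
apply/polyP => i; rewrite coef_shift coefX coef0.
by case: eqP => _; rewrite ?shift0 //= (derivation1 shift_derivation).
Qed.

Lemma expectp_rhat0 j (F : {poly T}) : coefwise (expect j) ((rhat 0)%:P * F) = 0.
Proof. by apply/polyP => i; rewrite coef_expect coefCM expect_rhat0 coef0. Qed.

Lemma expectp_rhat1 j (F : {poly T}) :
  coefwise (expect j.+1) ((rhat 1)%:P * F) = - (coefwise (expect j) (coefwise shift F) *+ j.+1).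
Proof.
by apply/polyP => i; rewrite coefN coefMn !coef_expect coefCM expect_rhat1 coef_shift.
Qed.

Lemma expectp_rhat2 (F : {poly T}) :
  coefwise (expect n.+1) ((rhat 2)%:P * F) = - (coefwise (expect n) F *+ (2 * n.+1)).
Proof. by apply/polyP => i; rewrite coefN coefMn !coef_expect coefCM expect_rhat2. Qed.

Lemma expectpX j (F : {poly T}) : coefwise (expect j) ('X * F) = 'X * coefwise (expect j) F.
Proof.
apply/polyP => i; rewrite coef_expect !coefXM coef_expect.
by case: eqP => // _; rewrite expect0.
Qed.

Lemma expectpD j (F G : {poly T}) : coefwise (expect j) (F + G) = coefwise (expect j) F + coefwise (expect j) G.
Proof. by apply/polyP => i; rewrite coefD !coef_expect coefD expectD. Qed.

Lemma expectpN j (F : {poly T}) : coefwise (expect j) (- F) = - coefwise (expect j) F.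
Proof. by apply/polyP => i; rewrite coefN !coef_expect coefN expectN. Qed.

Lemma expectpMn j (F : {poly T}) a : coefwise (expect j) (F *+ a) = coefwise (expect j) F *+ a.
Proof. by apply/polyP => i; rewrite coefMn !coef_expect coefMn expectMn. Qed.

Lemma deriv_expectp j (F : {poly T}) : (coefwise (expect j) F)^`() = coefwise (expect j) F^`().
Proof. by apply/polyP => i; rewrite coef_deriv !coef_expect coef_deriv expectMn. Qed.

(* In the parameter ['X], it joins <X^3> - x^3/l (at 0) to <(X - x)^3> (at 1). *)
Definition cubic : {poly T} :=
  (rhat 3)%:P - 'X * x%:P * (rhat 2)%:P *+ 3
  + 'X ^+ 2 * x%:P ^+ 2 * (rhat 1)%:P *+ 3 - 'X ^+ 3 * x%:P ^+ 3 * (rhat 0)%:P.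

(** With t for ['X], this is <(X - t x)^2> - ((1 - t) x)^2 / l, just as [cubic] is <(X - t x)^3> -
    ((1 - t) x)^3 / l. *)
Definition quadric : {poly T} :=
  (rhat 2)%:P - 'X * x%:P * (rhat 1)%:P *+ 2 + 'X ^+ 2 * x%:P ^+ 2 * (rhat 0)%:P.

Lemma deriv_cubic : cubic^`() = - (x%:P * quadric *+ 3).
Proof. by rewrite /cubic /quadric !derivE; ring. Qed.

Lemma shift_rhat i : shift (rhat i.+1) = rhat i *+ i.+1.
Proof.
rewrite /rhat (derivationD shift_derivation) (derivationN shift_derivation).
rewrite (derivationM shift_derivation) shift_li shift_r (derivationX shift_derivation) shift_x.
by rewrite mulr0 addr0 mulr1 mulrnAr -mulrnBl.
Qed.

Lemma shift_rhat0 : shift (rhat 0) = 0.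
Proof.
rewrite /rhat expr0 mulr1 (derivationD shift_derivation) (derivationN shift_derivation).
by rewrite shift_li shift_r mulr0n subr0.
Qed.

Lemma shift_cubic : coefwise shift cubic = (1 - 'X) * quadric *+ 3.
Proof.
have Hs := shiftp_derivation.
rewrite /cubic !(derivationD Hs, derivationN Hs, derivationMn Hs, derivationM Hs, derivationX Hs).
rewrite shiftpX !shiftpC shift_rhat0 !shift_rhat shift_x.
by rewrite /quadric !polyCMn; ring.
Qed.

(** In the derivative of the power of [cubic], the term in [rhat 2] loses one [L] by [expect_rhat2],
    the term in [rhat 1] by [expect_rhat1], and the term in [rhat 0] vanishes. With B' = -3Z the
    outcome is a multiple of (1 - 2t) B + t (1 - t) B', whose primitive t (1 - t) B is 0 at both
    ends. *)
Lemma expect_cubic m :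
  expect n.+1 ((r 3%N 0%N - x * r 2%N 0%N *+ 3 + x ^+ 2 * r 1%N 0%N *+ 3
     - x ^+ 3 * r 0%N 0%N) ^+ m) = expect n.+1 (rhat 3 ^+ m).
Proof.
case: m => [//|m].
pose A := coefwise (expect n.+1) (cubic ^+ m.+1).
pose B := coefwise (expect n) (x%:P * cubic ^+ m).
(* The constant is the product of 3 (m + 1), from differentiating the power of [cubic], and 2 (n +
   1), from [expect_rhat2]. *)
pose G := A - ('X * (1 - 'X) * B) *+ (6 * m.+1 * n.+1).
pose d3 := cubic ^+ m.-1 * quadric *+ m.
pose Z := coefwise (expect n) (x%:P ^+ 2 * d3).
have deriv_pow : (cubic ^+ m)^`() = - (x%:P * d3 *+ 3).
  by rewrite deriv_exp deriv_cubic /d3; ring.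
have shift_pow : coefwise shift (cubic ^+ m) = (1 - 'X) * d3 *+ 3.
  rewrite /d3; case: (m) => [|j].
    by rewrite expr0 (derivation1 shiftp_derivation) mulr0n mulr0 mul0rn.
  by rewrite (derivationX shiftp_derivation) shift_cubic /=; ring.
have B' : B^`() = - (Z *+ 3).
  rewrite /B deriv_expectp derivM derivC mul0r add0r deriv_pow.
  by rewrite /Z -expectpMn -expectpN; congr (coefwise _ _); ring.
have sF : coefwise (expect n) (coefwise shift (x%:P * (x%:P * cubic ^+ m)))
    = B *+ 2 + (Z - 'X * Z) *+ 3.
  rewrite /B /Z -expectpX -expectpN -expectpD -!expectpMn -expectpD.
  congr (coefwise _ _).
  rewrite !(derivationM shiftp_derivation) shiftpC shift_x shift_pow; ring.
have A' : A^`() = (B *+ (2 * n.+1) - 'X * (B *+ 2 + (Z - 'X * Z) *+ 3) *+ (2 * n.+1))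
    *+ (3 * m.+1).
  rewrite /A deriv_expectp deriv_exp deriv_cubic [m.+1.-1]/=.
  have -> : - (x%:P * quadric *+ 3) * cubic ^+ m *+ m.+1 =
     (- ((rhat 2)%:P * (x%:P * cubic ^+ m))
      + 'X * ((rhat 1)%:P * (x%:P * (x%:P * cubic ^+ m))) *+ 2
      - (rhat 0)%:P * ('X ^+ 2 * x%:P ^+ 3 * cubic ^+ m)) *+ (3 * m.+1).
    by rewrite /quadric; ring.
  rewrite expectpMn !(expectpD, expectpN, expectpMn, expectpX) expectp_rhat0.
  by rewrite expectp_rhat2 expectp_rhat1 sF -/B; ring.
have G' : G^`() = 0.
  by rewrite /G !derivE A' B'; ring.
have G01 : G.[1] = G.[0].
  suff -> : G = (G`_0)%:P by rewrite !hornerC.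
  apply/polyP => -[|i]; rewrite coefC //=.
  by apply: (@S_torsion_free _ i); rewrite -coef_deriv G' coef0.
have A01 : A.[1] = A.[0].
  move: G01; rewrite /G !hornerE !hornerMn !hornerE !(subrr, mulr0, mul0r, mul0rn, subr0).
  exact.
have e1 : cubic.[1] = r 3%N 0%N - x * r 2%N 0%N *+ 3 + x ^+ 2 * r 1%N 0%N *+ 3
     - x ^+ 3 * r 0%N 0%N.
  by rewrite /cubic !(hornerD, hornerN, hornerMn, hornerM, horner_exp, hornerX, hornerC) /rhat; ring.
have e0 : cubic.[0] = rhat 3.
  by rewrite /cubic !(hornerD, hornerN, hornerMn, hornerM, horner_exp, hornerX, hornerC); ring.
have := A01; rewrite (coefwise_horner_nat _ true (expectD _) (expect0 _)).
rewrite (coefwise_horner_nat _ false (expectD _) (expect0 _)).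
by rewrite !horner_exp e1 e0.
Qed.
End Translation.

(** * The marked point as a point of weight l *)

Section AddPoint.
Variables (T0 : comNzRingType) (C0 : Type) (cst0 : C0 -> T0).
Variable Y : nat * nat -> T0.
Hypothesis generated0 : forall K : T0 -> Prop,
  (forall c, K (cst0 c)) -> (forall i, K (Y i)) ->
  (forall P Q, K P -> K Q -> K (P + Q)) ->
  (forall P Q, K P -> K Q -> K (P * Q)) -> forall P, K P.
Variable L0 : T0 -> T0.
Hypothesis HL0 : diffop2 L0.
Hypothesis L0C : forall c, L0 (cst0 c) = 0.
Hypothesis L0CM : forall c P, carre L0 (cst0 c) P = 0.
Hypothesis L0r : forall i e, L0 (Y (i, e)) = Y (i - 2, e.+1)%N *+ 'C(i, 2).
Hypothesis c0rr : forall i e k f,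
  carre L0 (Y (i, e)) (Y (k, f)) = - (Y (i + k - 2, e + f)%N *+ (i * k)).
Variables alpha iota : {rmorphism T0 -> T}.
Hypothesis alphaC : forall c, exists c', alpha (cst0 c) = cst c'.
Hypothesis iotaC : forall c, exists c', iota (cst0 c) = cst c'.
Hypothesis alphaY : forall i e, alpha (Y (i, e)) = r i e - li * l ^+ e * x ^+ i.
Hypothesis iotaY : forall i e, iota (Y (i, e)) = r i e.

Lemma L_lM P : L (l * P) = l * L P.
Proof. by rewrite (diffop2M L) LlM Ll; ring. Qed.

Lemma L_lXM e P : L (l ^+ e * P) = l ^+ e * L P.
Proof. by elim: e P => [|e IH] P; rewrite ?expr0 ?mul1r // !exprSr -!mulrA IH L_lM. Qed.

Lemma carre_lX e a b : carre L (l ^+ e * a) b = l ^+ e * carre L a b.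
Proof.
elim: e => [|e IH]; first by rewrite expr0 !mul1r.
by rewrite exprS -!mulrA (carreMl HL) LlM mulr0 addr0 IH.
Qed.

Lemma L_xX i : L (x ^+ i) = l * x ^+ (i - 2) *+ 'C(i, 2).
Proof.
case: i => [|i]; first by rewrite expr0 diffop21 bin0n mulr0n.
have cx j : carre L x (x ^+ j) = l * x ^+ j.-1 *+ j.
  case: j => [|j]; first by rewrite expr0 carreC carre1l mulr0n.
  by rewrite (derivationX (carre_derivation x)) cxx mulrC.
elim: i => [|i IH]; first by rewrite expr1 Lx bin_small.
rewrite exprS (diffop2M L) IH Lx cx mulr0 addr0 [in RHS]binS bin1.
rewrite subSS; case: i {IH} => [|i].
  by rewrite bin_small // mulr0n mulr0 add0r !expr0.
by rewrite !subSS !subn0 /= [RHS]mulrnDr mulrnAr mulrCA -exprS.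
Qed.

Lemma carre_xX i k : carre L (x ^+ i) (x ^+ k) = l * x ^+ (i + k - 2) *+ (i * k).
Proof.
case: i => [|i]; first by rewrite expr0 carre1l mulr0n.
case: k => [|k]; first by rewrite expr0 carreC carre1l muln0 mulr0n.
rewrite (derivationX (carre_derivation _)) carreC (derivationX (carre_derivation _)) cxx.
have -> : (i.+1 + k.+1 - 2 = i + k)%N by lia.
by rewrite mulrnA exprD; ring.
Qed.

(** The corrections l^(e-1) x^i transform under [L] as the symbols <X^i K^e> do, but their carre du
    champ, i k l^(e+f-1) x^(i+k-2), has the opposite sign. Subtracting them therefore reproduces the
    rules of the symbols. *)
Lemma L_alpha P : L (alpha P) = alpha (L0 P).
Proof.
apply/eqP; rewrite -subr_eq0; apply/eqP.
have zD (a b : T) : a = 0 -> b = 0 -> a + b = 0 by move=> -> ->; rewrite addr0.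
have zM (Q : T0) (b : T) : b = 0 -> alpha (idfun Q) * b = 0 by move=> ->; rewrite mulr0.
apply: (@intertwine_mod _ _ _ cst0 Y generated0 T idfun alpha L0 L (fun b => b = 0) HL0 HL erefl zD zM) => //=.
- by move=> c; have [c' ->] := alphaC c.
- by move=> c b; have [c' ->] := alphaC c.
- move=> [i e]; rewrite alphaY L0r rmorphMn /= alphaY (diffop2B HL) Lr -mulrA L_liM L_lXM L_xX.
  by rewrite exprS; ring.
move=> [i e] [k f]; rewrite !alphaY c0rr rmorphN rmorphMn /= alphaY.
have crx i' e' j : carre L (r i' e') (x ^+ j) = 0.
  case: j => [|j]; first by rewrite expr0 carreC carre1l.
  by rewrite (derivationX (carre_derivation _)) carreC cxr mulr0 mul0rn.
have cxr' i' e' j : carre L (x ^+ j) (r i' e') = 0 by rewrite carreC crx.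
have carreBr a b c : carre L a (b - c) = carre L a b - carre L a c.
  by rewrite [LHS]carreC carreB !(carreC L a).
have carre_lXr a b e' : carre L a (l ^+ e' * b) = l ^+ e' * carre L a b.
  by rewrite carreC carre_lX carreC.
rewrite -!mulrA carreB !carreBr !carre_li !carrex_li !carre_lX !carre_lXr.
rewrite crr crx cxr' carre_xX exprD.
apply/eqP; rewrite subr_eq0; apply/eqP.
rewrite !mulr0 subr0 sub0r opprK.
transitivity (- (r (i + k - 2)%N (e + f)%N *+ (i * k))
  + (l * li) * li * l ^+ e * l ^+ f * x ^+ (i + k - 2) *+ (i * k)); first by ring.
by rewrite lli; ring.
Qed.

Lemma L_iota P : L (iota P) = iota (L0 P).
Proof.
apply/eqP; rewrite -subr_eq0; apply/eqP.
have zD (a b : T) : a = 0 -> b = 0 -> a + b = 0 by move=> -> ->; rewrite addr0.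
have zM (Q : T0) (b : T) : b = 0 -> iota (idfun Q) * b = 0 by move=> ->; rewrite mulr0.
apply: (@intertwine_mod _ _ _ cst0 Y generated0 T idfun iota L0 L (fun b => b = 0) HL0 HL erefl zD zM) => //=.
- by move=> c; have [c' ->] := iotaC c.
- by move=> c b; have [c' ->] := iotaC c.
- by move=> [i e]; rewrite iotaY L0r rmorphMn /= iotaY Lr subrr.
by move=> [i e] [k f]; rewrite !iotaY c0rr rmorphN rmorphMn /= iotaY crr subrr.
Qed.

Lemma carre_x_iota P : carre L x (iota P) = 0.
Proof.
move: P; apply: generated0 => [c|[i e]|P Q IP IQ|P Q IP IQ].
- by have [c' ->] := iotaC c; rewrite carreC LCM.
- by rewrite iotaY cxr.
- by rewrite rmorphD (carreDr HL) IP IQ addr0.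
- by rewrite rmorphM (carreMr HL) IP IQ !mulr0 addr0.
Qed.

Lemma L_iota_x P j :
  L (iota P * x ^+ j) = iota (L0 P) * x ^+ j + iota P * (l * x ^+ (j - 2)) *+ 'C(j, 2).
Proof.
have c0 : carre L (iota P) (x ^+ j) = 0.
  case: j => [|j]; first by rewrite expr0 carreC carre1l.
  by rewrite (derivationX (carre_derivation _)) carreC carre_x_iota mulr0 mul0rn.
by rewrite (diffop2M L) c0 L_iota L_xX; ring.
Qed.

Variables (S : comNzRingType) (ev : {rmorphism T -> S}).
Hypothesis ev_x : ev x = 0.

(** This is (2i)!/2^i, the number of ways to remove 2i copies of x in successive unordered pairs. *)
Definition moment i : nat := \prod_(a < i) 'C(2 * a + 2, 2).

(** As [x] is orthogonal to the image of [iota], each application of [L] acts on [P] or removes two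
    copies of [x]. At x = 0 only the terms without [x] survive, and the first binomial selects the
    j/2 applications that remove pairs. *)
Lemma ev_iota_x n j P :
  ev (iter n L (iota P * x ^+ j)) =
  if odd j then 0 else
  ev l ^+ j./2 * ev (iota (iter (n - j./2) L0 P)) *+ ('C(n, j./2) * moment j./2).
Proof.
elim: n j P => [|n IH] j P.
  rewrite /= rmorphM rmorphXn ev_x; case: j => [|[|j]].
  - by rewrite /= bin0 mul1n /moment big_ord0 !expr0 mulr1 mul1r.
  - by rewrite /= mulr0.
  by rewrite /= exprS mul0r mulr0 bin0n mul0n mulr0n if_same.
rewrite iterSr L_iota_x; case: j => [|[|j]].
- rewrite mulr0n addr0 IH /= !subn0 -iterSr /=.
  by rewrite !bin0.
- by rewrite mulr0n addr0 IH.
rewrite iterL_D rmorphD IH.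
have -> : iter n L (iota P * (l * x ^+ (j.+2 - 2)) *+ 'C(j.+2, 2)) =
    l * iter n L (iota P * x ^+ j) *+ 'C(j.+2, 2).
  rewrite subn2 /= mulrCA.
  elim: (n) => //= m ->.
  by rewrite (diffop2Mn HL) L_lM.
rewrite rmorphMn rmorphM IH /= negbK; case: ifP => jo; first by rewrite mulr0 mul0rn addr0.
set h := j./2; have ej : j = (2 * h)%N by rewrite -[LHS]odd_double_half jo -mul2n.
have -> : moment h.+1 = (moment h * 'C(j.+2, 2))%N.
  by rewrite /moment big_ord_recr /= ej addn2.
set M := 'C(j.+2, 2); rewrite subSS (binS n h) exprS -iterSr !mulnA.
have e2 (E : S) : ev l * (ev l ^+ h * E *+ ('C(n, h) * moment h)) *+ M =
    ev l * ev l ^+ h * E *+ ('C(n, h) * moment h * M).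
  by rewrite mulrnAr mulrA -mulrnA.
rewrite e2; case: (leqP h.+1 n) => hn; last first.
  by rewrite (bin_small hn) mul0n mulr0n !add0r add0n.
have -> : (n - h.+1).+1 = (n - h)%N by lia.
by rewrite !mulnDl mulrnDr.
Qed.

Lemma sum_even (V : nmodType) (F : nat -> V) k :
  (forall j, odd j -> F j = 0) -> \sum_(j < (2 * k).+1) F j = \sum_(a < k.+1) F (2 * a)%N.
Proof.
move=> F0; elim: k => [|k IH]; first by rewrite !big_ord1.
rewrite mulnS add2n big_ord_recr /= big_ord_recr /= IH [RHS]big_ord_recr /=.
by rewrite F0 ?addr0 ?mulnS //= mul2n odd_double.
Qed.

Lemma add_point k :
  ev (alpha (iter (3 * k) L0 (Y (3, 0)%N ^+ (2 * k)))) =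
  \sum_(a < k.+1) ev l ^+ a
     * ev (iota (iter (3 * (k - a)) L0 (Y (3, 0)%N ^+ (2 * (k - a)))))
     *+ ('C(2 * k, 2 * a) * ('C(3 * k, 3 * a) * moment (3 * a))).
Proof.
have -> : alpha (iter (3 * k) L0 (Y (3, 0)%N ^+ (2 * k))) =
    iter (3 * k) L (alpha (Y (3, 0)%N ^+ (2 * k))).
  by elim: (3 * k)%N => //= n <-; rewrite L_alpha.
rewrite rmorphXn alphaY -iotaY expr0 mulr1 exprBn.
have LNli b Q : L ((- li) ^+ b * Q) = (- li) ^+ b * L Q.
  elim: b Q => [|b IH] Q; first by rewrite expr0 !mul1r.
  by rewrite exprS -!mulrA mulNr (diffop2N HL) L_liM IH; ring.
have iter_sum n m (F : 'I_m -> T) :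
    iter n L (\sum_(j < m) F j) = \sum_(j < m) iter n L (F j).
  by elim: n => //= n ->; rewrite (diffop2_sum HL).
rewrite iter_sum rmorph_sum /=.
pose F j := ev ((- li) ^+ j) * ev (iter (3 * k) L (iota (Y (3, 0)%N ^+ (2 * k - j)) * x ^+ (3 * j)))
  *+ 'C(2 * k, j).
rewrite (eq_bigr (fun j : 'I__ => F j)) => [|j _]; last first.
  rewrite /F -rmorphM -rmorphMn; congr (ev _).
  have <- : iter (3 * k) L (((- li) ^+ j * (iota (Y (3, 0)%N ^+ (2 * k - j)) * x ^+ (3 * j))) *+ 'C(2 * k, j))
     = (- li) ^+ j * iter (3 * k) L (iota (Y (3, 0)%N ^+ (2 * k - j)) * x ^+ (3 * j)) *+ 'C(2 * k, j).
    elim: (3 * k)%N => //= n ->; rewrite (diffop2Mn HL); congr (_ *+ _).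
    exact: LNli.
  congr (iter _ _ _); rewrite rmorphXn exprMn -exprM; congr (_ *+ _).
  by rewrite [in RHS]exprNn; ring.
(* An odd number of factors x^3 leaves an odd power of x, which the evaluation kills. *)
rewrite sum_even => [|j jo]; last first.
  by rewrite /F ev_iota_x oddM /= jo mulr0 mul0rn.
apply: eq_bigr => a _; have ak : (a <= k)%N by rewrite -ltnS.
have e6 : (3 * (2 * a) = (3 * a).*2)%N by rewrite -mul2n; lia.
rewrite /F ev_iota_x e6 odd_double doubleK -!mulnBr exprM sqrrN -exprM.
(* The 2a factors 1/l of the cubics meet the 3a factors l of the contractions, leaving l^a. *)
have -> : ev (li ^+ (2 * a)) * (ev l ^+ (3 * a) * ev (iota (iter (3 * (k - a)) L0 (Y (3, 0)%N ^+ (2 * (k - a)))))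
    *+ ('C(3 * k, 3 * a) * moment (3 * a))) =
   (ev ((l * li) ^+ (2 * a)) * ev l ^+ a * ev (iota (iter (3 * (k - a)) L0 (Y (3, 0)%N ^+ (2 * (k - a))))))
    *+ ('C(3 * k, 3 * a) * moment (3 * a)).
  rewrite (_ : 3 * a = 2 * a + a)%N; last by lia.
  by rewrite exprMn !rmorphM !rmorphXn exprD mulrnAr; congr (_ *+ _); ring.
by rewrite lli expr1n rmorph1 mul1r -mulrnA (mulnC 'C(2 * k, 2 * a)).
Qed.
End AddPoint.

(** * Polynomials in X - x and K *)

Section Centered.
Hypothesis T_torsion_free : forall (a : T) j, a *+ j.+1 = 0 -> a = 0.
Implicit Types (s : nat -> T) (u v f : {poly T}).

Definition lin s u : T := \sum_(a < size u) u`_a * s a.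

Lemma lin_wide n s u : (size u <= n)%N -> lin s u = \sum_(a < n) u`_a * s a.
Proof.
move=> un; rewrite /lin -(subnK un) addnC big_split_ord /= [X in _ = _ + X]big1 ?addr0 // => a _.
by rewrite nth_default ?mul0r // leq_addr.
Qed.

Lemma linD s u v : lin s (u + v) = lin s u + lin s v.
Proof.
pose n := maxn (size u) (size v).
rewrite !(@lin_wide n) ?leq_maxl ?leq_maxr ?(size_polyD u v) // -big_split /=.
by apply: eq_bigr => a _; rewrite coefD mulrDl.
Qed.

Lemma linCM s z u : lin s (z%:P * u) = z * lin s u.
Proof.
have szu : (size (z%:P * u)%R <= size u)%N by rewrite mul_polyC size_scale_leq.
rewrite (lin_wide s szu) /lin mulr_sumr; apply: eq_bigr => a _.
by rewrite coefCM mulrA.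
Qed.

Lemma lin0 s : lin s 0 = 0.
Proof. by rewrite /lin size_poly0 big_ord0. Qed.

Lemma linXn s n : lin s 'X^n = s n.
Proof.
rewrite /lin size_polyXn big_ord_recr /= coefXn eqxx mul1r big1 ?add0r // => a _.
by rewrite coefXn ltn_eqF ?mul0r.
Qed.

Lemma lin_sum s (J : Type) (t : seq J) (F : J -> {poly T}) :
  lin s (\sum_(j <- t) F j) = \sum_(j <- t) lin s (F j).
Proof. exact: (big_morph (lin s) (linD s) (lin0 s)). Qed.

Lemma linMn s u n : lin s (u *+ n) = lin s u *+ n.
Proof. by elim: n => [|n IH]; rewrite ?mulr0n ?lin0 // !mulrS linD IH. Qed.

Lemma poly_sumXn u : u = \sum_(a < size u) (u`_a)%:P * 'X^a.
Proof.
by rewrite -[LHS]coefK poly_def; apply: eq_bigr => a _; rewrite mul_polyC.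
Qed.

Lemma linM s u v :
  lin s (u * v) = \sum_(a < size u) \sum_(b < size v) u`_a * v`_b * s (a + b)%N.
Proof.
rewrite [X in lin _ (X * _)]poly_sumXn [X in lin _ (_ * X)]poly_sumXn.
rewrite mulr_suml lin_sum; apply: eq_bigr => a _; rewrite mulr_sumr lin_sum.
apply: eq_bigr => b _; rewrite -(linXn s) exprD -linCM; congr (lin _ _).
by rewrite polyCM; ring.
Qed.

Lemma lin_deriv s u v : lin s (u^`() * v^`()) =
  \sum_(a < size u) \sum_(b < size v) u`_a * v`_b * (s (a + b - 2)%N *+ (a * b)).
Proof.
rewrite [X in lin _ (X^`() * _)]poly_sumXn [X in lin _ (_ * X^`())]poly_sumXn.
rewrite !raddf_sum /= mulr_suml lin_sum; apply: eq_bigr => a _; rewrite mulr_sumr lin_sum.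
apply: eq_bigr => b _; rewrite !derivM !derivC !mul0r !add0r !derivXn.
rewrite -(linXn s) -linMn -linCM; congr (lin _ _).
case: (nat_of_ord a) => [|i]; first by rewrite !mulr0n !mulr0 mul0r.
case: (nat_of_ord b) => [|j]; first by rewrite muln0 !mulr0n !mulr0.
have -> : (i.+1 + j.+1 - 2 = i + j)%N by lia.
by rewrite exprD polyCM mulrnA /=; ring.
Qed.

Lemma lin_deriv2 s u : lin s u^`()^`() =
  \sum_(a < size u) u`_a * (s (a - 2)%N *+ 'C(a, 2)) *+ 2.
Proof.
rewrite [X in lin _ X^`()^`()]poly_sumXn !raddf_sum /= lin_sum; apply: eq_bigr => a _.
rewrite derivM derivC mul0r add0r derivXn derivM derivC mul0r add0r derivMn derivXn.
rewrite -(linXn s) -linMn -linCM -linMn; congr (lin _ _).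
case: (nat_of_ord a) => [|[|i]]; rewrite /= ?mulr0n ?mul0rn ?mulr0 ?mul0rn //.
rewrite subn2 /= -mulrnA -mulrnAr -mulrnA; congr (_ * (_ *+ _)).
by have := mul_bin_diag i.+2 1; rewrite bin1 /=; lia.
Qed.

Definition is_const z := L z = 0 /\ forall b, carre L z b = 0.

Lemma constantD z1 z2 : is_const z1 -> is_const z2 -> is_const (z1 + z2).
Proof.
move=> [h1 h1'] [h2 h2']; split=> [|b]; first by rewrite (diffop2D HL) h1 h2 addr0.
by rewrite (carreDl HL) h1' h2' addr0.
Qed.

Lemma constantM z1 z2 : is_const z1 -> is_const z2 -> is_const (z1 * z2).
Proof.
move=> [h1 h1'] [h2 h2']; split=> [|b].
  by rewrite (diffop2M L) h1 h2 h1' !mulr0 !addr0.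
by rewrite (carreMl HL) h1' h2' !mulr0 addr0.
Qed.

Lemma constant0 : is_const 0.
Proof. by split=> [|b]; rewrite ?(diffop20 HL) ?carre0l. Qed.

Lemma constant1 : is_const 1.
Proof. by split=> [|b]; rewrite ?diffop21 ?carre1l. Qed.

Definition constant_poly f := forall e, is_const f`_e.

Lemma constant_polyM f g : constant_poly f -> constant_poly g -> constant_poly (f * g).
Proof.
move=> hf hg e; rewrite coefM; apply: (big_ind is_const) => [|? ?|i _].
- exact: constant0.
- exact: constantD.
- exact: constantM.
Qed.

Lemma constant_polyX f n : constant_poly f -> constant_poly (f ^+ n).
Proof.
move=> hf; elim: n => [|n IH]; last by rewrite exprS; apply: constant_polyM.
by move=> e; rewrite expr0 coefC; case: e => [|e]; [exact: constant1|exact: constant0].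
Qed.

(* <X^a f(K)> *)
Definition rK f a : T := lin (fun e => r a e) f.

Lemma L_constM z P : is_const z -> L (z * P) = z * L P.
Proof. by move=> [h h']; rewrite (diffop2M L) h h'; ring. Qed.

Lemma carre_constM z a b : is_const z -> carre L (z * a) b = z * carre L a b.
Proof. by move=> [h h']; rewrite (carreMl HL) h'; ring. Qed.

Lemma carre_rK f g a b : constant_poly f -> constant_poly g ->
  carre L (rK f a) (rK g b) = - (rK (f * g) (a + b - 2) *+ (a * b)).
Proof.
move=> hf hg; rewrite {1}/rK {1}/lin (carre_suml HL) /rK linM.
rewrite -sumrMnl -sumrN; apply: eq_bigr => e _; rewrite carre_constM //.
rewrite carreC (carre_suml HL) mulr_sumr -sumrMnl -sumrN; apply: eq_bigr => e' _.
by rewrite carre_constM // carreC crr; ring.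
Qed.

Lemma L_rK f a : constant_poly f -> L (rK f a) = rK ('X * f) (a - 2) *+ 'C(a, 2).
Proof.
move=> hf; rewrite {1}/rK {1}/lin (diffop2_sum HL) mulrC {1}/rK.
rewrite -[X in lin _ (_ * X)](expr1 'X) -['X^1]/('X^1).
have -> : lin (fun e => r (a - 2)%N e) (f * 'X^1) = \sum_(e < size f) f`_e * r (a - 2)%N e.+1.
  by rewrite linM; apply: eq_bigr => e _; rewrite size_polyXn big_ord_recl big_ord1 /= !coefXn /= mulr0 mul0r add0r mulr1 addn1.
by rewrite -sumrMnl; apply: eq_bigr => e _; rewrite L_constM // Lr mulrnAr.
Qed.

Lemma carre_x_rK f a : constant_poly f -> carre L x (rK f a) = 0.
Proof.
move=> hf; rewrite carreC /rK /lin (carre_suml HL) big1 // => e _.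
by rewrite carre_constM // carreC cxr mulr0.
Qed.

(* <(X - x)^i f(K)> *)
Definition centered f i : T := lin (rK f) (('X - x%:P) ^+ i).

(** By [cxx] and [cxr] this is d/dx, the symbols <X^i K^e> being constant. *)
Definition dx z := li * carre L x z.

Lemma dx_derivation : derivation dx.
Proof.
split=> a b; rewrite /dx; first by rewrite (carreDr HL) mulrDr.
by rewrite (carreMr HL); ring.
Qed.

Lemma dx_x : dx x = 1.
Proof. by rewrite /dx cxx mulrC. Qed.

(** The chain rule obeyed by polynomials in [x], which spares the definition of the subring they
    form. *)
Definition in_x z := forall b, carre L z b = dx z * carre L x b.

Lemma in_x_rK z f a : constant_poly f -> in_x z -> carre L z (rK f a) = 0.
Proof. by move=> hf hz; rewrite hz carre_x_rK // mulr0. Qed.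

Lemma carre_x z : carre L x z = l * dx z.
Proof. by rewrite /dx mulrA lli mul1r. Qed.

Lemma in_x_carre z z' : in_x z -> carre L z z' = l * dx z * dx z'.
Proof. by move=> ->; rewrite carre_x; ring. Qed.

Lemma in_xB z z' : in_x z -> in_x z' -> in_x (z - z').
Proof.
move=> hz hz' b; rewrite carreB hz hz' (derivationD dx_derivation).
by rewrite (derivationN dx_derivation); ring.
Qed.

Lemma in_xM z z' : in_x z -> in_x z' -> in_x (z * z').
Proof.
by move=> hz hz' b; rewrite (carreMl HL) hz hz' (derivationM dx_derivation); ring.
Qed.

Lemma in_x_nat n : in_x n%:R.
Proof.
move=> b; rewrite (carreMn HL) carre1l (derivationMn dx_derivation).
by rewrite (derivation1 dx_derivation) !mul0rn mul0r.
Qed.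

Lemma in_x_x : in_x x. Proof. by move=> b; rewrite dx_x mul1r. Qed.

Local Notation pw i := (('X - x%:P) ^+ i).

Lemma coef_pwS i a : (pw i.+1)`_a = (if a is b.+1 then (pw i)`_b else 0) - x * (pw i)`_a.
Proof. by rewrite exprS mulrBl coefB coefXM coefCM; case: a. Qed.

Lemma in_x_coef i a : in_x (pw i)`_a.
Proof.
elim: i a => [|i IH] a; first by rewrite expr0 coef1; apply: in_x_nat.
rewrite coef_pwS; apply: in_xB; last exact: in_xM in_x_x (IH a).
by case: a => [|a]; [exact: (in_x_nat 0)|exact: IH].
Qed.

Lemma dx_coef i a : dx (pw i)`_a = - ((pw i.-1)`_a *+ i).
Proof.
elim: i a => [|i IH] a.
  rewrite expr0 coef1 (derivationMn dx_derivation) (derivation1 dx_derivation).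
  by rewrite mul0rn mulr0n oppr0.
rewrite coef_pwS (derivationD dx_derivation) (derivationN dx_derivation).
rewrite (derivationM dx_derivation) dx_x mulr1 IH.
have -> : dx (if a is b.+1 then (pw i)`_b else 0)
    = - ((if a is b.+1 then (pw i.-1)`_b else 0) *+ i).
  by case: (a) => [|b]; rewrite ?(derivation0 dx_derivation) ?mul0rn ?oppr0 ?IH.
case: i {IH} => [|i] /=; first by rewrite !mulr0n; ring.
by rewrite !coef_pwS; case: a => [|a]; ring.
Qed.

(** On functions of [x] alone, [L] is (l/2) d^2/dx^2. *)
Lemma L_coef i a : L (pw i)`_a = l * (pw (i - 2))`_a *+ 'C(i, 2).
Proof.
elim: i a => [|i IH] a.
  by rewrite expr0 coef1 (diffop2Mn HL) diffop21 bin0n mul0rn mulr0n.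
rewrite coef_pwS (diffop2B HL) (diffop2M L) Lx mulr0 addr0 IH carre_x dx_coef.
have -> : L (if a is b.+1 then (pw i)`_b else 0)
    = l * (if a is b.+1 then (pw (i - 2))`_b else 0) *+ 'C(i, 2).
  by case: (a) => [|b]; rewrite ?(diffop20 HL) ?mulr0 ?mul0rn ?IH.
rewrite binS bin1 subSS; case: i {IH} => [|[|i]] /=.
- by rewrite bin0n /= !mulr0n; ring.
- by rewrite bin_small // !subnn; case: a => [|a] ; ring.
by rewrite !subSS !subn0 coef_pwS; case: a => [|a]; rewrite [in RHS]mulrnDr; ring.
Qed.

Lemma size_pw i : size (pw i) = i.+1.
Proof. exact: size_exp_XsubC. Qed.

Lemma centeredE f i n : (i < n)%N -> centered f i = \sum_(a < n) (pw i)`_a * rK f a.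
Proof. by move=> ltin; rewrite /centered (@lin_wide n) // size_pw. Qed.

Lemma deriv_pw i : (pw i)^`() = pw i.-1 *+ i.
Proof. by rewrite deriv_exp derivB derivX derivC subr0 mul1r. Qed.

Lemma sum_dx_coef f i :
  \sum_(a < i.+1) dx (pw i)`_a * rK f a = - (centered f i.-1 *+ i).
Proof.
rewrite (@centeredE _ _ i.+1) ?ltnS ?leq_pred // -sumrMnl -sumrN.
by apply: eq_bigr => a _; rewrite dx_coef mulNr mulrnAl.
Qed.

(** The symbols contract among themselves through d/dX and the coefficients through d/dx, without
    mixed terms. Since d/dx = -d/dX on functions of X - x, two signs cancel in the second
    summand. *)
Lemma carre_centered f g i k : constant_poly f -> constant_poly g ->
  carre L (centered f i) (centered g k) =
  - (centered (f * g) (i + k - 2) *+ (i * k))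
  + l * centered f i.-1 * centered g k.-1 *+ (i * k).
Proof.
move=> hf hg.
have -> : centered (f * g) (i + k - 2) *+ (i * k)
    = \sum_(a < i.+1) \sum_(b < k.+1) (pw i)`_a * (pw k)`_b * (rK (f * g) (a + b - 2) *+ (a * b)).
  have := lin_deriv (rK (f * g)) (pw i) (pw k); rewrite !size_pw => <-.
  rewrite !deriv_pw /centered; case: i => [|i]; first by rewrite !mulr0n mul0r lin0.
  case: k => [|k]; first by rewrite muln0 !mulr0n mulr0 lin0.
  rewrite -linMn; congr (lin _ _); have -> : (i.+1 + k.+1 - 2 = i + k)%N by lia.
  by rewrite exprD mulrnAl mulrnAr -mulrnA mulnC.
have -> : l * centered f i.-1 * centered g k.-1 *+ (i * k) =
    l * (\sum_(a < i.+1) dx (pw i)`_a * rK f a) * (\sum_(b < k.+1) dx (pw k)`_b * rK g b).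
  by rewrite !sum_dx_coef mulrnA; ring.
rewrite (centeredE f (ltnSn i)) (centeredE g (ltnSn k)) (carre_suml HL).
rewrite [l * _]mulr_sumr mulr_suml -sumrN -big_split; apply: eq_bigr => a _ /=.
rewrite carreC (carre_suml HL) [l * _ * _]mulr_sumr -sumrN -big_split; apply: eq_bigr => b _ /=.
rewrite carreC (carreMl HL) !(carreMr HL) carre_rK //.
rewrite (in_x_rK _ hg (in_x_coef _ _)) [carre L (rK f a) _]carreC (in_x_rK _ hf (in_x_coef _ _)).
by rewrite (in_x_carre _ (in_x_coef _ _)); ring.
Qed.

(** The second derivatives of (X - x)^i in X and in x coincide; the former comes with K and the
    latter with l. Hence the sum K + l, the origin of (K + l)/2 in the specialisation. *)
Lemma L_centered f i : constant_poly f ->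
  L (centered f i) = (centered ('X * f) (i - 2) + l * centered f (i - 2)) *+ 'C(i, 2).
Proof.
(* Doubling replaces the binomial i (i - 1)/2 by the factor i (i - 1) of a second derivative. *)
move=> hf; apply/eqP; rewrite -subr_eq0; apply/eqP; apply: (T_torsion_free (j := 1)).
rewrite mulrnBl; apply/eqP; rewrite subr_eq0; apply/eqP.
rewrite (centeredE f (ltnSn i)) (diffop2_sum HL).
have -> : \sum_(a < i.+1) L ((pw i)`_a * rK f a) =
    \sum_(a < i.+1) (pw i)`_a * (rK ('X * f) (a - 2) *+ 'C(a, 2))
    + l * (\sum_(a < i.+1) (pw (i - 2))`_a * rK f a) *+ 'C(i, 2).
  rewrite mulr_sumr -sumrMnl -big_split; apply: eq_bigr => a _ /=.
  by rewrite (diffop2M L) L_rK // L_coef (in_x_rK _ hf (in_x_coef _ _)) addr0; ring.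
rewrite -centeredE; last by rewrite ltnS leq_subr.
rewrite mulrnDl mulrnDl mulrnDl; congr (_ + _).
rewrite -sumrMnl; have := lin_deriv2 (rK ('X * f)) (pw i); rewrite size_pw => <-.
rewrite deriv_pw derivMn deriv_pw /centered -mulrnA -!linMn; congr (lin _ _).
rewrite subn2 -mulrnA; congr (_ *+ _); case: i => [|[|i]] //.
by have := mul_bin_diag i.+2 1; rewrite bin1 /=; lia.
Qed.

Lemma shift_const z : is_const z -> shift z = 0.
Proof. by move=> [_ hz]; rewrite /shift carreC hz oppr0. Qed.

Lemma shift_rK f a : constant_poly f -> shift (rK f a) = rK f a.-1 *+ a.
Proof.
move=> hf; rewrite /rK /lin (derivation_sum shift_derivation) -sumrMnl.
apply: eq_bigr => e _; rewrite (derivationM shift_derivation) shift_r.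
by rewrite (shift_const (hf e)) mulr0 addr0 mulrnAr.
Qed.

Lemma shift_coef i a : shift (pw i)`_a = - ((pw i.-1)`_a *+ i).
Proof.
rewrite -dx_coef; have := in_x_coef i a (rhat 1); rewrite carreC /shift => ->.
have -> : carre L x (rhat 1) = - shift x by rewrite /shift opprK carreC.
by rewrite shift_x mulrN1 opprK.
Qed.

(** X - x does not change when X and x move together. *)
Lemma shift_centered f i : constant_poly f -> shift (centered f i) = 0.
Proof.
move=> hf; rewrite (centeredE f (ltnSn i)) (derivation_sum shift_derivation).
rewrite (eq_bigr (fun a : 'I_i.+1 => (pw i)`_a * (rK f a.-1 *+ a) + dx (pw i)`_a * rK f a)).
  rewrite big_split /= sum_dx_coef /centered -linMn -deriv_pw; apply/eqP; rewrite subr_eq0; apply/eqP.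
  rewrite [in RHS](poly_sumXn (pw i)) size_pw raddf_sum lin_sum /=.
  apply: eq_bigr => a _; rewrite derivM derivC mul0r add0r derivXn linCM linMn linXn.
  by [].
move=> a _; rewrite (derivationM shift_derivation) shift_rK // shift_coef dx_coef.
by rewrite [rK f a * _]mulrC.
Qed.

Lemma rK1 a : rK 1 a = r a 0%N.
Proof. by rewrite /rK -[1]/('X^0) linXn. Qed.

Lemma centered1 : centered 1 1 = r 1%N 0%N - x * r 0%N 0%N.
Proof. by rewrite (@centeredE _ _ 2) // !big_ord_recr big_ord0 /= expr1 !coefE /= !rK1; ring. Qed.

Lemma centered3 : centered 1 3 = r 3%N 0%N - x * r 2%N 0%N *+ 3
  + x ^+ 2 * r 1%N 0%N *+ 3 - x ^+ 3 * r 0%N 0%N.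
Proof.
rewrite (@centeredE _ _ 4) // !big_ord_recr big_ord0 /= !rK1.
have -> : pw 3 = 'X^3 - x%:P * 'X^2 *+ 3 + (x ^+ 2)%:P * 'X *+ 3 - (x ^+ 3)%:P.
  by rewrite !rmorphXn; ring.
by rewrite !coefE /=; ring.
Qed.

(** * From the Polishchuk operator to the Gaussian one *)

Section Descent.
Variables (half : T) (ifact : nat -> T).
Hypothesis half2 : half *+ 2 = 1.
Hypothesis half_const : is_const half.
Hypothesis ifact0 : forall i, ifact i.+1 *+ i.+1 = ifact i.
Hypothesis ifactE : forall i, ifact i *+ i`! = 1.
Hypothesis ifact_const : forall i, is_const (ifact i).

Definition theta_poly : {poly T} := half%:P * ('X + l%:P).

Lemma constant_l : is_const l. Proof. by []. Qed.

Lemma theta_constant n : constant_poly (theta_poly ^+ n).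
Proof.
apply: constant_polyX; apply: constant_polyM => e; rewrite ?coefD ?coefX ?coefC.
  by case: eqP => _; [exact: half_const|exact: constant0].
by apply: constantD; case: eqP => _; [exact: constant1|exact: constant0|exact: constant_l|exact: constant0].
Qed.

(* <(X - x)^i ((K + l) / 2)^((j + 2 - i) / 2)> / i!, [ifact i] being 1 / i! *)
Definition hvar i j : T :=
  if (i <= j + 2)%N then ifact i * centered (theta_poly ^+ (j + 2 - i)./2) i else 0.

Lemma hvar0 n : hvar 0 (2 * n) = ifact 0 * (half ^+ n.+1 *
  \sum_(e < n.+2) l ^+ (n.+1 - e) * r 0%N (val e) *+ 'C(n.+1, e)).
Proof.
rewrite /hvar leq0n; congr (_ * _).
have -> : (2 * n + 2 - 0)./2 = n.+1 by lia.
rewrite /centered expr0 -[in lin _ 1](expr0 'X) linXn /rK /theta_poly.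
rewrite exprMn -rmorphXn linCM /= addrC exprDn lin_sum; congr (_ * _).
by apply: eq_bigr => e _; rewrite linMn -rmorphXn linCM linXn.
Qed.

(** In <((K + l)/2)^(n+1)> the part l^(e-1) of <K^e> sums to 2^(n+1) l^n over 2^(n+1), which is the
    isolated summand psi^n. The part kappa_(e-1), absent for e = 0, gives the sum over r = e - 1. *)
Lemma rmorph_hvar0 (S : comAlgType rat) (ev : {rmorphism T -> S}) (q : rat)
    (kap : nat -> S) n : q != 0 ->
  ev (ifact 0) = 1 -> ev half = (2^-1)%:A -> ev l = q%:A ->
  (forall e, ev (r 0%N e) = (q^-1 * q ^+ e)%:A + if e is i.+1 then kap i else 0) ->
  ev (hvar 0 (2 * n)) = p0_formula (in_alg S) q%:A kap n.
Proof.
move=> q0 evi evh evl evr; rewrite hvar0 !rmorphM evi mul1r rmorphXn /= evh rmorph_sum /=.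
pose A e : S := (q ^+ n)%:A *+ 'C(n.+1, e).
pose B e : S := (if e is i.+1 then q%:A ^+ (n - i) * kap i else 0) *+ 'C(n.+1, e).
rewrite (eq_bigr (fun e : 'I_n.+2 => A e + B e)) => [|e _]; last first.
  rewrite rmorphMn rmorphM rmorphXn /= evl evr -mulrnDl mulrDr; congr ((_ + _) *+ _).
    rewrite -(rmorphXn (in_alg S)) -(rmorphM (in_alg S)) /=; congr (_%:A).
    have := ltn_ord e; rewrite ltnS => en; rewrite mulrCA -exprD subnK //.
    by rewrite exprS mulKf.
  by case: (val e) => [|i]; rewrite ?mulr0 ?subSS.
rewrite big_split /= mulrDr addrC /p0_formula; congr (_ + _).
  rewrite big_ord_recl /B mul0rn add0r -(rmorphXn (in_alg S)) exprVn /=; congr (_ * _).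
have -> : \sum_(e < n.+2) A e = (2 ^+ n.+1 * q ^+ n)%:A.
  rewrite -[2]/(1 + 1) exprDn mulr_suml scaler_suml; apply: eq_bigr => e _.
  by rewrite !expr1n mulr1 mulr_natl /A scalerMnl.
rewrite -(rmorphXn (in_alg S)) -(rmorphXn (in_alg S)) -(rmorphM (in_alg S)) /=.
by rewrite exprVn mulKf ?expf_neq0.
Qed.

Lemma shift_hvar i j : shift (hvar i j) = 0.
Proof.
rewrite /hvar; case: ifP => _; last exact: derivation0 shift_derivation.
rewrite (derivationM shift_derivation) (shift_centered _ (theta_constant _)).
by rewrite (shift_const (ifact_const i)) !mulr0 addr0.
Qed.

(** The factor K + l of [L_centered] is twice [theta_poly], so the binomial becomes i (i - 1), which
    1/i! absorbs into 1/(i-2)!. *)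
Lemma L_hvar i j : (i <= j + 2)%N ->
  L (hvar i j) = if i is i'.+2 then hvar i' j else 0.
Proof.
move=> ij; rewrite /hvar ij (L_constM _ (ifact_const i)) L_centered; last exact: theta_constant.
case: i ij => [|[|i]] ij; [by rewrite bin0n mulr0n mulr0|by rewrite bin_small // mulr0n mulr0|].
have -> : (i <= j + 2)%N by lia.
have -> : (j + 2 - i)./2 = ((j + 2 - i.+2)./2).+1.
  by rewrite (_ : j + 2 - i = (j + 2 - i.+2).+2)%N //; lia.
set n := (_./2); rewrite subn2 /= -(ifact0 i) -(ifact0 i.+1) exprS.
set f := theta_poly ^+ n.
have -> : centered (theta_poly * f) i = half * (centered ('X * f) i + l * centered f i).
  rewrite /centered; set u := (_ ^+ i).
  have rKD a b c : rK (a + b) c = rK a c + rK b c by rewrite /rK linD.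
  have rKC z a c : rK (z%:P * a) c = z * rK a c by rewrite /rK linCM.
  rewrite /lin mulr_sumr -big_split mulr_sumr; apply: eq_bigr => a _ /=.
  rewrite /theta_poly -mulrA mulrDl rKC rKD rKC; ring.
rewrite -mulrnA; have -> : (i.+2 * i.+1 = 2 * 'C(i.+2, 2))%N.
  by have := mul_bin_diag i.+2 1; rewrite bin1.
rewrite mulrnA; transitivity ((half *+ 2) * ifact i.+2 * (centered ('X * f) i + l * centered f i) *+ 'C(i.+2, 2)); first by rewrite half2; ring.
by ring.
Qed.

(** The factors of the first product are the images of p_(i-1,j-1) and p_(k-1,m-1) unless j or m is
    0. They stay unfolded here, and [lower_hvar] deals with that exception. *)
Lemma carre_hvar i j k m : (i <= j + 2)%N -> (k <= m + 2)%N ->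
  odd i = odd j -> odd k = odd m ->
  carre L (hvar i j) (hvar k m) =
  if (i, k) is (i'.+1, k'.+1) then
    l * (ifact i' * centered (theta_poly ^+ (j + 2 - i)./2) i')
      * (ifact k' * centered (theta_poly ^+ (m + 2 - k)./2) k')
    - hvar (i' + k') (j + m) *+ 'C(i' + k', i')
  else 0.
Proof.
move=> ij km oij okm; rewrite /hvar ij km (carre_constM _ _ (ifact_const i)) carreC.
rewrite (carre_constM _ _ (ifact_const k)) carreC carre_centered; try exact: theta_constant.
case: i ij oij => [|i] ij oij; first by rewrite !mulr0n; ring.
case: k km okm => [|k] km okm; first by rewrite !muln0 !mulr0n; ring.
have -> : (i.+1 + k.+1 - 2 = i + k)%N by lia.
have -> : (i + k <= j + m + 2)%N by lia.
rewrite -exprD; have -> : ((j + 2 - i.+1)./2 + (m + 2 - k.+1)./2 = (j + m + 2 - (i + k))./2)%N.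
  by move: oij okm => /=; lia.
rewrite -[X in _ = X - _]mulr1 -(ifact0 i) -(ifact0 k) /=.
set c := centered _ (i + k); set a := centered _ i; set b := centered _ k.
(* This product of inverse factorials is where the binomial coefficient of the Polishchuk operator
   comes from. *)
have e : ifact i * ifact k = ifact (i + k) *+ 'C(i + k, i).
  have h := bin_fact (leq_addr k i); rewrite addKn in h.
  have h1 : ifact (i + k) *+ 'C(i + k, i) *+ i`! *+ k`! = 1.
    by rewrite -!mulrnA h ifactE.
  have h2 := ifactE i; have h3 := ifactE k.
  rewrite -[RHS]mulr1 -{1}h2 -[RHS]mulr1 -{1}h3 -[LHS]mulr1 -{1}h1; ring.
rewrite mulr1 -[ifact (i + k) * c *+ _]mulrnAl -e -(ifact0 i) -(ifact0 k).
rewrite mulrnA; ring.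
Qed.

Variables (A : comNzRingType) (CA : Type) (cA : CA -> A) (J : Type) (Z : J -> A).
Hypothesis generatedA : forall K : A -> Prop,
  (forall c, K (cA c)) -> (forall v : J, K (Z v)) ->
  (forall P Q, K P -> K Q -> K (P + Q)) ->
  (forall P Q, K P -> K Q -> K (P * Q)) -> forall P, K P.
Variables (fs sn : J -> nat) (psi : A) (p : int -> int -> A) (D : A -> A).
Hypothesis parity : forall v : J, odd (fs v) = odd (sn v).
Hypothesis HD : diffop2 D.
Hypothesis DC : forall c, D (cA c) = 0.
Hypothesis DCM : forall c P, carre D (cA c) P = 0.
Hypothesis DZ : forall v : J, D (Z v) = p ((fs v)%:Z - 2) (sn v).
Hypothesis DZZ : forall v w : J, carre D (Z v) (Z w) =
  psi * (p ((fs v)%:Z - 1) ((sn v)%:Z - 1) * p ((fs w)%:Z - 1) ((sn w)%:Z - 1))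
  - p ((fs v)%:Z + (fs w)%:Z - 2) ((sn v)%:Z + (sn w)%:Z) *+ polbin (fs v) (fs w).
Hypothesis p_negl : forall i j, (i < 0)%R -> p i j = 0.
Hypothesis p_negr : forall i j, (j < 0)%R -> p i j = 0.
Variable g : {rmorphism A -> A}.
Hypothesis gC : forall c, g (cA c) = cA c.
Hypothesis gpsi : g psi = psi.
Hypothesis gZ : forall v : J, g (Z v) = if (fs v <= sn v + 2)%N then Z v else 0.
Hypothesis gp : forall i j : nat, (i <= j + 2)%N -> g (p i j) = p i j.

Lemma gpz (i j : int) : (i <= j + 2)%R -> g (p i j) = p i j.
Proof.
case: i => [i|i] ij; last by rewrite p_negl ?rmorph0.
case: j ij => [j|j] ij; last by rewrite p_negr ?rmorph0.
by apply: gp; lia.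
Qed.

(** [D] cannot be compared with [L] on p_(j+4,j): its image is 0, whereas that of p_(j+2,j) is not
    forced to be. The condition i <= j + 2 excludes this, holds for p_(3,1), and passes to
    p_(i-2,j), p_(i-1,j-1) and p_(i+k-2,j+l). *)
Lemma truncated_stable P : g P = P -> g (D P) = D P.
Proof.
suff: g (D (g P)) - D (g P) = 0 by move=> + e; rewrite e => /eqP; rewrite subr_eq0 => /eqP.
have zD (a b : A) : a = 0 -> b = 0 -> a + b = 0 by move=> -> ->; rewrite addr0.
have zM (Q : A) (b : A) : b = 0 -> g Q * b = 0 by move=> ->; rewrite mulr0.
pose E P := g (D (g P)) - D (g P).
pose F P Q := g (carre D (g P) (g Q)) - carre D (g P) (g Q).
have ggZ (v : J) : g (g (Z v)) = g (Z v) by rewrite gZ; case: ifP => h; rewrite ?rmorph0 // gZ h.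
have gg P' : g (g P') = g P'.
  move: P'; apply: generatedA => [c|v|P' Q' h1 h2|P' Q' h1 h2].
  - by rewrite !gC.
  - exact: ggZ.
  - by rewrite !rmorphD h1 h2.
  - by rewrite !rmorphM h1 h2.
apply: (@second_order_ind _ _ _ cA Z generatedA A g (fun b => b = 0) zD zM E F); rewrite /E /F.
- by move=> a b; rewrite !(rmorphD, diffop2D HD); ring.
- by move=> a b; rewrite !rmorphM !(diffop2M D) !rmorphD !rmorphM !gg; ring.
- by move=> a b; rewrite !(carreC D _ (g b)).
- by move=> a b c; rewrite (rmorphD g a b) !(carreDl HD) (rmorphD g); ring.
- move=> a b c; rewrite (rmorphM g a b) !(carreMl HD) (rmorphD g) 2!(rmorphM g) !gg.
  by ring.
- by move=> c; rewrite gC DC rmorph0 subrr.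
- by move=> c Q; rewrite gC DCM rmorph0 subrr.
- move=> v; rewrite gZ; case: ifP => hv; last by rewrite (diffop20 HD) rmorph0 subrr.
  by rewrite DZ gpz ?subrr //; lia.
move=> v w; rewrite !gZ; case: ifP => hv; last first.
  have -> Q : carre D 0 Q = 0 by rewrite /carre mul0r (diffop20 HD); ring.
  by rewrite rmorph0 subrr.
case: ifP => hw; last first.
  have -> Q : carre D Q 0 = 0 by rewrite /carre mulr0 (diffop20 HD); ring.
  by rewrite rmorph0 subrr.
rewrite DZZ rmorphB !rmorphM rmorphMn /= gpsi !gpz ?subrr //; lia.
Qed.

Lemma truncated_stable_iter n P : g P = P -> g (iter n D P) = iter n D P.
Proof. by move=> gP; elim: n => //= n IH; apply: truncated_stable. Qed.

Variable h : {rmorphism A -> T}.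
Hypothesis LhC : forall c, is_const (h (cA c)).
Hypothesis hpsi : h psi = l.
Hypothesis hZ : forall v : J, h (Z v) = hvar (fs v) (sn v).
Hypothesis hp : forall i j : nat, odd i = odd j -> h (p i j) = hvar i j.

Lemma shift_h P : shift (h P) = 0.
Proof.
have Hs := shift_derivation.
move: P; apply: generatedA => [c|v|P' Q' h1 h2|P' Q' h1 h2].
- exact: shift_const.
- by rewrite hZ shift_hvar.
- by rewrite rmorphD (derivationD Hs) h1 h2 addr0.
- by rewrite rmorphM (derivationM Hs) h1 h2 !mulr0 addr0.
Qed.

(** The cofactor of [rhat 1] must be translation-invariant: by [expect_rhat1], this is what makes
    [expect] vanish. The set is a module over the invariant elements, among which are all values of
    [h]. *)
Definition translation_ideal z :=
  exists a b, z = rhat 1 * a + rhat 0 * b /\ shift a = 0.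

Lemma translation_ideal0 : translation_ideal 0.
Proof. by exists 0, 0; rewrite !mulr0 addr0 (derivation0 shift_derivation). Qed.

Lemma translation_idealD z z' :
  translation_ideal z -> translation_ideal z' -> translation_ideal (z + z').
Proof.
move=> [a [b [-> ha]]] [a' [b' [-> ha']]]; exists (a + a'), (b + b').
by rewrite (derivationD shift_derivation) ha ha' addr0; split => //; ring.
Qed.

Lemma translation_idealM (u z : T) :
  shift u = 0 -> translation_ideal z -> translation_ideal (u * z).
Proof.
move=> hu [a [b [-> ha]]]; exists (u * a), (u * b).
by rewrite (derivationM shift_derivation) ha hu !mulr0 addr0; split => //; ring.
Qed.

Lemma translation_ideal_centered : translation_ideal (centered 1 1).
Proof.
exists 1, (- x); rewrite (derivation1 shift_derivation); split => //.
by rewrite centered1 /rhat expr1 expr0; ring.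
Qed.

(* Only for p_(2,0) is the correction [z] nonzero: p_(1,-1) is 0, whereas
   <X - x> is a combination of [rhat 1] and [rhat 0]. *)
Lemma lower_hvar (v : J) i : fs v = i.+1 -> (fs v <= sn v + 2)%N ->
  exists z, [/\ ifact i * centered (theta_poly ^+ (sn v + 2 - i.+1)./2) i
     = h (p ((fs v)%:Z - 1) ((sn v)%:Z - 1)) + z, translation_ideal z & shift z = 0].
Proof.
move=> fsv good; have par := parity v; rewrite fsv in good par *.
have -> : i.+1%:Z - 1 = i by lia.
case E : (sn v) => [|j] in good par *.
  have -> : i = 1%N by move: i good par {fsv} => [|[|[|i]]].
  exists (ifact 1 * centered 1 1).
  rewrite p_negr // rmorph0 add0r expr0; split=> //.
    apply: translation_idealM translation_ideal_centered.
    exact: shift_const (ifact_const _).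
  have c1 : constant_poly 1 by rewrite -[1](expr0 theta_poly); apply: theta_constant.
  rewrite (derivationM shift_derivation) (shift_const (ifact_const _)) (shift_centered _ c1).
  by rewrite !mulr0 addr0.
exists 0; split; [|exact: translation_ideal0|exact: derivation0 shift_derivation].
have -> : j.+1%:Z - 1 = j by lia.
rewrite addr0 hp; last by move: par => /= /negb_inj.
rewrite /hvar; have -> : (i <= j + 2)%N by lia.
by rewrite (_ : j.+1 + 2 - i.+1 = j + 2 - i)%N //; lia.
Qed.

(** On single variables the two sides agree exactly. On pairs they differ by the corrections of
    [lower_hvar], multiplied by translation-invariant factors. *)
Lemma descent P : translation_ideal (L (h (g P)) - h (D (g P))).
Proof.
have N0 := translation_ideal0.
apply: (@intertwine_mod _ _ _ cA Z generatedA T g h D L translation_ideal HD HL N0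
  translation_idealD _ gC DC DCM) => [Q a|c|c|v|v w].
- exact: translation_idealM (shift_h _).
- by have [] := LhC c.
- by move=> b; have [] := LhC c.
- rewrite gZ; case: ifP => good; last by rewrite (diffop20 HD) !rmorph0 (diffop20 HL) subrr.
  rewrite DZ hZ L_hvar //; case E : (fs v) (parity v) => [|[|i]] par.
  + by rewrite p_negl // rmorph0 subrr.
  + by rewrite p_negl // rmorph0 subrr.
  have -> : i.+2%:Z - 2 = i by lia.
  by rewrite hp ?subrr //; move: par => /=; rewrite negbK.
rewrite !gZ; case: ifP => gv; last first.
  have -> Q : carre D 0 Q = 0 by rewrite /carre mul0r (diffop20 HD); ring.
  by rewrite !rmorph0 carre0l subrr.
case: ifP => gw; last first.
  have -> Q : carre D Q 0 = 0 by rewrite /carre mulr0 (diffop20 HD); ring.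
  by rewrite !rmorph0 carreC carre0l subrr.
rewrite DZZ !hZ carre_hvar // rmorphB !rmorphM rmorphMn /= hpsi.
case Ev : (fs v) => [|i]; first by rewrite p_negl // rmorph0 mul0r mulr0 /polbin mulr0n !subr0.
case Ew : (fs w) => [|k].
  by rewrite [p (0 - 1) _]p_negl // rmorph0 !mulr0 /polbin orbT mulr0n !subr0.
have [zv [ev nv sv]] := lower_hvar Ev gv; have [zw [ew nw sw]] := lower_hvar Ew gw.
rewrite -Ev -Ew in ev ew *; rewrite Ev Ew in ev ew *; rewrite ev ew.
have -> : i.+1%:Z + k.+1%:Z - 2 = (i + k)%N by lia.
have -> : (sn v)%:Z + (sn w)%:Z = (sn v + sn w)%N by lia.
rewrite hp; last by rewrite !oddD -!parity Ev Ew /=; case: (odd i); case: (odd k).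
have -> : polbin i.+1 k.+1 = 'C(i + k, i).
  by rewrite /polbin /= subn1 /=; congr 'C(_, _); lia.
set a := h (p _ _); set b := h (p _ _).
have -> : l * (a + zv) * (b + zw) - hvar (i + k) (sn v + sn w) *+ 'C(i + k, i) -
    (l * (a * b) - hvar (i + k) (sn v + sn w) *+ 'C(i + k, i)) =
    l * (b + zw) * zv + l * a * zw by ring.
have Hs := shift_derivation.
apply: translation_idealD; apply: translation_idealM => //.
  by rewrite (derivationM Hs) shift_l (derivationD Hs) shift_h sw addr0 !mulr0 addr0.
by rewrite (derivationM Hs) shift_l shift_h !mulr0 addr0.
Qed.

Variables (S : comNzRingType) (ev : {rmorphism T -> S}).
Hypothesis ev_x : ev x = 0.
Hypothesis ev_r : forall i e, ev (r i.+1 e) = 0.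
Hypothesis ev_r00 : ev (r 0%N 0%N) = ev li.

Lemma expect_translation_ideal j z : translation_ideal z -> expect ev j z = 0.
Proof.
move=> [a [b [-> ha]]]; rewrite expectD expect_rhat0 // addr0.
case: j => [|j]; last by rewrite expect_rhat1 // ha expect0 mul0rn oppr0.
by rewrite /expect /= rmorphM /rhat expr1 rmorphB rmorphM /= ev_x ev_r mulr0 subrr mul0r.
Qed.

(** Each exchange of [D] for [L] makes an error in the translation ideal, killed by [expect] at
    every level; hence the statement for all [j]. *)
Lemma expect_descent n j P : g P = P ->
  expect ev j (h (iter n D P)) = expect ev (n + j) (h P).
Proof.
move=> gP; elim: n j => [//|n IH] j.
have := descent (iter n D P); rewrite truncated_stable_iter // => /(expect_translation_ideal j).
rewrite expectD expectN => /eqP; rewrite subr_eq0 => /eqP <-.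
by rewrite addSnnS -IH /expect iterSr.
Qed.

Lemma descent_cubic n m :
  (forall (a : S) j, a *+ j.+1 = 0 -> a = 0) ->
  ev (r 0%N 1%N) + 1 = (2 * n)%:R ->
  ev (h (iter n.+1 D (p 3 1 ^+ m))) =
  ev (ifact 3) ^+ m * ev (iter n.+1 L (rhat 3 ^+ m)).
Proof.
move=> S_torsion_free ev_r01.
have gpm : g (p 3 1 ^+ m) = p 3 1 ^+ m by rewrite rmorphXn /= gp.
have := expect_descent n.+1 0 gpm; rewrite addn0 {1}/expect /= => ->.
rewrite rmorphXn [h _]hp // [hvar 3 1]/(ifact 3 * centered (theta_poly ^+ 0) 3) expr0 exprMn.
have L_ifact b P : L (ifact 3 ^+ b * P) = ifact 3 ^+ b * L P.
  elim: b P => [|b IH] P; first by rewrite expr0 !mul1r.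
  by rewrite exprSr -!mulrA IH L_constM.
have -> : expect ev n.+1 (ifact 3 ^+ m * centered 1 3 ^+ m)
    = ev (ifact 3) ^+ m * expect ev n.+1 (centered 1 3 ^+ m).
  rewrite /expect -rmorphXn -rmorphM; congr (ev _).
  by elim: n.+1 => //= j ->; rewrite L_ifact.
by rewrite centered3 (expect_cubic S_torsion_free ev_x ev_r ev_r00 ev_r01).
Qed.
End Descent.
End Centered.
End GaussianModel.

(** * Operators on polynomial rings *)

Section Pdop.
Variables (R : comNzRingType) (I : choiceType).
Local Notation A := (polyring R I).

Lemma pderiv_derivation i : derivation (pderiv i : A -> A).
Proof.
split=> P Q; first exact: pderivD.
have e : pderiv i P * Q = Q * pderiv i P := mulrC _ _.
by apply: etrans (pderivM i P Q) _; rewrite [LHS]addrC e.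
Qed.

Lemma pderivCA i j (P : A) : pderiv i (pderiv j P) = pderiv j (pderiv i P).
Proof.
apply/malgP => m; rewrite [LHS]pderivE [X in X *+ _]pderivE.
rewrite [RHS]pderivE [X in _ = X *+ _]pderivE -!mulrnA.
have -> : mmul (mmul m (ucm i)) (ucm j) = mmul (mmul m (ucm j)) (ucm i).
  by apply/eqP/cmP => v; rewrite !cmM addnAC.
rewrite !cmM !cmU; case: (eqVneq i j) => [->//|ij].
by rewrite !addn0 mulnC.
Qed.

Variables (half : A) (gam : I -> I -> A) (lam : I -> A).

Definition pdop : A -> A := dop (@pderiv R I) (@pvars R I) half gam lam.

Lemma pdop_diffop2 : diffop2 pdop.
Proof.
apply: dop_diffop2; [exact: pderiv_derivation|exact: pderivCA|].
by move=> V F s P; apply: pvars_sum.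
Qed.

Lemma pdopC c : pdop c%:MP = 0.
Proof. by apply: dop_vanish; [exact: pderiv_derivation|move=> i; exact: pderivC]. Qed.

Lemma carre_pdopC c P : carre pdop c%:MP P = 0.
Proof.
apply: carre_dop_vanish; [exact: pderiv_derivation|exact: pderivCA| |].
  by move=> V F s Q; apply: pvars_sum.
by move=> i; exact: pderivC.
Qed.

Lemma pdopX i : pdop (pX R i) = lam i.
Proof.
apply: dopX; [exact: pderiv_derivation|exact: pderivX|exact: pderivCA|].
by move=> V F s Q; apply: pvars_sum.
Qed.

Lemma carre_pdopX i j :
  carre pdop (pX R i) (pX R j) = half * (gam i j + gam j i).
Proof.
apply: carre_dopX; [exact: pderiv_derivation|exact: pderivX|exact: pderivCA|].
by move=> V F s Q; apply: pvars_sum.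
Qed.

End Pdop.

(** * The Gaussian operators over the rationals *)

Local Notation Q0 := (polyring rat (nat * nat)%type).
Local Notation Q1 := (polyring rat (option (nat * nat))).

Lemma half_double (I : choiceType) (P : polyring rat I) :
  (2^-1 : rat)%:MP * (P + P) = P.
Proof. by rewrite mul_malgC -mulr2n -scaler_nat scalerA mulVf // scale1r. Qed.

Definition gam0 (p q : nat * nat) : Q0 :=
  - (pX rat (p.1 + q.1 - 2, p.2 + q.2)%N *+ (p.1 * q.1)).
Definition lam0 (p : nat * nat) : Q0 := pX rat (p.1 - 2, p.2.+1)%N *+ 'C(p.1, 2).
Definition gauss0 : Q0 -> Q0 := pdop (2^-1 : rat)%:MP gam0 lam0.

Lemma gauss0_r i e : gauss0 (pX rat (i, e)) = pX rat (i - 2, e.+1)%N *+ 'C(i, 2).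
Proof. exact: pdopX. Qed.

Lemma carre_gauss0 i e k f :
  carre gauss0 (pX rat (i, e)) (pX rat (k, f)) =
  - (pX rat (i + k - 2, e + f)%N *+ (i * k)).
Proof.
rewrite carre_pdopX -[RHS]half_double; congr (_ * (_ + _)).
by rewrite /gam0 /= addnC (addnC f) mulnC.
Qed.

Definition gam1 (l : rat) (u v : option (nat * nat)) : Q1 :=
  match u, v with
  | Some p, Some q => - (pX rat (Some (p.1 + q.1 - 2, p.2 + q.2)%N) *+ (p.1 * q.1))
  | None, None => l%:MP
  | _, _ => 0
  end.
Definition lam1 (u : option (nat * nat)) : Q1 :=
  if u is Some p then pX rat (Some (p.1 - 2, p.2.+1)%N) *+ 'C(p.1, 2) else 0.
Definition gauss1 (l : rat) : Q1 -> Q1 := pdop (2^-1 : rat)%:MP (gam1 l) lam1.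

Section Gauss1.
Variable l : rat.
Local Notation L := (gauss1 l).
Local Notation r i e := (pX rat (Some (i, e))).

Lemma gauss1_diffop2 : diffop2 L.
Proof. exact: pdop_diffop2. Qed.

Lemma gauss1_x : L (pX rat None) = 0.
Proof. exact: pdopX. Qed.

Lemma gauss1_r i e : L (r i e) = r (i - 2)%N e.+1 *+ 'C(i, 2).
Proof. exact: pdopX. Qed.

Lemma carre_gauss1_xx : carre L (pX rat None) (pX rat None) = l%:MP.
Proof. by rewrite carre_pdopX half_double. Qed.

Lemma carre_gauss1_xr i e : carre L (pX rat None) (r i e) = 0.
Proof. by rewrite carre_pdopX addr0 mulr0. Qed.

Lemma carre_gauss1_rr i e k f :
  carre L (r i e) (r k f) = - (r (i + k - 2)%N (e + f)%N *+ (i * k)).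
Proof.
rewrite carre_pdopX -[RHS]half_double; congr (_ * (_ + _)).
by rewrite /gam1 /= addnC (addnC f) mulnC.
Qed.
End Gauss1.

Lemma malgC_alg (R : comNzRingType) (I : choiceType) (c : R) :
  c%:MP = c%:A :> polyring R I.
Proof. by rewrite -mul_malgC mulr1. Qed.

Definition at0 (S : comNzRingType) (c : nat -> S) (p : nat * nat) : S :=
  if p.1 is 0%N then c p.2 else 0.
Definition eval0 (S : comNzRingType) (f : rat -> S) (c : nat -> S) : Q0 -> S :=
  pev f (at0 c).
Definition eval1 (S : comNzRingType) (f : rat -> S) (c : nat -> S) : Q1 -> S :=
  pev f (oapp (at0 c) 0).

HB.instance Definition _ (S : comNzRingType) (f : {rmorphism rat -> S}) c :=
  GRing.RMorphism.copy (eval0 f c) (pev f (at0 c)).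
HB.instance Definition _ (S : comNzRingType) (f : {rmorphism rat -> S}) c :=
  GRing.RMorphism.copy (eval1 f c) (pev f (oapp (at0 c) 0)).

(** Contracting an edge between two symbols merges them with a minus sign, and contracting a loop
    raises the exponent of K. So this is a weighted sum over cubic graphs with 2k vertices and
    ordered edges, where a component of first Betti number b contributes -<K^b>; compare exp(-{log
    A}). *)
Definition wick k : Q0 := iter (3 * k) gauss0 (pX rat (3, 0)%N ^+ (2 * k)).

Definition incl01 : Q0 -> Q1 := pev (in_alg Q1) (fun p => pX rat (Some p)).
Definition split_point (l : rat) : Q0 -> Q1 :=
  pev (in_alg Q1) (fun p => pX rat (Some p) - (l^-1)%:MP * l%:MP ^+ p.2 * pX rat None ^+ p.1).

HB.instance Definition _ := GRing.RMorphism.copy incl01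
  (pev (in_alg Q1) (fun p => pX rat (Some p))).
HB.instance Definition _ l := GRing.RMorphism.copy (split_point l)
  (pev (in_alg Q1) (fun p => pX rat (Some p) - (l^-1)%:MP * l%:MP ^+ p.2 * pX rat None ^+ p.1)).

Lemma split_point_r l i e : split_point l (pX rat (i, e)) =
  pX rat (Some (i, e)) - (l^-1)%:MP * l%:MP ^+ e * pX rat None ^+ i.
Proof. exact: pevX. Qed.

Lemma incl01_r i e : incl01 (pX rat (i, e)) = pX rat (Some (i, e)).
Proof. exact: pevX. Qed.

Lemma eval1_r (S : comNzRingType) (f : {rmorphism rat -> S}) c i e :
  eval1 f c (pX rat (Some (i, e))) = if i is 0%N then c e else 0.
Proof. exact: pevX. Qed.

Lemma eval1_x (S : comNzRingType) (f : {rmorphism rat -> S}) c :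
  eval1 f c (pX rat None) = 0.
Proof. exact: pevX. Qed.

Lemma eval1C (S : comNzRingType) (f : {rmorphism rat -> S}) c a :
  eval1 f c a%:MP = f a.
Proof. exact: pevC. Qed.

Lemma rmorph_pev (S S' : comNzRingType) (R : comNzRingType) (I : choiceType)
    (f : {rmorphism R -> S}) (h : I -> S) (f' : {rmorphism R -> S'}) (h' : I -> S')
    (u : {rmorphism S -> S'}) :
  (forall c, u (f c) = f' c) -> (forall i, u (h i) = h' i) ->
  forall P, u (pev f h P) = pev f' h' P.
Proof.
move=> uf uh; apply: polyring_ind => [c|i|P Q IP IQ|P Q IP IQ].
- by rewrite !pevC.
- by rewrite !pevX.
- by rewrite !rmorphD /= IP IQ.
- by rewrite !rmorphM /= IP IQ.
Qed.

(** At x = 0 the correction l^(e-1) x^i survives only for i = 0, where it lowers <K^e> by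
    l^(e-1). *)
Lemma eval1_split_point (S : comNzRingType) (f : {rmorphism rat -> S})
    (c : nat -> S) (l : rat) P :
  eval1 f c (split_point l P) = eval0 f (fun e => c e - f (l^-1 * l ^+ e)) P.
Proof.
apply: (rmorph_pev (u := eval1 f c)) => [a|[i e]].
  by rewrite /= -malgC_alg eval1C.
have ev := fun P Q => rmorphM (eval1 f c) P Q.
have ex := fun P j => rmorphXn (eval1 f c) j P.
apply: etrans (rmorphB (eval1 f c) _ _) _; rewrite [X in X - _]eval1_r.
rewrite [X in _ - X]ev [X in _ - X * _]ev [X in _ - _ * X * _]ex [X in _ - _ * _ * X]ex.
rewrite [X in _ - _ * _ * X ^+ _]eval1_x [X in _ - X * _ * _]eval1C [X in _ - _ * X ^+ _ * _]eval1C.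
rewrite /at0 /= (rmorphM f) (rmorphXn f).
by case: i => [|i]; rewrite ?expr0 ?mulr1 //= exprS mul0r mulr0 subr0.
Qed.

Lemma wick_add_point (S : comNzRingType) (f : {rmorphism rat -> S})
    (c : nat -> S) (l : rat) k : l != 0 ->
  eval0 f (fun e => c e - f (l^-1 * l ^+ e)) (wick k) =
  \sum_(a < k.+1) f l ^+ a * eval0 f c (wick (k - a))
     *+ ('C(2 * k, 2 * a) * ('C(3 * k, 3 * a) * moment (3 * a))).
Proof.
move=> l0.
have lli : l%:MP * (l^-1)%:MP = 1 :> Q1.
  by rewrite mul_malgC malgC_alg scalerA mulfV // scale1r.
have evl : eval1 f c l%:MP = f l by apply: eval1C.
have e0 P : eval1 f c (incl01 P) = eval0 f c P.
  apply: (rmorph_pev (u := eval1 f c)) => [a|p].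
    by rewrite /= -malgC_alg eval1C.
  by case: p => i e; apply: eval1_r.
have e1 := eval1_split_point f c l.
rewrite -e1; under eq_bigr => a _ do rewrite -e0 -evl.
apply: (@add_point Q1 rat (fun a => a%:MP) (@pX rat _) l%:MP (l^-1)%:MP (gauss1 l)
  lli _ _ _ _ _ _ _ _ _ _ _ _ Q0 rat (fun a => a%:MP) (@pX rat _) _ gauss0
  _ _ _ _ _ (split_point l) incl01 _ _ _ _ S (eval1 f c) _ k).
- exact: gauss1_diffop2.
- by move=> a; apply: pdopC.
- by move=> a P; apply: carre_pdopC.
- exact: pdopC.
- by move=> P; apply: carre_pdopC.
- exact: pdopC.
- by move=> P; apply: carre_pdopC.
- exact: gauss1_x.
- exact: gauss1_r.
- exact: carre_gauss1_xx.
- exact: carre_gauss1_xr.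
- exact: carre_gauss1_rr.
- exact: polyring_ind.
- exact: pdop_diffop2.
- by move=> a; apply: pdopC.
- by move=> a P; apply: carre_pdopC.
- exact: gauss0_r.
- exact: carre_gauss0.
- by move=> a; exists a; apply: etrans (pevC _ _ _) _; rewrite /= malgC_alg.
- by move=> a; exists a; apply: etrans (pevC _ _ _) _; rewrite /= malgC_alg.
- exact: split_point_r.
- exact: incl01_r.
- exact: eval1_x.
Qed.

Lemma gauss1_split_point l P : l != 0 ->
  gauss1 l (split_point l P) = split_point l (gauss0 P).
Proof.
move=> l0; have lli : l%:MP * (l^-1)%:MP = 1 :> Q1.
  by rewrite mul_malgC malgC_alg scalerA mulfV // scale1r.
apply: (@L_alpha Q1 rat (fun a => a%:MP) (@pX rat _) l%:MP (l^-1)%:MP (gauss1 l)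
  lli _ _ _ _ _ _ _ _ _ _ _ _ Q0 rat (fun a => a%:MP) (@pX rat _) _ gauss0
  _ _ _ _ _ (split_point l) _ _ P).
- exact: gauss1_diffop2.
- by move=> a; apply: pdopC.
- by move=> a Q; apply: carre_pdopC.
- exact: pdopC.
- by move=> Q; apply: carre_pdopC.
- exact: pdopC.
- by move=> Q; apply: carre_pdopC.
- exact: gauss1_x.
- exact: gauss1_r.
- exact: carre_gauss1_xx.
- exact: carre_gauss1_xr.
- exact: carre_gauss1_rr.
- exact: polyring_ind.
- exact: pdop_diffop2.
- by move=> a; apply: pdopC.
- by move=> a Q; apply: carre_pdopC.
- exact: gauss0_r.
- exact: carre_gauss0.
- by move=> a; exists a; apply: etrans (pevC _ _ _) _; rewrite /= malgC_alg.
- exact: split_point_r.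
Qed.

(** * Logarithmic derivatives of power series *)

Lemma alg_torsion_free (R : lmodType rat) (a : R) j : a *+ j.+1 = 0 -> a = 0.
Proof.
move/(congr1 (fun b => (j.+1%:R^-1 : rat) *: b)).
by rewrite -scaler_nat scalerA mulVf ?pnatr_eq0 // scale1r scaler0.
Qed.

Section LogDerivative.
Variable R : comNzRingType.
Implicit Types (f g : nat -> R) (F G : {poly R}).

(* [g' = f' g] as power series *)
Definition logder f g := forall i,
  g i.+1 *+ i.+1 = \sum_(j < i.+1) f j.+1 *+ j.+1 * g (i - j)%N.

(** Power series identities up to a given order thus become identities between truncating
    polynomials. *)
Lemma logderE f g N F G i : (i < N)%N ->
  (forall j, (j <= N)%N -> F`_j = f j) -> (forall j, (j <= N)%N -> G`_j = g j) ->
  (G^`() - F^`() * G)`_i =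
  g i.+1 *+ i.+1 - \sum_(j < i.+1) f j.+1 *+ j.+1 * g (i - j)%N.
Proof.
move=> iN hF hG; rewrite coefB coef_deriv hG // coefM; congr (_ - _).
apply: eq_bigr => j _; rewrite coef_deriv hF ?hG //.
  by rewrite (leq_trans (leq_subr _ _)) // ltnW.
by rewrite (leq_trans _ iN) // ltnS -ltnS.
Qed.

Lemma coef_trunc f N i : (i <= N)%N -> (series_trunc f N)`_i = f i.
Proof. by move=> iN; rewrite coef_poly ltnS iN. Qed.

Definition cauchy g1 g2 n := \sum_(a < n.+1) g1 (n - a)%N * g2 a.

Lemma coefM_low F G i : (forall j, (j <= i)%N -> F`_j = 0) -> (F * G)`_i = 0.
Proof.
move=> F0; rewrite coefM big1 // => j _; rewrite F0 ?mul0r //.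
by rewrite -ltnS.
Qed.

Lemma logderM f1 f2 g1 g2 : logder f1 g1 -> logder f2 g2 ->
  logder (fun n => f1 n + f2 n) (cauchy g1 g2).
Proof.
move=> h1 h2 i; set N := i.+1.
pose F1 := series_trunc f1 N; pose F2 := series_trunc f2 N.
pose G1 := series_trunc g1 N; pose G2 := series_trunc g2 N.
apply/eqP; rewrite -subr_eq0; apply/eqP.
rewrite -(@logderE (fun n => f1 n + f2 n) (cauchy g1 g2) N (F1 + F2) (G1 * G2) i) //; first last.
- move=> j jN; rewrite coefMr; apply: eq_bigr => a _.
  by have ha := ltn_ord a; rewrite !coef_trunc //; lia.
- by move=> j jN; rewrite coefD !coef_trunc.
have -> : (G1 * G2)^`() - (F1 + F2)^`() * (G1 * G2) =
    (G1^`() - F1^`() * G1) * G2 + (G2^`() - F2^`() * G2) * G1.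
  by rewrite derivM derivD; ring.
have low f g : logder f g -> forall j, (j <= i)%N ->
    ((series_trunc g N)^`() - (series_trunc f N)^`() * series_trunc g N)`_j = 0.
  move=> h j ji; rewrite (@logderE f g N) ?h ?subrr // => ? ?; exact: coef_trunc.
by rewrite coefD !coefM_low ?addr0 //; apply: low.
Qed.

Lemma coefX_low F m i : F`_0 = 0 -> (i < m)%N -> (F ^+ m)`_i = 0.
Proof.
move=> F0; elim: m i => // m IH i im; rewrite exprS coefM big1 // => -[[|j] ji] _ /=.
  by rewrite F0 mul0r.
by rewrite IH ?mulr0 //; lia.
Qed.

Lemma coefX_eq F G m n : (forall j, (j <= n)%N -> F`_j = G`_j) ->
  forall i, (i <= n)%N -> (F ^+ m)`_i = (G ^+ m)`_i.
Proof.
move=> e; elim: m => [//|m IH] i ni; rewrite !exprS !coefM; apply: eq_bigr => -[j ji] _ /=.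
by rewrite e ?IH //; lia.
Qed.

End LogDerivative.

Section ExpSeries.
Variable R : comAlgType rat.
Implicit Types (f g : nat -> R) (F G : {poly R}).

Lemma logder_uniq f g1 g2 :
  logder f g1 -> logder f g2 -> g1 0%N = g2 0%N -> g1 =1 g2.
Proof.
move=> h1 h2 e0 n; elim/ltn_ind: n => -[//|n] IH.
apply/eqP; rewrite -subr_eq0; apply/eqP; apply: (@alg_torsion_free _ _ n).
rewrite mulrnBl h1 h2 -sumrB big1 // => j _.
by rewrite IH ?subrr // ltnS leq_subr.
Qed.

Definition exp_poly f N : {poly R} :=
  \sum_(m < N.+1) (m`!%:R^-1 : rat)%:A *: series_trunc f N ^+ m.

(** Without constant term, an m-th power starts in degree m, so all coefficients can be read off one
    truncation. *)
Lemma exp_seriesE f N n : f 0%N = 0 -> (n <= N)%N -> exp_series f n = (exp_poly f N)`_n.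
Proof.
move=> f0 nN; rewrite /exp_series /exp_poly coef_sum.
rewrite -(subnK (leq_ltn_trans nN (ltnSn N))) addnC big_split_ord /=.
rewrite [X in _ = _ + X]big1 ?addr0 => [|m _]; last first.
  rewrite coefZ coefX_low ?mulr0 ?coef_trunc //; lia.
apply: eq_bigr => m _; rewrite coefZ mulr_algl; congr (_ *: _).
by apply: (@coefX_eq R (series_trunc f n) (series_trunc f N) m n) => // j jn; rewrite !coef_trunc // (leq_trans jn).
Qed.

Lemma logder_exp f : f 0%N = 0 -> logder f (exp_series f).
Proof.
move=> f0 i; set N := i.+1; pose F := series_trunc f N.
apply/eqP; rewrite -subr_eq0; apply/eqP.
rewrite -(@logderE R f (exp_series f) N F (exp_poly f N) i) //; first last.
- by move=> j jN; rewrite -exp_seriesE.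
- by move=> j jN; rewrite coef_trunc.
(* The truncated exponential satisfies its equation up to F^N/N!, which has no coefficient in
   degrees at most i < N. *)
have -> : (exp_poly f N)^`() = F^`() * (exp_poly f N - (N`!%:R^-1 : rat)%:A *: F ^+ N).
  rewrite [in RHS]/exp_poly big_ord_recr /= addrK /exp_poly big_ord_recl expr0.
  rewrite derivD derivZ derivC scaler0 add0r raddf_sum mulr_sumr /=.
  apply: eq_bigr => m _; rewrite derivZ deriv_exp -scalerAr -scaler_nat scalerA.
  congr (_ *: _); rewrite -[(bump 0 m)%:R](rmorph_nat (in_alg R)) -(rmorphM (in_alg R)) /=.
  by rewrite /bump /= add1n factS natrM invfM mulrAC mulVf ?mul1r // pnatr_eq0.
rewrite -mulrBr addrAC subrr add0r mulrC coefM_low // => j ji.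
by rewrite coefN coefZ coefX_low ?mulr0 ?oppr0 ?coef_trunc.
Qed.

Lemma logder0 : logder (fun=> 0 : R) (fun n => (n == 0%N)%:R).
Proof. by move=> i; rewrite mul0rn big1 // => j _; rewrite mul0rn mul0r. Qed.

Lemma exp_series0 f : f 0%N = 0 -> exp_series f 0 = 1.
Proof.
move=> f0; rewrite (@exp_seriesE f 0) // /exp_poly big_ord1 expr0 coefZ coefC /=.
by rewrite fact0 invr1 scale1r mulr1.
Qed.

End ExpSeries.

Lemma log_seriesE (a : nat -> rat) N n : a 0%N = 1 -> (n <= N)%N ->
  log_series a n = (\sum_(m < N) ((-1) ^+ m / m.+1%:R) *: (series_trunc a N - 1) ^+ m.+1)`_n.
Proof.
move=> a0 nN; rewrite /log_series -(big_mkord xpredT (fun m =>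
  ((-1) ^+ m / m.+1%:R) *: (series_trunc a N - 1) ^+ m.+1)) big_add1 /=.
have cX m : ((series_trunc a n - 1) ^+ m)`_n = ((series_trunc a N - 1) ^+ m)`_n :> rat.
  apply: (@coefX_eq rat (series_trunc a n - 1) (series_trunc a N - 1) m n) => // j jn.
  by rewrite !coefB !coef_trunc // (leq_trans jn).
rewrite [in RHS](big_cat_nat (n := n)) //= coefD [X in _ = _ + X]coef_sum.
rewrite [X in _ = _ + X]big_nat_cond [X in _ = _ + X]big1 ?addr0 => [|m]; last first.
  rewrite andbT => /andP[nm mN]; rewrite coefZ coefX_low ?mulr0 ?ltnS //.
  by rewrite coefB coef_trunc // a0 coefC subrr.
by rewrite !coef_sum; apply: eq_bigr => m _; rewrite !coefZ cX.
Qed.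

Lemma logder_log (a : nat -> rat) : a 0%N = 1 -> logder (log_series a) a.
Proof.
move=> a0 i; set N := i.+1; pose G := series_trunc a N.
pose F := \sum_(m < N) ((-1) ^+ m / m.+1%:R) *: (G - 1) ^+ m.+1.
apply/eqP; rewrite -subr_eq0; apply/eqP.
rewrite -(@logderE rat (log_series a) a N F G i) //; first last.
- by move=> j jN; rewrite coef_trunc.
- by move=> j jN; rewrite -log_seriesE.
have -> : F^`() = G^`() * \sum_(m < N) (- (G - 1)) ^+ m.
  rewrite /F raddf_sum mulr_sumr /=; apply: eq_bigr => m _.
  rewrite derivZ deriv_exp derivB derivC subr0 /= -scaler_nat scalerA divfK ?pnatr_eq0 //.
  rewrite [in RHS]exprNn -[in LHS]signr_odd -[in RHS]signr_odd.
  by case: odd; rewrite ?expr1 ?expr0 ?scaleN1r ?scale1r ?mulN1r ?mul1r ?mulrN.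
(* The truncated geometric series inverts G up to (1 - G)^N, which vanishes to order N. *)
have -> : G^`() - G^`() * (\sum_(m < N) (- (G - 1)) ^+ m) * G = (- (G - 1)) ^+ N * G^`().
  have := subrX1 (- (G - 1)) N => e.
  have eN : (- (G - 1)) ^+ N = 1 - G * \sum_(m < N) (- (G - 1)) ^+ m.
    rewrite -[LHS](subrK 1) e; ring.
  by rewrite eN; ring.
rewrite coefM_low // => j ji; rewrite coefX_low //.
by rewrite coefN coefB coef_trunc // a0 coefC subrr oppr0.
Qed.

(** * Adding a point *)

Section FaberZagier.
Variable R : comAlgType rat.
Implicit Types (c : nat -> R) (l : rat).

(* Entry [e] of [c] stands for [kappa_(e-1)]. *)
Definition fz c : nat -> R :=
  exp_series (fun n => - bracket (log_series seriesA) (fun m => c m.+1) n).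

Lemma log_series0 (a : nat -> rat) : log_series a 0 = 0.
Proof. by rewrite /log_series big_geq // coef0. Qed.

Lemma fz_logder c :
  logder (fun n => - bracket (log_series seriesA) (fun m => c m.+1) n) (fz c).
Proof. by apply: logder_exp; rewrite /bracket log_series0 scale0r oppr0. Qed.

Lemma fz0 c : fz c 0 = 1.
Proof. by apply: exp_series0; rewrite /bracket log_series0 scale0r oppr0. Qed.

Lemma seriesA0 : seriesA 0 = 1.
Proof. by rewrite /seriesA !muln0 fact0 expr0 mulr1 !invr1 mulr1. Qed.

Lemma logder_scale (a b : nat -> rat) l : logder a b ->
  logder (fun n => (a n * l ^+ n)%:A : R) (fun n => (b n * l ^+ n)%:A).
Proof.
move=> h i; rewrite scalerMnl -mulrnAl h mulr_suml scaler_suml; apply: eq_bigr => j _.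
rewrite scalerMnl mulr_algl scalerA -mulrnAl; congr (_ *: _).
have -> : l ^+ i.+1 = l ^+ j.+1 * l ^+ (i - j).
  by rewrite -exprD addSn subnKC // -ltnS.
by ring.
Qed.

Lemma logder_ext (f1 f2 g1 g2 : nat -> R) :
  f1 =1 f2 -> g1 =1 g2 -> logder f1 g1 -> logder f2 g2.
Proof. by move=> ef eg h i; rewrite -eg h; apply: eq_bigr => j _; rewrite ef eg. Qed.

(** Removing l^n from each kappa_n adds log A(l z) to the exponent. Both sides then solve the same
    first-order equation with initial value 1. *)
Lemma fz_add_point c l k : l != 0 ->
  fz (fun e => c e - (l^-1 * l ^+ e)%:A) k =
  \sum_(a < k.+1) fz c (k - a) * (seriesA a * l ^+ a)%:A.
Proof.
move=> l0.
have h2 : logder (fun n => (log_series seriesA n * l ^+ n)%:A : R)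
   (fun n => (seriesA n * l ^+ n)%:A).
  by apply: logder_scale; apply: logder_log; apply: seriesA0.
have h := logderM (fz_logder c) h2.
pose c' e := c e - (l^-1 * l ^+ e)%:A.
have {}h : logder (fun n => - bracket (log_series seriesA) (fun m => c' m.+1) n)
    (cauchy (fz c) (fun n => (seriesA n * l ^+ n)%:A)).
  apply: (logder_ext _ _ h) => // n.
  by rewrite /bracket /c' scalerBr opprB addrC scalerA exprS mulKf.
apply: (logder_uniq (fz_logder c') h).
by rewrite fz0 /cauchy big_ord1 fz0 seriesA0 expr0 !(mulr1, mul1r, scale1r).
Qed.

Lemma fz_zero k : fz (fun=> 0) k = (k == 0%N)%:R.
Proof.
have h : logder (fun n => - bracket (log_series seriesA) (fun=> 0 : R) n)
    (fun n => (n == 0%N)%:R).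
  by apply: (logder_ext _ _ (@logder0 R)) => // n; rewrite /bracket scaler0 oppr0.
exact: (logder_uniq (fz_logder (fun=> 0)) h (fz0 _)).
Qed.

Lemma fz_local c c' k : (forall e, (e <= k.+1)%N -> c e = c' e) -> fz c k = fz c' k.
Proof.
move=> e; rewrite /fz /exp_series; apply: eq_bigr => m _; congr (_ *: _).
apply: (@coefX_eq _ _ _ m k) => // j jk; rewrite !coef_trunc //.
by rewrite /bracket e.
Qed.
End FaberZagier.

Lemma fz_rmorph (R R' : comAlgType rat) (u : {rmorphism R -> R'}) c k :
  (forall (q : rat) x, u (q *: x) = q *: u x) -> u (fz c k) = fz (u \o c) k.
Proof.
move=> uZ; move: k.
apply: (@logder_uniq R' _ (fun k => u (fz c k)) _ _ (fz_logder (u \o c))) => [i|]; last by rewrite !fz0 rmorph1.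
rewrite -rmorphMn fz_logder rmorph_sum; apply: eq_bigr => j _ /=.
by rewrite rmorphM rmorphMn rmorphN /= /bracket uZ.
Qed.

(** * Polynomials invariant under adding points *)

Lemma poly_nat_roots (V : comAlgType rat) (p : {poly V}) :
  (forall n : nat, p.[n%:R] = 0) -> p = 0.
Proof.
move: {2}(size p) (leqnn (size p)) => N; elim: N p => [|N IH] p.
  by rewrite leqn0 size_poly_eq0 => /eqP.
move=> szp roots.
(* [V] may have zero divisors, so roots are not counted: the factor X is split off and the quotient
   translated by 1, which only requires dividing by positive integers. *)
have /factor_theorem[q pq] : root p 0 by apply/eqP; apply: (roots 0%N).
case: (eqVneq q 0) => [q0|q0]; first by rewrite pq q0 mul0r.
pose r := q \Po ('X + 1).
have r0 : r = 0.
  apply: IH => [|n].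
    rewrite (leq_trans (size_comp_poly_leq _ _)) //.
    have -> : size ('X + 1 : {poly V}) = 2%N by rewrite -['X + 1]/('X + 1%:P) size_XaddC.
    move: szp; rewrite pq size_Mmonic ?monicXsubC // size_XsubC addn2 muln1 /=.
    by rewrite ltnS prednK // lt0n size_poly_eq0.
  rewrite /r horner_comp !hornerE natr1.
  have := roots n.+1; rewrite pq hornerM hornerXsubC subr0 mulr_natr.
  exact: alg_torsion_free.
suff qz : q = 0 by rewrite pq qz mul0r.
have -> : q = r \Po ('X - 1).
  by rewrite /r -comp_polyA comp_polyD comp_polyX comp_polyC subrK comp_polyXr.
by rewrite r0 comp_poly0.
Qed.

Lemma pev_eq_in (R S : comNzRingType) (I : choiceType) (f : R -> S)
    (h h' : I -> S) (P : polyring R I) :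
  {in pvars P, h =1 h'} -> pev f h P = pev f h' P.
Proof.
move=> e; rewrite /pev /mmap big_seq [RHS]big_seq; apply: eq_bigr => m mP.
congr (_ * _); rewrite /mev big_seq [RHS]big_seq; apply: eq_bigr => i im.
rewrite e // /pvars mem_undup; apply/flattenP; exists (finsupp m : seq I) => //.
by apply/mapP; exists m.
Qed.

Lemma pev_ext (R S : comNzRingType) (I : choiceType) (f : R -> S)
    (h h' : I -> S) (P : polyring R I) : h =1 h' -> pev f h P = pev f h' P.
Proof. by move=> e; apply: pev_eq_in => i _. Qed.

Lemma pev_id (I : choiceType) (P : polyring rat I) :
  pev (in_alg (polyring rat I)) (fun i => pX rat i) P = P.
Proof.
move: P; apply: polyring_ind => [c|i|P Q IP IQ|P Q IP IQ].
- by rewrite pevC /= malgC_alg.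
- by rewrite pevX.
- by rewrite rmorphD /= IP IQ.
- by rewrite rmorphM /= IP IQ.
Qed.

Lemma pev_pev (S : comNzRingType) (I J : choiceType) (f : {rmorphism rat -> S})
    (a : J -> S) (h : I -> polyring rat J) P :
  pev f a (pev (in_alg (polyring rat J)) h P) = pev f (fun i => pev f a (h i)) P.
Proof.
have e := @rmorph_pev _ S rat I (in_alg (polyring rat J)) h f
  (fun i => pev f a (h i)) (pev f a : {rmorphism _ -> _}).
by apply: e => [c|i] //=; rewrite -malgC_alg pevC.
Qed.

Lemma pevB_shift (S : comNzRingType) (I : choiceType) (f : {rmorphism rat -> S})
    (a : I -> S) i (q : rat) :
  pev f a (pX rat i - q%:A) = a i - f q.
Proof. by rewrite (rmorphB (pev f a)) [X in X - _]pevX -malgC_alg [X in _ - X]pevC. Qed.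

(** Points of weights 1, ..., n with suitable multiplicities realise any n values, by the
    invertibility of a Vandermonde matrix. *)
Lemma point_interpolation (S : comAlgType rat) (c : nat -> S) n :
  exists t : nat -> S, forall e, (e < n)%N ->
    \sum_(b < n) t b * ((b.+1%:R : rat)^-1 * b.+1%:R ^+ e)%:A = c e.
Proof.
pose M := Vandermonde n (\row_(b < n) (b.+1%:R : rat)).
have Mu : M \in unitmx.
  rewrite unitmxE unitfE det_Vandermonde; apply/prodf_neq0 => i _.
  apply/prodf_neq0 => j ij; rewrite !mxE subr_eq0 eqr_nat eqSS.
  by rewrite gtn_eqF.
have WE (e k : 'I_n) : \sum_(b < n) b.+1%:R ^+ e * invmx M b k = (e == k)%:R.
  have := congr1 (fun A : 'M_n => A e k) (mulmxV Mu).
  by rewrite !mxE => <-; apply: eq_bigr => b _; rewrite !mxE.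
exists (fun b => if insub b is Some b' then
  \sum_(k < n) (b.+1%:R * invmx M b' k)%:A * c k else 0) => e en.
have alg_mul (p q : rat) (z : S) : p%:A * z * q%:A = (q * p)%:A * z.
  by rewrite !mulr_algl mulrC mulr_algl scalerA.
transitivity (\sum_(b < n) \sum_(k < n) (b.+1%:R ^+ e * invmx M b k)%:A * c k).
  apply: eq_bigr => b _; rewrite valK mulr_suml; apply: eq_bigr => k _.
  rewrite alg_mul; congr (_%:A * _).
  by rewrite mulrCA -!mulrA mulVKf // pnatr_eq0.
rewrite exchange_big /=; transitivity (\sum_(k < n) (k == Ordinal en)%:R%:A * c k).
  apply: eq_bigr => k _; rewrite -mulr_suml -scaler_suml; congr (_%:A * _).
  by rewrite eq_sym -WE.
rewrite (bigD1 (Ordinal en)) //= eqxx scale1r mul1r big1 ?addr0 // => k ke.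
by rewrite (negbTE ke) scale0r mul0r.
Qed.

(** Iteration gives invariance under integral multiplicities of a point. The dependence on the
    multiplicity is polynomial, so arbitrary multiplicities in the ring follow; by interpolation
    these cancel every variable of [U]. *)
Lemma point_invariant_const (U : polyring rat nat) :
  (forall l : rat, l != 0 ->
    pev (in_alg (polyring rat nat)) (fun e => pX rat e - (l^-1 * l ^+ e)%:A) U = U) ->
  U = pev (in_alg (polyring rat nat)) (fun=> 0) U.
Proof.
set V := polyring rat nat => H.
pose E (a : nat -> V) := pev (in_alg V) a U.
have inv1 a l : l != 0 -> E (fun e => a e - (l^-1 * l ^+ e)%:A) = E a.
  move=> l0; rewrite /E -[in RHS](H l l0) [RHS]pev_pev.
  by apply: pev_ext => e; rewrite [RHS]pevB_shift.
have invn a l n : l != 0 -> E (fun e => a e - n%:R * (l^-1 * l ^+ e)%:A) = E a.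
  move=> l0; elim: n => [|n IH].
    by apply: pev_ext => e; rewrite mul0r subr0.
  rewrite -[RHS]IH -[RHS](inv1 _ l l0); apply: pev_ext => e.
  by rewrite -natr1 mulrDl mul1r opprD addrA.
have invt a l (t : V) : l != 0 -> E (fun e => a e - t * (l^-1 * l ^+ e)%:A) = E a.
  move=> l0.
  pose p : {poly V} := pev (polyC \o in_alg V)
     (fun e => (a e)%:P - 'X * ((l^-1 * l ^+ e)%:A)%:P) U - (E a)%:P.
  have ph s : p.[s] = E (fun e => a e - s * (l^-1 * l ^+ e)%:A) - E a.
    rewrite /p hornerD hornerN hornerC; congr (_ - _).
    apply: (rmorph_pev (u := horner_eval s)) => [c|e].
      exact: hornerC.
    transitivity ((a e)%:P - 'X * ((l^-1 * l ^+ e)%:A)%:P).[s]; first by [].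
    by rewrite hornerD hornerN hornerM !hornerC hornerX.
  have p0 : p = 0 by apply: poly_nat_roots => n; rewrite ph invn // subrr.
  by apply/eqP; rewrite -subr_eq0 -ph p0 horner0.
have invs a n (t : nat -> V) :
    E (fun e => a e - \sum_(b < n) t b * ((b.+1%:R : rat)^-1 * b.+1%:R ^+ e)%:A) = E a.
  elim: n => [|n IH]; first by apply: pev_ext => e; rewrite big_ord0 subr0.
  have nz : (n.+1%:R : rat) != 0 by rewrite pnatr_eq0.
  apply: etrans IH; apply: etrans (invt _ _ (t n) nz).
  by apply: pev_ext => e; rewrite big_ord_recr opprD addrA.
pose n := (\max_(i <- pvars U) i).+1.
have [t tE] := point_interpolation (fun e : nat => pX rat e : V) n.
rewrite -{1}(pev_id U) -[LHS]/(E _) -(invs _ n t); apply: pev_eq_in => e eU.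
rewrite tE ?subrr // ltnS.
exact: (@leq_bigmax_seq _ (pvars U) xpredT (fun i : nat => i) e eU).
Qed.

(** * Comparison with the Faber-Zagier series *)

Definition wick_norm k : nat := ((3 * k)`! * (2 * k)`! * 9 ^ k)%N.

Lemma momentE m : (moment m * 2 ^ m = (2 * m)`!)%N.
Proof.
elim: m => [|m IH]; first by rewrite /moment big_ord0.
have -> : moment m.+1 = (moment m * 'C(2 * m + 2, 2))%N by rewrite /moment big_ord_recr.
have -> : (2 * m.+1 = (2 * m).+2)%N by lia.
rewrite addn2 !factS -IH expnS.
have := mul_bin_diag (2 * m).+2 1; rewrite bin1 /= => e.
by rewrite [RHS]mulnA e mulnACA [RHS]mulnACA; congr (_ * _)%N; apply: mulnC.
Qed.

Lemma wick_norm_rec k a : (a <= k)%N ->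
  ('C(2 * k, 2 * a) * ('C(3 * k, 3 * a) * moment (3 * a)))%:R * (wick_norm (k - a))%:R
  = (wick_norm k)%:R * seriesA a :> rat.
Proof.
move=> ak; rewrite /wick_norm /seriesA.
have e2 := bin_fact (leq_mul (leqnn 2) ak).
have e3 := bin_fact (leq_mul (leqnn 3) ak).
have m3 := momentE (3 * a).
rewrite -{}e2 -{}e3 !mulnBr (_ : 6 * a = 2 * (3 * a))%N; last by lia.
have e9 : (9 ^ k = 9 ^ (k - a) * 9 ^ a)%N by rewrite -expnD subnK.
rewrite -{}m3 expnM (_ : 2 ^ 3 = 8)%N // e9.
(* The 72 of the series A: 8 comes from the pairings in [moment], 9 from the normalisation. *)
rewrite (_ : (72 : rat) = 9%:R * 8%:R); last by rewrite -natrM.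
rewrite exprMn !natrM !natrX.
have f0 n : (n`!%:R : rat) != 0 by rewrite pnatr_eq0 -lt0n fact_gt0.
have := f0 (2 * a)%N; have := f0 (3 * a)%N.
have : (9%:R ^+ a : rat) != 0 by rewrite expf_neq0 // pnatr_eq0.
have : (8%:R ^+ a : rat) != 0 by rewrite expf_neq0 // pnatr_eq0.
set x := (2 * a)`!%:R; set y := (3 * a)`!%:R; set u := 9%:R ^+ a; set v := 8%:R ^+ a.
by move=> v0 u0 y0 x0; field; rewrite x0 y0 u0 v0.
Qed.

(** By [wick_norm_rec] the terms with a > 0 cancel, leaving the difference for k itself. *)
Lemma wick_fz_step (S : comAlgType rat) (z F : nat -> S) (l : rat) k :
  (forall j, (j < k)%N -> z j = (wick_norm j)%:R *: F j) ->
  \sum_(a < k.+1) (l%:A) ^+ a * z (k - a)%N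
     *+ ('C(2 * k, 2 * a) * ('C(3 * k, 3 * a) * moment (3 * a)))
  - (wick_norm k)%:R *: (\sum_(a < k.+1) F (k - a)%N * (seriesA a * l ^+ a)%:A)
  = z k - (wick_norm k)%:R *: F k.
Proof.
move=> h; rewrite !big_ord_recl /= !subn0 !muln0 !bin0 !mul1n expr0 mul1r.
rewrite /moment big_ord0 mulr1n seriesA0 mul1r expr0 scale1r mulr1 scalerDr opprD addrACA.
rewrite [X in _ + X](_ : _ = 0) ?addr0 // scaler_sumr -sumrB big1 // => a _.
rewrite /bump /= add1n h; last by have := ltn_ord a; lia.
have e := wick_norm_rec (ltn_ord a).
apply/eqP; rewrite subr_eq0; apply/eqP.
rewrite -(rmorphXn (in_alg S)) [in_alg S _ * _]mulr_algl -scaler_nat !scalerA.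
rewrite [F _ * _]mulrC mulr_algl scalerA [RHS](_ : _ = (wick_norm k)%:R *
  seriesA a.+1 * l ^+ a.+1 *: F (k - a.+1)%N); last by rewrite mulrA.
by rewrite -e; congr (_ *: _); ring.
Qed.

Local Notation V := (polyring rat nat).

Section WickSeries.
Let gen e : V := pX rat e.

Lemma pev_eval0 (S : comNzRingType) (f : {rmorphism rat -> S}) (a : nat -> S)
    (c : nat -> V) P :
  pev f a (eval0 (in_alg V) c P) = eval0 f (fun e => pev f a (c e)) P.
Proof.
rewrite /eval0 pev_pev; apply: pev_ext => -[[|i] e] //.
exact: (rmorph0 (pev f a)).
Qed.

Lemma pev_algZ (a : nat -> V) (q : rat) (y : V) :
  pev (in_alg V) a (q *: y) = q *: pev (in_alg V) a y.
Proof. by apply: etrans (pevZ _ _ _ _) _; rewrite /= mulr_algl. Qed.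

Lemma pev_fz (a c : nat -> V) k :
  pev (in_alg V) a (fz c k) = fz (fun e => pev (in_alg V) a (c e)) k.
Proof. exact: (fz_rmorph (u := pev (in_alg V) a)) (pev_algZ a). Qed.

Lemma pev_gen_eval0 (a : nat -> V) P :
  pev (in_alg V) a (eval0 (in_alg V) gen P) = eval0 (in_alg V) a P.
Proof.
apply: etrans (pev_eval0 _ _ _ _) _.
by apply: pev_ext => -[[|i] e] //; apply: pevX.
Qed.

Lemma pev_gen_fz (a : nat -> V) k : pev (in_alg V) a (fz gen k) = fz a k.
Proof. by apply: etrans (pev_fz _ _ _) _; apply: fz_local => e _; apply: pevX. Qed.

(** All coefficients of [gauss0] are multiples of variables. *)
Lemma eval0_zero_gauss0 P : eval0 (in_alg V) (fun=> 0) (gauss0 P) = 0.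
Proof.
pose ev : {rmorphism Q0 -> V} := eval0 (in_alg V) (fun=> 0).
have ev0 p : ev (pX rat p) = 0.
  by apply: etrans (pevX _ _ _) _; case: p => -[].
apply: (@rmorph_dop_vanish _ _ _ _ _ _ _ _ ev) => [v w|v].
  rewrite (rmorphN ev) (rmorphMn ev) [X in X *+ _]ev0.
  by rewrite mul0rn oppr0.
by apply: etrans (rmorphMn ev _ _) _; rewrite [X in X *+ _]ev0 mul0rn.
Qed.

(** Given smaller k, the difference of the two sides is invariant under adding points, hence equal
    to its value with all variables 0, where both sides vanish for positive k. Free variables are
    essential: kappa_0 is a fixed number, and adding a point would change it. *)
Lemma wick_fz_gen k : eval0 (in_alg V) gen (wick k) = (wick_norm k)%:R *: fz gen k.
Proof.
elim/ltn_ind: k => -[|k] IH.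
  rewrite /wick !muln0 /= expr0 (rmorph1 (eval0 (in_alg V) gen)) fz0.
  by rewrite /wick_norm !muln0 fact0 expn0 scale1r.
pose U := eval0 (in_alg V) gen (wick k.+1) - (wick_norm k.+1)%:R *: fz gen k.+1.
suff : U = 0 by move/eqP; rewrite subr_eq0 => /eqP.
have pevU a : pev (in_alg V) a U =
    eval0 (in_alg V) a (wick k.+1) - (wick_norm k.+1)%:R *: fz a k.+1.
  have e3 := etrans (pev_algZ a (wick_norm k.+1)%:R _) (congr1 _ (pev_gen_fz a k.+1)).
  apply: etrans (rmorphB (pev (in_alg V) a) _ _) _.
  exact: (congr2 (fun y z : V => y - z) (pev_gen_eval0 a _) e3).
have -> : U = pev (in_alg V) (fun=> 0) U.
  apply: point_invariant_const => l l0; apply: etrans (pevU _) _.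
  have e1 := wick_add_point (in_alg V) gen k.+1 l0.
  have e2 := fz_add_point gen k.+1 l0.
  have e3 := wick_fz_step l IH.
  by apply: etrans e3; rewrite -e2 -e1.
apply: etrans (pevU _) _.
rewrite [X in _ *: X]fz_zero scaler0 subr0.
by rewrite /wick mulnS add3n iterS; apply: eval0_zero_gauss0.
Qed.

Lemma wick_fz (c : nat -> V) k :
  eval0 (in_alg V) c (wick k) = (wick_norm k)%:R *: fz c k.
Proof.
have e0 := congr1 (pev (in_alg V) c) (wick_fz_gen k).
apply: etrans (esym (pev_gen_eval0 c (wick k))) _; apply: etrans e0 _.
apply: etrans (pev_algZ _ _ _) _.
exact: (congr1 (fun y => _ *: y) (pev_gen_fz c k)).
Qed.
End WickSeries.

Lemma pidx_parity (v : pidx) : odd (fstp v) = odd (sndp v).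
Proof. exact/eqP/(valP v). Qed.

Definition step (v : pidx) : Qpsi_p := pvar ((fstp v)%:Z - 2) (sndp v)%:Z.

(** * The Polishchuk operator *)

Local Notation half2 := ((2^-1 : rat)%:P%:MP : Qpsi_p).

Lemma polishchukE P :
  polishchuk P = pdop half2 polcoef step P.
Proof. by rewrite /polishchuk /pdop /dop mul_malgC. Qed.

Lemma carre_polishchuk P Q :
  carre polishchuk P Q = carre (pdop half2 polcoef step) P Q.
Proof. exact: (eq_carre P Q polishchukE). Qed.

Lemma polishchuk_diffop2 : diffop2 polishchuk.
Proof. exact: (eq_diffop2 polishchukE (pdop_diffop2 half2 polcoef step)). Qed.

Lemma polishchukC c : polishchuk c%:MP = 0.
Proof. by rewrite polishchukE; exact: pdopC. Qed.

Lemma carre_polishchukC c P : carre polishchuk c%:MP P = 0.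
Proof. by rewrite carre_polishchuk; exact: carre_pdopC. Qed.

Lemma polishchukX v : polishchuk (pX Qpsi v) = step v.
Proof. by rewrite polishchukE; exact: pdopX. Qed.

Lemma half_doublep (P : Qpsi_p) : half2 * (P + P) = P.
Proof.
rewrite mul_malgC -mulr2n -scaler_nat scalerA -polyC_natr -polyCM mulVf //.
exact: scale1r.
Qed.

Lemma polbinC i k : polbin i k = polbin k i.
Proof.
rewrite /polbin orbC; case: i k => [|i] [|k] //=.
by rewrite !subn1 addnC -bin_sub; [congr 'C(_, _)|]; lia.
Qed.

Lemma polcoefC v w : polcoef v w = polcoef w v.
Proof.
rewrite /polcoef polbinC (addrC (fstp v)%:Z (fstp w)%:Z) (addrC (sndp v)%:Z (sndp w)%:Z).
by rewrite [pvar _ _ * pvar _ _]mulrC; reflexivity.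
Qed.

Lemma carre_polishchukX v w : carre polishchuk (pX Qpsi v) (pX Qpsi w) = polcoef v w.
Proof.
rewrite carre_polishchuk; apply: etrans (carre_pdopX half2 polcoef step v w) _.
by rewrite (polcoefC w); exact: half_doublep.
Qed.

Lemma pvar_pidx (v : pidx) : pvar (fstp v) (sndp v) = pX Qpsi v.
Proof.
rewrite /pvar; have -> : (fstp v, sndp v) = val v by rewrite /fstp /sndp -surjective_pairing.
by rewrite valK.
Qed.

Lemma pvarP (i j : nat) : odd i = odd j ->
  exists2 v : pidx, pvar i j = pX Qpsi v & fstp v = i /\ sndp v = j.
Proof.
move=> ij; have pij : odd (i, j).1 == odd (i, j).2 by apply/eqP.
by exists (Sub (i, j) pij : pidx); rewrite -?pvar_pidx /fstp /sndp SubK.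
Qed.

Lemma pvar_negl i j : i < 0 -> pvar i j = 0.
Proof. by case: i. Qed.

Lemma pvar_negr i j : j < 0 -> pvar i j = 0.
Proof. by case: i; case: j. Qed.

(** * The specialisation at a nonzero rational l *)

Section Specialization.
Variable l : rat.
Hypothesis l0 : l != 0.
Local Notation L := (gauss1 l).

Definition truncate : Qpsi_p -> Qpsi_p :=
  pev (in_alg Qpsi_p) (fun v => if (fstp v <= sndp v + 2)%N then pX Qpsi v else 0).

HB.instance Definition _ := GRing.RMorphism.copy truncate
  (pev (in_alg Qpsi_p) (fun v => if (fstp v <= sndp v + 2)%N then pX Qpsi v else 0)).

Definition half1 : Q1 := (2^-1)%:MP.
Definition ifact1 i : Q1 := (i`!%:R^-1)%:MP.
Definition hvar1 : nat -> nat -> Q1 := hvar (fun o => pX rat o) l%:MP half1 ifact1.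

Definition specialize : Qpsi_p -> Q1 :=
  pev (in_alg Q1 \o horner_eval l) (fun v => hvar1 (fstp v) (sndp v)).

HB.instance Definition _ := GRing.RMorphism.copy specialize
  (pev (in_alg Q1 \o horner_eval l) (fun v => hvar1 (fstp v) (sndp v))).

Lemma is_const_malgC c : is_const L c%:MP.
Proof. by split=> [|b]; [apply: pdopC|apply: carre_pdopC]. Qed.

Lemma malgCMn (c : rat) n : (c%:MP : Q1) *+ n = (c *+ n)%:MP.
Proof. by rewrite !malgC_alg scalerMnl. Qed.

Lemma truncateC c : truncate c%:MP = c%:MP.
Proof. by apply: etrans (pevC _ _ _) _; rewrite /= -malgC_alg. Qed.

Lemma truncateX v :
  truncate (pX Qpsi v) = if (fstp v <= sndp v + 2)%N then pX Qpsi v else 0.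
Proof. exact: pevX. Qed.

Lemma truncate_pvar (i j : nat) : (i <= j + 2)%N -> truncate (pvar i j) = pvar i j.
Proof.
move=> ij; rewrite /pvar; case: insubP => [v _ /= ev|_]; last exact: (rmorph0 truncate).
have e1 : fstp v = i := congr1 fst ev.
have e2 : sndp v = j := congr1 snd ev.
by apply: etrans (truncateX v) _; rewrite e1 e2 ij.
Qed.

Lemma specializeC c : specialize c%:MP = (c.[l])%:MP.
Proof. by apply: etrans (pevC _ _ _) _; rewrite /= -malgC_alg. Qed.

Lemma specializeX v : specialize (pX Qpsi v) = hvar1 (fstp v) (sndp v).
Proof. exact: pevX. Qed.

Lemma specialize_pvar (i j : nat) : odd i = odd j -> specialize (pvar i j) = hvar1 i j.
Proof. by move=> /pvarP[v -> [<- <-]]; apply: specializeX. Qed.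

Lemma malgC1E : (1 : rat)%:MP = 1 :> Q1.
Proof. by rewrite malgC_alg scale1r. Qed.

Lemma descent_specialize (S : comAlgType rat) (f : {rmorphism rat -> S}) (c : nat -> S) n m :
  c 0%N = f l^-1 -> c 1%N + 1 = (2 * n)%:R ->
  eval1 f c (specialize (iter n.+1 polishchuk (pvar 3 1 ^+ m))) =
  f (6^-1) ^+ m * eval1 f c (iter n.+1 L (rhat (fun o => pX rat o) (l^-1)%:MP 3 ^+ m)).
Proof.
move=> c0 c1.
have e6 : eval1 f c (ifact1 3) = f (6^-1) by apply: eval1C.
rewrite -e6.
apply: (@descent_cubic Q1 rat (fun a => a%:MP) (fun o => pX rat o) _ l%:MP (l^-1)%:MP L
  _ (gauss1_diffop2 l) _ _ _ _ _ _ (gauss1_x l) (gauss1_r l) (carre_gauss1_xx l)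
  (carre_gauss1_xr l) (carre_gauss1_rr l) _ half1 ifact1 _ (is_const_malgC _) _ _ _
  Qpsi_p Qpsi (fun a => a%:MP) pidx (fun v => pX Qpsi v) _ fstp sndp 'X%:MP pvar polishchuk
  pidx_parity polishchuk_diffop2 polishchukC carre_polishchukC polishchukX _ pvar_negl pvar_negr
  truncate _ _ _ _ specialize _ _ _ _ S (eval1 f c) _ _ _ n m).
- exact: polyring_ind.
- by rewrite mul_malgC malgC_alg scalerA mulfV // scale1r.
- by move=> a; apply: pdopC.
- by move=> a P; apply: carre_pdopC.
- exact: pdopC.
- by move=> P; apply: carre_pdopC.
- exact: pdopC.
- by move=> P; apply: carre_pdopC.
- exact: alg_torsion_free.
- by rewrite malgCMn -[_ *+ 2]mulr_natr mulVf // malgC1E.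
- move=> i; rewrite malgCMn; congr (_%:MP).
  by rewrite factS natrM invfM -[LHS]mulr_natr mulrAC mulVf ?mul1r // pnatr_eq0.
- by move=> i; rewrite malgCMn -[_ *+ _]mulr_natr mulVf ?malgC1E // pnatr_eq0 -lt0n fact_gt0.
- by move=> i; apply: is_const_malgC.
- exact: polyring_ind.
- by move=> v w; rewrite mul_malgC; exact: carre_polishchukX.
- exact: truncateC.
- exact: truncateC.
- exact: truncateX.
- exact: truncate_pvar.
- by move=> a; exact: (eq_ind_r (is_const L) (is_const_malgC a.[l]) (specializeC a)).
- by apply: etrans (specializeC _) _; rewrite hornerX.
- exact: specializeX.
- exact: specialize_pvar.
- exact: eval1_x.
- by move=> i e; apply: eval1_r.
- by rewrite [LHS]eval1_r [RHS]eval1C.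
- exact: alg_torsion_free.
- by rewrite [X in X + 1]eval1_r.
Qed.
End Specialization.

(** <K^e> without the marked point; the entry at 0 fixes kappa_(-1) = 0, so that the marked point
    alone makes <1> equal to 1/l. *)
Definition shifted_kappa (g e : nat) : V := if e is r.+1 then kappa g r else 0.

Definition fz_coef k : rat := (6^-1) ^+ (2 * k) * (wick_norm k)%:R.

Lemma fz_shifted_kappa g k : fz (shifted_kappa g) k = faber_zagier g k.
Proof. by []. Qed.

Definition point_kappa g (l : rat) e : V := (l^-1 * l ^+ e)%:A + shifted_kappa g e.

Lemma rhat_split_point l :
  rhat (fun o => pX rat o) (l^-1)%:MP 3 = split_point l (pX rat (3, 0)%N).
Proof.
apply: etrans (esym (split_point_r l 3 0)); rewrite /rhat; congr (_ - _ * _).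
by rewrite expr0; exact: esym (mulr1 _).
Qed.

Lemma iter_intertwine (A B : Type) (u : A -> B) (D : A -> A) (L : B -> B) n P :
  (forall P, L (u P) = u (D P)) -> iter n L (u P) = u (iter n D P).
Proof. by move=> e; elim: n => //= n ->. Qed.

Lemma top_relation k g l : (1 <= k)%N -> g = (3 * k - 1)%N -> l != 0 ->
  eval1 (in_alg V) (point_kappa g l)
    (specialize l (iter (3 * k) polishchuk (pvar 3 1 ^+ (2 * k))))
  = fz_coef k *: faber_zagier g k.
Proof.
(* The number of operators is one more than the genus, as [expect_rhat2] demands. *)
move=> k1 gk l0; have -> : (3 * k = g.+1)%N by lia.
have c0 : point_kappa g l 0 = in_alg V l^-1.
  by rewrite /point_kappa expr0 mulr1 addr0.
have c1 : point_kappa g l 1 + 1 = (2 * g)%:R.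
  rewrite /point_kappa expr1 mulVf // scale1r [shifted_kappa _ _]/((2 * g - 2)%N%:R).
  set m := (2 * g - 2)%N; have -> : (2 * g = 1 + m + 1)%N by rewrite /m; lia.
  by rewrite [in RHS]natrD [in RHS]natrD.
rewrite (descent_specialize l0 (2 * k) c0 c1) rhat_split_point.
have -> : split_point l (pX rat (3, 0)%N) ^+ (2 * k) = split_point l (pX rat (3, 0)%N ^+ (2 * k)).
  by apply: esym; apply: (rmorphXn (split_point l)).
rewrite (iter_intertwine _ _ (fun P => gauss1_split_point P l0)).
rewrite eval1_split_point.
have -> : g.+1 = (3 * k)%N by lia.
rewrite -[iter _ _ _]/(wick k).
(* Forgetting the marked point removes exactly the contribution put in by [point_kappa]; the
   dependence on l ends here. *)
have -> : eval0 (in_alg V) (fun e => point_kappa g l e - in_alg V (l^-1 * l ^+ e)) (wick k)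
   = eval0 (in_alg V) (shifted_kappa g) (wick k).
  have e0 e : point_kappa g l e - in_alg V (l^-1 * l ^+ e) = shifted_kappa g e.
    by rewrite /point_kappa addrC addKr.
  by apply: pev_ext => -[[|i] e]; [exact: e0|].
rewrite wick_fz fz_shifted_kappa -(rmorphXn (in_alg V)) /= mulr_algl scalerA.
by rewrite /fz_coef; congr (_ *: _).
Qed.

(** * The weight of the Polishchuk operator *)

Section EulerGen.
Variables (R : comNzRingType) (I : choiceType) (wt : I -> nat).
Definition euler : polyring R I -> polyring R I :=
  pdop 0 (fun _ _ => 0) (fun v => pX R v *+ wt v).

Lemma euler_derivation : derivation euler.
Proof.
apply: dop_derivation; [exact: pderiv_derivation|exact: pderivCA| |by []].
by move=> W F s P; apply: pvars_sum.
Qed.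

Lemma eulerC c : euler c%:MP = 0. Proof. exact: pdopC. Qed.
Lemma eulerX v : euler (pX R v) = pX R v *+ wt v. Proof. exact: pdopX. Qed.
End EulerGen.

Local Notation E := (euler fstp : Qpsi_p -> Qpsi_p).

(** The absolute value does no harm, since p_(i,j) is 0 for negative i. *)
Lemma euler_pvar (i j : int) : E (pvar i j) = pvar i j *+ `|i|%N.
Proof.
have E0 : E 0 = 0 := derivation0 (euler_derivation _ _).
case: i => [i|i]; last by rewrite E0 mul0rn.
case: j => [j|j]; last by rewrite E0 mul0rn.
rewrite /pvar; case: insubP => [v _ ev|_]; last by rewrite E0 mul0rn.
by rewrite eulerX; congr (_ *+ _); exact: (congr1 fst ev).
Qed.

Lemma euler_polcoef v w :
  E (polcoef v w) = polcoef v w *+ fstp v + polcoef v w *+ fstp w - polcoef v w *+ 2.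
Proof.
have hE := euler_derivation Qpsi fstp.
rewrite /polcoef; case: (fstp v) => [|i].
  rewrite [pvar (0%N%:Z - 1) _]pvar_negl // mul0r scaler0 /polbin mulr0n subr0.
  by rewrite (derivation0 hE) !mul0rn subr0 addr0; reflexivity.
case: (fstp w) => [|k].
  rewrite [pvar (0%N%:Z - 1) _]pvar_negl // mulr0 scaler0 /polbin orbT mulr0n subr0.
  by rewrite (derivation0 hE) !mul0rn subr0 addr0; reflexivity.
rewrite -mul_malgC.
have -> : i.+1%:Z + k.+1%:Z - 2 = (i + k)%N by lia.
have -> : i.+1%:Z - 1 = i by lia.
have -> : k.+1%:Z - 1 = k by lia.
by apply: derivation_homogeneous => //; [exact: eulerC|exact: euler_pvar|exact: euler_pvar|exact: euler_pvar].
Qed.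

Lemma euler_polishchuk P : E (polishchuk P) = polishchuk (E P) - polishchuk P *+ 2.
Proof.
have hE := euler_derivation Qpsi fstp.
have hD := polishchuk_diffop2.
apply: (derivation_commutator (@polyring_ind Qpsi pidx) hE hD (@eulerC _ _ _) polishchukC carre_polishchukC).
  move=> v; rewrite eulerX (diffop2Mn hD) polishchukX /step euler_pvar.
  case: (fstp v) => [|[|i]]; [by rewrite pvar_negl // !mul0rn subr0|by rewrite pvar_negl // !mul0rn subr0|].
  by rewrite -mulrnBr //; congr (_ *+ _); lia.
have e1 v w : carre polishchuk (E (pX Qpsi v)) (pX Qpsi w) = polcoef v w *+ fstp v.
  by rewrite eulerX (carreMn hD) carre_polishchukX.
have e2 v w : carre polishchuk (pX Qpsi v) (E (pX Qpsi w)) = polcoef v w *+ fstp w.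
  by rewrite (carreC polishchuk) e1 polcoefC.
by move=> v w; rewrite e1 e2 carre_polishchukX; exact: euler_polcoef.
Qed.

Definition grade : Qpsi_p -> {poly Qpsi_p} :=
  pev (polyC \o in_alg Qpsi_p) (fun v => (pX Qpsi v)%:P * 'X^(fstp v)).
HB.instance Definition _ := GRing.RMorphism.copy grade
  (pev (polyC \o in_alg Qpsi_p) (fun v => (pX Qpsi v)%:P * 'X^(fstp v))).

Definition weight0 : Qpsi_p -> Qpsi_p :=
  pev (in_alg Qpsi_p) (fun v => if fstp v == 0%N then pX Qpsi v else 0).
HB.instance Definition _ := GRing.RMorphism.copy weight0
  (pev (in_alg Qpsi_p) (fun v => if fstp v == 0%N then pX Qpsi v else 0)).

Definition weight0_p0 : Qpsi_p -> Qpsi_p0 :=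
  pev (in_alg Qpsi_p0) (fun v => if fstp v == 0%N then pX Qpsi (sndp v)./2 else 0).

HB.instance Definition _ := GRing.RMorphism.copy incl_p0
  (pev (in_alg Qpsi_p) (fun n => pvar 0 (2 * n)%N)).

Lemma incl_p0C c : incl_p0 c%:MP = c%:MP.
Proof. by apply: etrans (pevC _ _ _) _; rewrite /= -malgC_alg. Qed.

Lemma incl_p0X n : incl_p0 (pX Qpsi n) = pvar 0 (2 * n)%N.
Proof. exact: pevX. Qed.

(** The parity condition makes the second index even when the first is 0, so halving it loses
    nothing. *)
Lemma incl_weight0 P : incl_p0 (weight0_p0 P) = weight0 P.
Proof.
apply: (rmorph_pev (u := incl_p0)) => [c|v].
  by rewrite /= -malgC_alg; exact: etrans (incl_p0C c) (malgC_alg _ _).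
have par := pidx_parity v.
case: eqP => [v0|_]; last exact: (rmorph0 incl_p0).
apply: etrans (incl_p0X _) _; rewrite -pvar_pidx v0; congr (pvar 0 _%:Z).
by move: par; rewrite v0; lia.
Qed.

Lemma Qpsi_p_torsion_free (a : Qpsi_p) j : a *+ j.+1 = 0 -> a = 0.
Proof.
move=> /(congr1 (fun b => (j.+1%:R^-1 : rat)%:P *: b)).
rewrite scaler0 -scaler_nat scalerA -polyC_natr -polyCM mulVf ?pnatr_eq0 //.
by rewrite scale1r.
Qed.

Lemma incl_top k : incl_p0 (weight0_p0 (iter (3 * k) polishchuk (pvar 3 1 ^+ (2 * k))))
  = iter (3 * k) polishchuk (pvar 3 1 ^+ (2 * k)).
Proof.
rewrite incl_weight0; set Q := iter _ _ _.
have hE := euler_derivation Qpsi fstp.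
apply: (euler_kernel (@polyring_ind Qpsi pidx) Qpsi_p_torsion_free hE (@eulerC _ _ _)
  (@eulerX _ _ _) (grade := grade)) => [c|v|c|v|].
- by apply: etrans (pevC _ _ _) _; rewrite /= -malgC_alg.
- exact: pevX.
- by apply: etrans (pevC _ _ _) _; rewrite /= -malgC_alg.
- exact: pevX.
have e3 : E (pvar 3 1 ^+ (2 * k)) = pvar 3 1 ^+ (2 * k) *+ (6 * k).
  case: (k) => [|m]; first by rewrite muln0 expr0 mulr0n; exact: (derivation1 hE).
  have -> : (2 * m.+1 = (2 * m).+2)%N by lia.
  rewrite (derivationX hE) euler_pvar mulrnAr -exprSr -mulrnA.
  by congr (_ *+ _); rewrite (_ : `|3|%N = 3%N) //; lia.
have h6 : (2 * (3 * k) <= 6 * k)%N by lia.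
have := derivation_commutator_iter hE euler_polishchuk (diffop2Mn polishchuk_diffop2) h6 e3.
by have -> : (6 * k - 2 * (3 * k) = 0)%N by lia.
Qed.

(** * The relation on the universal curve *)

Lemma rmorph_p0_formula (R S : comNzRingType) (u : {rmorphism R -> S}) e ps kap n :
  u (p0_formula e ps kap n) = p0_formula (u \o e) (u ps) (u \o kap) n.
Proof.
rewrite /p0_formula rmorphD rmorphM rmorphXn rmorph_sum; congr (_ * _ + _) => /=.
by apply: eq_bigr => r _; rewrite rmorphMn rmorphM rmorphXn.
Qed.

Lemma eq_p0_formula (R : comNzRingType) (e e' : rat -> R) ps ps' (kap kap' : nat -> R) n :
  e =1 e' -> ps = ps' -> kap =1 kap' -> p0_formula e ps kap n = p0_formula e' ps' kap' n.
Proof.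
move=> ee <- ek; rewrite /p0_formula ee; congr (_ * _ + _).
by apply: eq_bigr => r _; rewrite ek.
Qed.

HB.instance Definition _ g := GRing.RMorphism.copy (subst_p0 g)
  (pev (map_poly (in_alg Qkappa))
      (p0_formula (fun q => (in_alg Qkappa q)%:P) 'X
                  (fun r => (kappa g r)%:P))).

(** The bridge between the Gaussian model and the geometric substitution: on weight 0 they agree
    once psi is set to l. *)
Lemma specialize_incl g (l : rat) (P : Qpsi_p0) : l != 0 ->
  eval1 (in_alg V) (point_kappa g l) (specialize l (incl_p0 P)) = (subst_p0 g P).[l%:A].
Proof.
move=> l0; pose ev : {rmorphism _ -> V} := eval1 (in_alg V) (point_kappa g l).
pose f : {rmorphism Qpsi -> V} := in_alg V \o horner_eval l.
pose h n := p0_formula (in_alg V) l%:A (kappa g) n.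
transitivity (pev f h P).
  apply: (rmorph_pev (u := ev \o specialize l)) => [c|n].
    rewrite /= -malgC_alg; apply: etrans (congr1 ev (specializeC _ _)) _.
    exact: eval1C.
  apply: etrans (congr1 ev (@specialize_pvar l 0 (2 * n) _)) _; first by rewrite oddM.
  apply: rmorph_hvar0 => //.
  - by apply: etrans (eval1C _ _ _) _; rewrite fact0 invr1; exact: (rmorph1 (in_alg V)).
  - exact: eval1C.
  - exact: eval1C.
  - by move=> e; apply: eval1_r.
apply: esym; apply: (rmorph_pev (u := horner_eval (l%:A : V))) => [c|n].
  exact: (horner_map (in_alg V) c l).
apply: etrans (rmorph_p0_formula _ _ _ _ _) _.
by apply: eq_p0_formula => [q||r]; [apply: hornerC|apply: hornerX|apply: hornerC].
Qed.

Lemma poly_rat_roots (p : {poly V}) : (forall l : rat, l != 0 -> p.[l%:A] = 0) -> p = 0.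
Proof.
(* The factor X supplies the root 0, about which the hypothesis says nothing. *)
move=> p0; have Xp : 'X * p = 0.
  apply: poly_nat_roots => n; rewrite hornerM hornerX.
  case: n => [|n]; first by rewrite mul0r.
  by rewrite -[n.+1%:R](rmorph_nat (in_alg V)) p0 ?mulr0 // pnatr_eq0.
by apply/polyP => i; have := congr1 (fun q : {poly V} => q`_i.+1) Xp; rewrite coefXM !coef0.
Qed.

Definition top_p0 k : Qpsi_p0 :=
  weight0_p0 (iter (3 * k) polishchuk (pvar 3 1 ^+ (2 * k))).

Lemma subst_top k g : (1 <= k)%N -> g = (3 * k - 1)%N ->
  subst_p0 g (top_p0 k) = (fz_coef k *: faber_zagier g k)%:P.
Proof.
move=> k1 gk; apply/eqP; rewrite -subr_eq0; apply/eqP; apply: poly_rat_roots => l l0.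
rewrite hornerD hornerN hornerC -specialize_incl // incl_top.
by rewrite top_relation // subrr.
Qed.

Lemma pushforward_XC g (a : V) : pushforward g ('X * a%:P) = a * (2 * g - 2)%N%:R.
Proof.
have cX i : ('X * a%:P)`_i.+1 = if i is 0%N then a else 0.
  by rewrite coefXM coefC; case: i.
have szX : (size ('X * a%:P)%R <= 2)%N.
  by apply/leq_sizeP => -[|[|j]] // _; rewrite cX.
rewrite /pushforward; set n := (size _).-1.
have : (n <= 1)%N by move: szX; rewrite /n; case: (size _) => [|[|[]]].
case En : n => [|[|m]] // _; last by rewrite big_ord1 cX.
rewrite big_ord0.
have -> : a = 0; last by rewrite mul0r.
by rewrite -(cX 0%N) nth_default //; move: En; rewrite /n; case: (size _) => [|[]].
Qed.

(** * Transfer to Chow rings *)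

Section ChowModel.
Variables (g : nat) (M : chow_model g).
Local Notation K := (clK M).

HB.instance Definition _ := GRing.RMorphism.copy (evM M)
  (pev (in_alg (CHM M)) (fun n => push M (K ^+ n.+2))).
HB.instance Definition _ := GRing.RMorphism.copy (evC M)
  (horner_eval K \o map_poly (pull M \o evM M)).
HB.instance Definition _ := GRing.RMorphism.copy (evJ M)
  (pev (horner_alg (pullJ M K)) (@clp g M)).

Lemma evMZ q x : evM M (q *: x) = q *: evM M x.
Proof. by apply: etrans (pevZ _ _ _ _) _; rewrite /= mulr_algl. Qed.

Lemma evC_C x : evC M x%:P = pull M (evM M x).
Proof.
have e : map_poly (pull M \o evM M) x%:P = (pull M (evM M x))%:P := map_polyC _ _.
exact: etrans (congr1 (horner_eval K) e) (hornerC _ _).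
Qed.

Lemma evC_X : evC M 'X = K.
Proof.
have e : map_poly (pull M \o evM M) 'X = 'X := map_polyX _.
exact: etrans (congr1 (horner_eval K) e) (hornerX _).
Qed.

Lemma evM_kappa r : evM M (kappa g r) = push M (K ^+ r.+1).
Proof.
case: r => [|r]; last exact: pevX.
by rewrite expr1 push_clK; exact: (rmorph_nat (evM M)).
Qed.

Lemma pull_alg (q : rat) : pull M (evM M q%:A) = q%:A.
Proof. by rewrite evMZ linearZ (rmorph1 (evM M)) (rmorph1 (pull M)). Qed.

Lemma pullJ_alg (q : rat) : pullJ M q%:A = q%:A.
Proof. by rewrite linearZ (rmorph1 (pullJ M)). Qed.

(** Two ring maps that agree on psi and, by [clp0], on each p_(0,2n). *)
Lemma evJ_incl P : evJ M (incl_p0 P) = pullJ M (evC M (subst_p0 g P)).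
Proof.
pose f : {rmorphism Qpsi -> CHJ M} := horner_alg (pullJ M K).
pose h n := pullJ M (p0_formula (in_alg (CHC M)) K
  (fun r => pull M (push M (K ^+ r.+1))) n).
transitivity (pev f h P).
  apply: (rmorph_pev (u := evJ M)) => [c|n].
    by rewrite /= -malgC_alg; exact: pevC.
  have [v -> [v0 v2]] := @pvarP 0 (2 * n) (esym (oddM 2 n)).
  by apply: etrans (pevX _ _ _) _; apply: clp0.
apply: esym; apply: (rmorph_pev (u := pullJ M \o evC M)) => [c|n].
  have eC : map_poly (pull M \o evM M) (map_poly (in_alg V) c) = map_poly (in_alg (CHC M)) c.
    by rewrite -map_poly_comp; apply: eq_map_poly => q; apply: pull_alg.
  have eJ : map_poly (pullJ M) (map_poly (in_alg (CHC M)) c) = map_poly (in_alg (CHJ M)) c.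
    by rewrite -map_poly_comp; apply: eq_map_poly => q; apply: pullJ_alg.
  apply: etrans (congr1 (fun p => pullJ M p.[K]) eC) _.
  by rewrite -horner_map; exact: (congr1 (fun p : {poly _} => p.[_]) eJ).
rewrite /h /=; congr (pullJ M _); apply: etrans (rmorph_p0_formula _ _ _ _ _) _.
apply: eq_p0_formula => [q||r].
- by apply: etrans (evC_C _) _; exact: pull_alg.
- exact: evC_X.
- by apply: etrans (evC_C _) _; rewrite evM_kappa.
Qed.

Lemma iter_polishchuk_relation n P : evJ M P = 0 -> evJ M (iter n polishchuk P) = 0.
Proof. by move=> P0; elim: n => //= n; apply: polishchuk_relation. Qed.
End ChowModel.

Lemma fz_coef_neq0 k : fz_coef k != 0.
Proof.
rewrite /fz_coef mulf_neq0 ?expf_neq0 // pnatr_eq0 /wick_norm !muln_eq0 !negb_or.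
by rewrite -!lt0n !fact_gt0 expn_gt0.
Qed.

Theorem theorem3p10 (k g : nat) (hk : (1 <= k)%N) (hg : g = (3 * k - 1)%N) :
  exists (P : Qpsi_p0) (c c' : rat),
    [/\ incl_p0 P = iter (3 * k) polishchuk (pvar 3 1 ^+ (2 * k)),
        c != 0 /\ subst_p0 g P = (c *: faber_zagier g k)%:P,
        c' != 0 /\
        pushforward g ('X * subst_p0 g P) = c' *: faber_zagier g k
      & forall M : chow_model g,
          [/\ evC M (subst_p0 g P) = c *: pull M (evM M (faber_zagier g k)),
              push M (clK M * evC M (subst_p0 g P))
                = c' *: evM M (faber_zagier g k)
            & evJ M (pvar 3 1 ^+ (2 * k)) = 0 ->
              [/\ evC M (subst_p0 g P) = 0,
                  pull M (evM M (faber_zagier g k)) = 0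
                & evM M (faber_zagier g k) = 0]]].
Proof.
have c0 := fz_coef_neq0 k.
have e0 := subst_top hk hg.
(* The extra factor is the pushforward of K, nonzero because g is at least 2. *)
pose c := fz_coef k; pose c' := c * (2 * g - 2)%N%:R.
have c'0 : c' != 0 by rewrite mulf_neq0 // pnatr_eq0; lia.
have evC0 (M : chow_model g) :
    evC M (subst_p0 g (top_p0 k)) = c *: pull M (evM M (faber_zagier g k)).
  by rewrite e0 evC_C evMZ linearZ.
have push0 (M : chow_model g) :
    push M (clK M * evC M (subst_p0 g (top_p0 k))) = c' *: evM M (faber_zagier g k).
  rewrite evC0 -linearZ mulrC projection_formula push_clK mulr_natr /=.
  by rewrite -scaler_nat scalerA mulrC.
exists (top_p0 k), c, c'; split=> [|||M].
- exact: incl_top.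
- by [].
- split=> //; rewrite e0 pushforward_XC mulr_natr -scaler_nat scalerA.
  by rewrite mulrC.
split=> // rel0.
have z0 : evC M (subst_p0 g (top_p0 k)) = 0.
  (* The Polishchuk operator keeps the relation on J_g; once it involves only the p_(0,2n),
     injectivity of the pullback brings it down to C_g. *)
  apply: pullJ_inj; rewrite -evJ_incl rmorph0 incl_top.
  exact: iter_polishchuk_relation.
split=> //.
  by move/eqP: (evC0 M); rewrite z0 eq_sym scaler_eq0 (negbTE c0) => /eqP.
by move/eqP: (push0 M); rewrite z0 mulr0 linear0 eq_sym scaler_eq0 (negbTE c'0) => /eqP.
Qed.
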